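(* Let $A = A_1 \ast \dots \ast A_n \ast B$ be a free product decomposition with $B$ a finitely generated free group, and with at least two of the factors $A_1,\dots,A_n,B$ non-trivial. Let $H \leqslant \mathrm{Out}(A, \{A_1, \dots, A_n \})$ be a finite subgroup, and suppose that the factors $A_i$ are finitely generated. Then $H$ fixes a point in the graph of relative free splittings $\mathcal{FS}(A, \{A_1, \dots, A_n \})$.
   Context: $\mathrm{Out}(A, \{A_1, \dots, A_n \})$ is the subgroup of $\mathrm{Out}(A)$ consisting of those outer automorphisms which preserve the decomposition, i.e. which send each $A_i$ ($1\le i\le n$), up to conjugation in $A$, to some $A_j$ with $1 \le j \le n$ (no condition on $B$). The graph of relative free splittings $\mathcal{FS}(A, \{A_1, \dots, A_n\})$ (Handel--Mosher) is defined as follows. Its vertices are finite non-trivial graphs of groups with fundamental group (identified with) $A$, with trivial edge groups, such that each $A_i$ is contained in a conjugate of a vertex group; here non-trivial means that $A$ does not fix a vertex of the associated Bass--Serre tree (universal cover). Two such graphs of groups define the same vertex when the associated universal covers are $A$-equivariantly isometric (all edges having length $1$). Two vertices are connected by an edge if and only if the graphs of groups admit a common refinement. The group $\mathrm{Out}(A, \{A_1, \dots, A_n \})$ acts on this graph by changing the identification of the fundamental group with $A$ (equivalently, by twisting the $A$-action on the Bass--Serre tree by automorphisms). *)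

(* Defs.v *)
From HB Require Import structures.
From mathcomp Require Import all_boot all_order all_algebra.
From mathcomp Require Import generic_quotient.
From mathcomp Require Import boolp classical_sets cardinality reals.

Set Implicit Arguments.
Unset Strict Implicit.
Unset Printing Implicit Defensive.

Local Open Scope quotient_scope.
Local Open Scope group_scope.

Definition nontrivial_group (G : groupType) : Prop := exists x : G, x <> 1.

Definition finitely_generated (G : groupType) : Prop :=
  exists s : seq G, forall P : G -> Prop,
    P 1 -> (forall x y, P x -> P y -> P (x * y^-1)) ->
    (forall x, x \in s -> P x) -> forall x, P x.

Definition free_of_finite_rank (B : groupType) : Prop :=
  exists (k : nat) (b : 'I_k -> B),
    forall (K : groupType) (f : 'I_k -> K),
      exists F : {multiplicative B -> K},
        (forall i, F (b i) = f i) /\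
        forall F' : {multiplicative B -> K}, (forall i, F' (b i) = f i) -> F' =1 F.

(* A = A_1 * ... * A_n * B, the factors being given with their inclusions:
   A is the coproduct in the category of groups (injectivity of the inclusions
   follows). *)
Definition is_free_product (A : groupType) (n : nat) (Ai : 'I_n -> groupType)
    (B : groupType) (iA : forall i, {multiplicative Ai i -> A})
    (iB : {multiplicative B -> A}) : Prop :=
  forall (K : groupType) (f : forall i, {multiplicative Ai i -> K})
         (g : {multiplicative B -> K}),
    let extends (F : {multiplicative A -> K}) :=
      (forall i x, F (iA i x) = f i x) /\ (forall y, F (iB y) = g y) in
    exists F, extends F /\ forall F', extends F' -> F' =1 F.

Definition two_nontrivial_factors (n : nat) (Ai : 'I_n -> groupType)
    (B : groupType) : Prop :=
  (exists i j, [/\ i <> j, nontrivial_group (Ai i) & nontrivial_group (Ai j)]) \/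
  (exists i, nontrivial_group (Ai i) /\ nontrivial_group B).

Record automorphism (A : groupType) := Automorphism {
  aut_fun :> A -> A;
  aut_morph : {morph aut_fun : x y / x * y};
  aut_bij : bijective aut_fun }.

HB.instance Definition _ (A : groupType) := gen_eqMixin (automorphism A).
HB.instance Definition _ (A : groupType) := gen_choiceMixin (automorphism A).

HB.instance Definition _ (A : groupType) (f : automorphism A) :=
  isMultiplicative.Build A A (aut_fun f) (aut_morph f).

Lemma autP (A : groupType) (f g : automorphism A) : f =1 g -> f = g.
Proof.
case: f g => f fM fb [g gM gb] /= /funext fg; subst g.
by rewrite (Prop_irrelevance fM gM) (Prop_irrelevance fb gb).
Qed.

Section AutGroup.
Variable A : groupType.
Implicit Types f g : automorphism A.

Lemma aut1 f : f 1 = 1.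
Proof. by apply: (@mulgI _ (f 1)); rewrite -aut_morph !mulg1. Qed.

Lemma autV f a : f a^-1 = (f a)^-1.
Proof. by symmetry; apply: mulg1_eq; rewrite -aut_morph mulgV aut1. Qed.

Definition aut_inv_fun f : A -> A := fun y => projT1 (cid (let: Bijective g _ gK := aut_bij f in
  ex_intro (fun x => f x = y) (g y) (gK y))).

Lemma aut_invK f : cancel (aut_inv_fun f) f.
Proof. by move=> y; rewrite /aut_inv_fun; case: cid. Qed.

Lemma aut_Kinv f : cancel f (aut_inv_fun f).
Proof. by move=> x; apply: (bij_inj (aut_bij f)); rewrite aut_invK. Qed.

Lemma aut_inv_morph f : {morph aut_inv_fun f : x y / x * y}.
Proof.
by move=> x y; apply: (bij_inj (aut_bij f)); rewrite aut_morph !aut_invK.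
Qed.

Definition aut_inv f : automorphism A :=
  Automorphism (aut_inv_morph f) (Bijective (aut_invK f) (aut_Kinv f)).

Lemma aut_comp_morph f g : {morph f \o g : x y / x * y}.
Proof. by move=> x y /=; rewrite !aut_morph. Qed.

Definition aut_comp f g : automorphism A :=
  Automorphism (aut_comp_morph f g) (bij_comp (aut_bij f) (aut_bij g)).

Lemma aut_id_morph : {morph @id A : x y / x * y}. Proof. by []. Qed.

Definition aut_id : automorphism A :=
  Automorphism aut_id_morph (Bijective (fun=> erefl) (fun=> erefl)).

Fact aut_compA : associative aut_comp. Proof. by move=> f g h; apply: autP. Qed.
Fact aut_comp1f : left_id aut_id aut_comp. Proof. by move=> f; apply: autP. Qed.
Fact aut_compf1 : right_id aut_id aut_comp. Proof. by move=> f; apply: autP. Qed.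
Fact aut_compVf : left_inverse aut_id aut_inv aut_comp.
Proof. by move=> f; apply: autP => x /=; rewrite aut_Kinv. Qed.
Fact aut_compfV : right_inverse aut_id aut_inv aut_comp.
Proof. by move=> f; apply: autP => x /=; rewrite aut_invK. Qed.

HB.instance Definition _ := isGroup.Build (automorphism A)
  aut_compA aut_comp1f aut_compf1 aut_compVf aut_compfV.

Definition outer_equiv : rel (automorphism A) :=
  fun f g => `[< exists a : A, forall x, g x = a * f x * a^-1 >].

Lemma outer_equiv_refl : reflexive outer_equiv.
Proof. by move=> f; apply/asboolP; exists 1 => x; rewrite mul1g invg1 mulg1. Qed.

Lemma outer_equiv_sym : symmetric outer_equiv.
Proof.
suff sub f g : outer_equiv f g -> outer_equiv g f.
  by move=> f g; apply/idP/idP; apply: sub.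
move=> /asboolP[a fg]; apply/asboolP; exists a^-1 => x.
by rewrite fg invgK -!mulgA mulVg mulg1 mulKg.
Qed.

Lemma outer_equiv_trans : transitive outer_equiv.
Proof.
move=> g f h /asboolP[a fg] /asboolP[b gh]; apply/asboolP; exists (b * a) => x.
by rewrite gh fg invgM !mulgA.
Qed.

Canonical outer_equiv_rel :=
  EquivRel outer_equiv outer_equiv_refl outer_equiv_sym outer_equiv_trans.

Definition Out := {eq_quot outer_equiv_rel}.

HB.instance Definition _ := Choice.on Out.
HB.instance Definition _ := EqQuotient.on Out.

Lemma Out_eqP f g : reflect (exists a : A, forall x, g x = a * f x * a^-1)
  (\pi_Out f == \pi_Out g).
Proof. by rewrite piE; apply: asboolP. Qed.

Definition Out_mul : Out -> Out -> Out :=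
  fun h k => \pi_Out (aut_comp (repr h) (repr k)).
Definition Out_inv : Out -> Out := fun h => \pi_Out (aut_inv (repr h)).

Lemma Out_reprP f : exists a : A, forall x, f x = a * repr (\pi_Out f) x * a^-1.
Proof. by apply/Out_eqP; rewrite reprK. Qed.

Lemma Out_pi_mul f g : Out_mul (\pi_Out f) (\pi_Out g) = \pi_Out (aut_comp f g).
Proof.
have [a fE] := Out_reprP f; have [b gE] := Out_reprP g.
apply/eqP/Out_eqP; exists (a * repr (\pi_Out f) b) => x /=.
by rewrite fE gE !aut_morph autV invgM !mulgA.
Qed.

Lemma Out_pi_inv f : Out_inv (\pi_Out f) = \pi_Out (aut_inv f).
Proof.
apply/eqP; have [a fE] := Out_reprP f; apply/Out_eqP => /=.
exists (aut_inv_fun f a^-1) => x.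
apply: (bij_inj (aut_bij f)); rewrite aut_invK !aut_morph autV aut_invK invgK.
by rewrite [f (aut_inv_fun (repr _) x)]fE aut_invK !mulgA mulVg mul1g mulgVK.
Qed.

Fact Out_mulA : associative Out_mul.
Proof.
by elim/quotW=> f; elim/quotW=> g; elim/quotW=> h; rewrite (Out_pi_mul g h) (Out_pi_mul f g) !Out_pi_mul aut_compA.
Qed.
Fact Out_mul1h : left_id (\pi_Out aut_id) Out_mul.
Proof. by elim/quotW=> f; rewrite Out_pi_mul aut_comp1f. Qed.
Fact Out_mulh1 : right_id (\pi_Out aut_id) Out_mul.
Proof. by elim/quotW=> f; rewrite Out_pi_mul aut_compf1. Qed.
Fact Out_mulVh : left_inverse (\pi_Out aut_id) Out_inv Out_mul.
Proof. by elim/quotW=> f; rewrite Out_pi_inv Out_pi_mul aut_compVf. Qed.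
Fact Out_mulhV : right_inverse (\pi_Out aut_id) Out_inv Out_mul.
Proof. by elim/quotW=> f; rewrite Out_pi_inv Out_pi_mul aut_compfV. Qed.

HB.instance Definition _ := isGroup.Build Out
  Out_mulA Out_mul1h Out_mulh1 Out_mulVh Out_mulhV.

End AutGroup.

(* Out(A, {A_1, ..., A_n}). The condition depends only on the outer class of f. *)
Definition Out_rel (A : groupType) (n : nat) (Ai : 'I_n -> groupType)
    (iA : forall i, {multiplicative Ai i -> A}) (h : Out A) : Prop :=
  forall f : automorphism A, \pi_(Out A) f = h ->
  forall i, exists (j : 'I_n) (a : A), forall y : A,
    (exists x : Ai i, y = f (iA i x)) <-> (exists x : Ai j, y = a * iA j x * a^-1).

Definition is_subgroup (G : groupType) (H : set G) : Prop :=
  H 1 /\ forall x y, H x -> H y -> H (x * y^-1).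

(* One orientation of each geometric edge is chosen. *)
Record graph_of_groups := GraphOfGroups {
  gvertex : finType;
  gedge : finType;
  gsrc : gedge -> gvertex;
  gtgt : gedge -> gvertex;
  vgroup : gvertex -> groupType;
  egroup : gedge -> groupType;
  esrc : forall e, {multiplicative egroup e -> vgroup (gsrc e)};
  etgt : forall e, {multiplicative egroup e -> vgroup (gtgt e)};
  esrc_inj : forall e, injective (esrc e);
  etgt_inj : forall e, injective (etgt e) }.

Definition gadj (G : graph_of_groups) (F : {set gedge G}) : rel (gvertex G) :=
  fun u v => [exists e in F, ((gsrc e == u) && (gtgt e == v)) ||
                             ((gsrc e == v) && (gtgt e == u))].

(* F is connected, spanning, and without circuits. The underlying graph is
   connected as soon as it has a spanning tree. *)
Definition spanning_tree (G : graph_of_groups) (F : {set gedge G}) : Prop :=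
  [/\ (0 < #|gvertex G|)%N,
      (forall u v, connect (gadj F) u v) &
      (forall e, e \in F -> ~~ connect (gadj (F :\ e)) (gsrc e) (gtgt e))].

(* Generators and relations of pi_1(G, F): the vertex groups and a stable
   letter per edge, with t_e = 1 for e in F. A term of this type is a
   homomorphism from pi_1(G, F) to K. *)
Record pi1_hom (G : graph_of_groups) (F : {set gedge G}) (K : groupType) :=
  Pi1Hom {
  vhom : forall v, {multiplicative vgroup v -> K};
  stable : gedge G -> K;
  stable_tree : forall e, e \in F -> stable e = 1;
  stable_rel : forall e (x : egroup e),
    stable e * vhom (gtgt e) (etgt e x) * (stable e)^-1
      = vhom (gsrc e) (esrc e x) }.

(* The homomorphism p : pi_1(G, F) -> A is an isomorphism. *)
Definition is_pi1 (G : graph_of_groups) (F : {set gedge G}) (A : groupType)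
    (p : pi1_hom F A) : Prop :=
  forall (K : groupType) (q : pi1_hom F K),
    let factors (f : {multiplicative A -> K}) :=
      (forall v (x : vgroup v), f (vhom p v x) = vhom q v x) /\
      (forall e, f (stable p e) = stable q e) in
    exists f, factors f /\ forall f', factors f' -> f' =1 f.

Record marked_graph_of_groups (A : groupType) := MarkedGraphOfGroups {
  mgraph :> graph_of_groups;
  mtree : {set gedge mgraph};
  mtree_spanning : spanning_tree mtree;
  mhom : pi1_hom mtree A;
  mhom_pi1 : is_pi1 mhom }.

Arguments mtree {A} m.
Arguments mhom {A} m.

Section BassSerre.
Variables (A : groupType) (S : marked_graph_of_groups A).

Definition vcoset (v : gvertex S) (a : A) : A -> Prop :=
  fun y => exists x : vgroup v, y = a * vhom (mhom S) v x.

(* The disjoint union over v of the sets A / A_v of left cosets. *)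
Definition bs_vertex : Type :=
  {p : gvertex S * (A -> Prop) | exists a, p.2 = vcoset p.1 a}.

Definition bs_mk (v : gvertex S) (a : A) : bs_vertex :=
  exist _ (v, vcoset v a) (ex_intro _ a erefl).

Lemma bs_act_subproof (a : A) (p : bs_vertex) :
  exists b, (fun y => (sval p).2 (a^-1 * y)) = vcoset (sval p).1 b.
Proof.
case: p => -[v C] /= [b ->]; exists (a * b); apply/funext => y; apply/propext.
split=> -[x E]; exists x; first by rewrite -mulgA -E mulVKg.
by rewrite E -mulgA mulKg.
Qed.

Definition bs_act (a : A) (p : bs_vertex) : bs_vertex :=
  exist _ ((sval p).1, fun y => (sval p).2 (a^-1 * y)) (bs_act_subproof a p).

(* The edges of the tree are the cosets of the edge groups; the edge a A_e
   joins a A_{src e} and a t_e A_{tgt e}. [bs_joined F p q]: some edge lying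
   above F joins p and q. *)
Definition bs_joined (F : {set gedge S}) (p q : bs_vertex) : Prop :=
  exists (e : gedge S) (a : A), e \in F /\
    let s := bs_mk (gsrc e) a in
    let t := bs_mk (gtgt e) (a * stable (mhom S) e) in
    (p = s /\ q = t) \/ (p = t /\ q = s).

Fixpoint bs_walk (F : {set gedge S}) (k : nat) (p q : bs_vertex) : Prop :=
  if k is k'.+1 then exists2 r, bs_joined F p r & bs_walk F k' r q else p = q.

(* The distance from p to q is k, all edges having length 1. *)
Definition bs_dist (p q : bs_vertex) (k : nat) : Prop :=
  bs_walk [set: gedge S]%SET k p q /\
  forall j, bs_walk [set: gedge S]%SET j p q -> (k <= j)%N.

Definition edge_groups_trivial : Prop :=
  forall (e : gedge S) (x : egroup e), x = 1.

Definition fixes_no_vertex : Prop :=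
  ~ exists p : bs_vertex, forall a : A, bs_act a p = p.

End BassSerre.

Record free_splitting (A : groupType) := FreeSplitting {
  fs_graph :> marked_graph_of_groups A;
  fs_edges : edge_groups_trivial fs_graph;
  fs_nontrivial : fixes_no_vertex fs_graph }.

(* An isometry is given by its action on vertices: edges have length 1, and
   only isometries between lines on which A acts by translations need not send
   vertices to vertices, in which case some other equivariant isometry does. *)
Definition equivariantly_isometric (A : groupType) (S S' : free_splitting A) : Prop :=
  exists f : bs_vertex S -> bs_vertex S',
    [/\ bijective f, (forall a p, f (bs_act a p) = bs_act a (f p)) &
        forall p q k, bs_dist (f p) (f q) k <-> bs_dist p q k].

(* S is obtained from R by collapsing the edges in F: on universal covers, by
   collapsing to a point each component of the union of the edges above F. *)
Definition collapses_to (A : groupType) (R S : free_splitting A)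
    (F : {set gedge R}) : Prop :=
  exists f : bs_vertex R -> bs_vertex S,
    [/\ (forall a p, f (bs_act a p) = bs_act a (f p)),
        (forall u, exists p, f p = u),
        (forall p q, f p = f q <-> exists k, bs_walk F k p q) &
        (forall u v, bs_joined [set: gedge S]%SET u v <->
           exists p q, [/\ f p = u, f q = v & bs_joined (~: F)%SET p q])].

Definition refines (A : groupType) (R S : free_splitting A) : Prop :=
  exists F : {set gedge R}, @collapses_to A R S F.

Section Twist.
Variable A : groupType.
Implicit Types (f g : automorphism A) (S : free_splitting A).

Lemma twist_tree f S e : e \in mtree S -> f (stable (mhom S) e) = 1.
Proof. by move=> eT; rewrite stable_tree // aut1. Qed.

Lemma twist_rel f S e (x : egroup e) :
  f (stable (mhom S) e) * f (vhom (mhom S) (gtgt e) (etgt e x)) *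
    (f (stable (mhom S) e))^-1 = f (vhom (mhom S) (gsrc e) (esrc e x)).
Proof. by rewrite -autV -!aut_morph stable_rel. Qed.

Lemma comp_aut_morph f (G : groupType) (u : {multiplicative G -> A}) :
  {morph f \o u : x y / x * y}.
Proof. by move=> x y /=; rewrite gmulfM aut_morph. Qed.

Definition comp_aut f (G : groupType) (u : {multiplicative G -> A}) :
    {multiplicative G -> A} :=
  HB.pack_for {multiplicative G -> A} (f \o u)
    (isMultiplicative.Build G A (f \o u) (comp_aut_morph f u)).

Definition twist_hom f S : pi1_hom (mtree S) A :=
  @Pi1Hom S (mtree S) A (fun v => comp_aut f (vhom (mhom S) v))
    (fun e => f (stable (mhom S) e)) (@twist_tree f S) (@twist_rel f S).

Lemma twist_pi1 f S : is_pi1 (twist_hom f S).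
Proof.
move=> K q; have [F [[Fv Fe] Fu]] := mhom_pi1 q.
have FM : {morph F \o aut_inv f : x y / x * y}.
  by move=> x y /=; rewrite aut_inv_morph gmulfM.
exists (HB.pack_for {multiplicative A -> K} (F \o aut_inv f)
  (isMultiplicative.Build A K (F \o aut_inv f) FM)).
split; first by split=> [v x|e] /=; rewrite aut_Kinv ?Fv ?Fe.
move=> F' [Fv' Fe'] x /=.
have F'M : {morph F' \o f : x y / x * y}.
  by move=> y z /=; rewrite aut_morph gmulfM.
have := Fu (HB.pack_for {multiplicative A -> K} (F' \o f)
  (isMultiplicative.Build A K (F' \o f) F'M)).
move=> /(_ _ (aut_inv f x)) /= <-; first by rewrite aut_invK.
by split=> [v y|e] /=; rewrite -?Fv' -?Fe'.
Qed.

Definition twist_graph f S : marked_graph_of_groups A :=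
  MarkedGraphOfGroups (mtree_spanning S) (@twist_pi1 f S).

(* The Bass-Serre tree of the twist is that of S, up to the bijection f of A. *)
Lemma twist_vcoset f S (v : gvertex S) a :
  @vcoset A (twist_graph f S) v (f a) = fun y => vcoset v a (aut_inv f y).
Proof.
apply/funext => y; apply/propext; split=> -[x E]; exists x.
  by rewrite E /= aut_inv_morph !aut_Kinv.
by rewrite -[LHS](aut_invK f) (E : aut_inv_fun f y = _) aut_morph.
Qed.

Lemma twist_to_subproof f S (p : bs_vertex S) :
  exists a, (fun y => (sval p).2 (aut_inv f y)) =
    @vcoset A (twist_graph f S) (sval p).1 a.
Proof. by case: p => -[v C] /= [a ->]; exists (f a); rewrite twist_vcoset. Qed.

Definition twist_to f S (p : bs_vertex S) : bs_vertex (twist_graph f S) :=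
  exist _ ((sval p).1, fun y => (sval p).2 (aut_inv f y)) (twist_to_subproof f p).

Lemma bs_eqP (S : marked_graph_of_groups A) (p q : bs_vertex S) :
  sval p = sval q -> p = q.
Proof.
by case: p q => p Hp [q Hq] /= E; subst q; rewrite (Prop_irrelevance Hp Hq).
Qed.

Lemma bs_mkP (S : marked_graph_of_groups A) (p : bs_vertex S) :
  exists v a, p = bs_mk v a.
Proof.
by case: p => -[v C] Hp; case: (Hp) => a /= E; exists v, a; apply: bs_eqP; rewrite /= E.
Qed.

Lemma bs_act_mk (S : marked_graph_of_groups A) (v : gvertex S) (a b : A) :
  bs_act a (bs_mk v b) = bs_mk v (a * b).
Proof.
apply: bs_eqP => /=; congr pair; apply/funext => y; apply/propext.
split=> -[x E]; exists x; first by rewrite -mulgA -E mulVKg.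
by rewrite E -mulgA mulKg.
Qed.

Lemma twist_to_mk f S (v : gvertex S) a :
  twist_to f (bs_mk v a) = @bs_mk A (twist_graph f S) v (f a).
Proof. by apply: bs_eqP; rewrite /= twist_vcoset. Qed.

Lemma twist_to_act f S a (p : bs_vertex S) :
  twist_to f (bs_act a p) = bs_act (f a) (twist_to f p).
Proof.
have [v [b ->]] := bs_mkP p.
by rewrite bs_act_mk !twist_to_mk bs_act_mk aut_morph.
Qed.

Lemma inj_surj_bij (X Y : Type) (u : X -> Y) :
  injective u -> (forall y, exists x, u x = y) -> bijective u.
Proof.
move=> uinj usurj; exists (fun y => sval (cid (usurj y))) => x; last by case: cid.
by apply: uinj; case: cid.
Qed.

Lemma twist_to_bij f S : bijective (@twist_to f S).
Proof.
apply: inj_surj_bij => [p q /(congr1 sval) [E1 E2]|q].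
  apply: bs_eqP; rewrite [LHS]surjective_pairing [RHS]surjective_pairing E1.
  congr pair; apply/funext => y; have := congr1 (fun D => D (f y)) E2.
  by rewrite /= aut_Kinv.
have [v [b ->]] := bs_mkP q; exists (@bs_mk A S v (aut_inv f b)).
by rewrite twist_to_mk [f _]aut_invK.
Qed.

Lemma twist_nontrivial f S : fixes_no_vertex (twist_graph f S).
Proof.
case=> p pfix; have [g tK gK] := @twist_to_bij f S.
apply: (@fs_nontrivial A S); exists (g p) => a.
by apply: (can_inj tK); rewrite twist_to_act gK.
Qed.

Definition twist f S : free_splitting A :=
  @FreeSplitting A (twist_graph f S) (@fs_edges A S) (@twist_nontrivial f S).

Lemma isometric_refl S : equivariantly_isometric S S.
Proof. by exists id; split=> //; exists id. Qed.

Lemma isometric_sym S S' :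
  equivariantly_isometric S S' -> equivariantly_isometric S' S.
Proof.
case=> u [[v uK vK] uA ud]; exists v; split; first by exists u.
  by move=> a p; apply: (can_inj uK); rewrite uA !vK.
by move=> p q k; rewrite -ud !vK.
Qed.

Lemma isometric_trans S2 S1 S3 : equivariantly_isometric S1 S2 ->
  equivariantly_isometric S2 S3 -> equivariantly_isometric S1 S3.
Proof.
case=> u [ub uA ud] [v [vb vA vd]]; exists (v \o u).
split; first exact: bij_comp.
  by move=> a p /=; rewrite uA vA.
by move=> p q k /=; rewrite vd ud.
Qed.

Lemma walk_bij (S S' : marked_graph_of_groups A) (u : bs_vertex S -> bs_vertex S') :
  bijective u ->
  (forall p q, bs_joined [set: gedge S']%SET (u p) (u q) <->
               bs_joined [set: gedge S]%SET p q) ->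
  forall p q k, bs_dist (u p) (u q) k <-> bs_dist p q k.
Proof.
move=> [v uK vK] uj.
have uw k p q : bs_walk [set: gedge S']%SET k (u p) (u q) <->
               bs_walk [set: gedge S]%SET k p q.
  elim: k p q => [|k IH] p q /=; first by split=> [/(can_inj uK)|->].
  split=> -[r].
    by rewrite -[r]vK => /uj pr /IH rq; exists (v r).
  by move=> /uj pr /IH rq; exists (u r).
move=> p q k; split=> -[w m]; (split; first exact/uw) => j /uw; exact: m.
Qed.

Lemma twist_to_joined f S (p q : bs_vertex S) :
  bs_joined [set: gedge (twist_graph f S)]%SET (twist_to f p) (twist_to f q) <->
  bs_joined [set: gedge S]%SET p q.
Proof.
have [g tK _] := @twist_to_bij f S; have ti := can_inj tK.
split=> -[e [a [_ E]]].
  exists e, (aut_inv f a); split; first by rewrite inE.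
  by case: E => -[Ep Eq]; [left|right]; split; apply: ti;
     rewrite twist_to_mk ?aut_morph [f (aut_inv f a)]aut_invK.
exists e, (f a); split; first by rewrite inE.
by case: E => -[-> ->]; [left|right]; rewrite !twist_to_mk aut_morph.
Qed.

Lemma twist_isometric f S S' : equivariantly_isometric S S' ->
  equivariantly_isometric (twist f S) (twist f S').
Proof.
case=> u [ub uA ud].
have [g tK gK] := @twist_to_bij f S.
have td T := walk_bij (@twist_to_bij f T) (@twist_to_joined f T).
have gb : bijective g by exists (@twist_to f S).
have gA a p : g (bs_act a p) = bs_act (aut_inv_fun f a) (g p).
  by apply: (can_inj tK); rewrite twist_to_act aut_invK !gK.
exists (@twist_to f S' \o u \o g); split.
- exact: (bij_comp (bij_comp (@twist_to_bij f S') ub) gb).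
- by move=> a p /=; rewrite gA uA twist_to_act aut_invK.
- by move=> p q k; rewrite /= td ud -td !gK.
Qed.

Lemma twist_inner f g S : (exists a : A, forall x, g x = a * f x * a^-1) ->
  equivariantly_isometric (twist f S) (twist g S).
Proof.
case=> c fg.
pose T := twist f S; pose T' := twist g S.
have cosE (v : gvertex S) b :
    (fun y => @vcoset A T v b (y * c)) = @vcoset A T' v (b * c^-1).
  apply/funext => y; apply/propext; split=> -[x E]; exists x.
    rewrite /= fg -!mulgA mulKg mulgA; apply: (@mulIg _ c).
    by rewrite E /= -!mulgA mulVg mulg1.
  by rewrite E /= fg -!mulgA mulKg mulVg mulg1.
have sub (p : bs_vertex T) :
    exists b, (fun y => (sval p).2 (y * c)) = @vcoset A T' (sval p).1 b.
  by case: p => -[v C] /= [b ->]; exists (b * c^-1); exact: cosE.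
pose u (p : bs_vertex T) : bs_vertex T' :=
  exist _ ((sval p).1, fun y => (sval p).2 (y * c)) (sub p).
have uE (v : gvertex S) b : u (@bs_mk A T v b) = @bs_mk A T' v (b * c^-1).
  by apply: bs_eqP; rewrite /= cosE.
have uinj : injective u.
  move=> p q /(congr1 sval) [E1 E2]; apply: bs_eqP.
  rewrite [LHS]surjective_pairing [RHS]surjective_pairing E1; congr pair.
  apply/funext => y; have := congr1 (fun D => D (y * c^-1)) E2.
  by rewrite /= -mulgA mulVg mulg1.
have usurj q : exists p, u p = q.
  have [v [b ->]] := bs_mkP q; exists (@bs_mk A T v (b * c)).
  by rewrite uE mulgK.
have ub : bijective u by exact: inj_surj_bij.
exists u; split=> //.
  by move=> a p; have [v [b ->]] := bs_mkP p; rewrite bs_act_mk !uE bs_act_mk mulgA.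
apply: walk_bij => // p q.
have stE e a : a * c^-1 * g (stable (mhom S) e) = a * f (stable (mhom S) e) * c^-1.
  by rewrite fg -!mulgA mulKg.
split=> -[e [a [_ E]]].
  exists e, (a * c); split; first by rewrite inE.
  by case: E => -[Ep Eq]; [left|right]; split; apply: uinj;
     rewrite uE -?stE mulgK.
exists e, (a * c^-1); split; first by rewrite inE.
by case: E => -[-> ->]; [left|right]; rewrite !uE /= stE.
Qed.

End Twist.

Section FreeSplittingGraph.
Variable A : groupType.

Definition fs_class : Type :=
  {c : free_splitting A -> Prop | exists S, c = equivariantly_isometric S}.

Lemma fs_act_subproof (h : Out A) (c : fs_class) :
  exists S0, (fun S' => exists (f : automorphism A) S,
    [/\ \pi_(Out A) f = h, sval c S & equivariantly_isometric (twist f S) S'])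
  = equivariantly_isometric S0.
Proof.
case: c => c /= [S ->]; exists (twist (repr h) S).
apply/funext => S'; apply/propext; split.
  case=> f [S1 [fh SS1 S1S']]; apply: isometric_trans S1S'.
  apply: isometric_trans (twist_isometric _ SS1) _.
  by apply: twist_inner; apply/Out_eqP; rewrite reprK fh.
by move=> E; exists (repr h), S; split=> //; [rewrite reprK|exact: isometric_refl].
Qed.

(* The class of S is sent by that of f to the class of the twist of S by f. *)
Definition fs_act (h : Out A) (c : fs_class) : fs_class :=
  exist _ _ (fs_act_subproof h c).

Lemma fs_classP (c d : fs_class) S : sval c S -> sval d S -> c = d.
Proof.
case: c d => c Hc [d Hd] /= cS dS; have E : c = d.
  case: (Hc) (Hd) cS dS => S1 -> [S2 ->] S1S S2S.
  have S12 := isometric_trans S1S (isometric_sym S2S).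
  apply/funext => T; apply/propext; split=> ST.
    exact: isometric_trans (isometric_sym S12) ST.
  exact: isometric_trans S12 ST.
by subst d; rewrite (Prop_irrelevance Hc Hd).
Qed.

Lemma fs_act_twist (f : automorphism A) (c : fs_class) S :
  sval c S -> sval (fs_act (\pi_(Out A) f) c) (twist f S).
Proof. by move=> cS; exists f, S; split=> //; exact: isometric_refl. Qed.

Lemma fs_actM (h k : Out A) (c : fs_class) : fs_act (h * k) c = fs_act h (fs_act k c).
Proof.
elim/quotW: h => f; elim/quotW: k => g.
have [S cS] : exists S, sval c S.
  by case: c => c [S E]; exists S; rewrite /= E; exact: isometric_refl.
apply: (fs_classP (S := twist f (twist g S))); last by do 2!apply: fs_act_twist.
exists (aut_comp f g), S; split=> //; first by rewrite -Out_pi_mul.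
by exists id; split=> //; [exists id | move=> a p; exact: bs_eqP].
Qed.

Variables (n : nat) (Ai : 'I_n -> groupType).
Variable iA : forall i, {multiplicative Ai i -> A}.

Definition relative (S : free_splitting A) : Prop :=
  forall i, exists (v : gvertex S) (a : A), forall y : Ai i,
    exists x : vgroup v, iA i y = a * vhom (mhom S) v x * a^-1.

Definition FS_vertex (c : fs_class) : Prop := exists2 S, sval c S & relative S.

Definition FS_edge (c d : fs_class) : Prop :=
  [/\ FS_vertex c, FS_vertex d, c <> d &
      exists S T R : free_splitting A,
        [/\ sval c S, sval d T, relative R, refines R S & refines R T]].

Variable R : realType.

(* The point (1 - t) c + t d of the segment [c, d], in barycentric coordinates. *)
Definition segment_point (c d : fs_class) (t : R) : fs_class -> R :=
  fun z => ((1 - t) * (`[< z = c >])%:R + t * (`[< z = d >])%:R)%R.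

(* The points of the (geometric realization of the) graph. *)
Definition FS_point (w : fs_class -> R) : Prop :=
  exists (c d : fs_class) (t : R),
    [/\ FS_vertex c, FS_vertex d, c = d \/ FS_edge c d,
        (0 <= t <= 1)%R & w = segment_point c d t].

Definition FS_point_act (h : Out A) (w : fs_class -> R) : fs_class -> R :=
  fun z => w (fs_act h^-1 z).

End FreeSplittingGraph.

(* Main.v *)
(* Let E be the group of automorphisms of A above H. It acts on the set P of
   conjugates of the non-trivial A_i, with finitely many orbits on the edges of a
   suitable connected graph on P on which A acts freely. In the manner of Dunwoody,
   one looks for a subset C of P with finite coboundary, nested with all its
   translates by E, and with trivial stabilizer in A; the tree dual to the orbit
   of C is then an E-invariant free splitting in which each A_i is elliptic.

   A smallest cut may well have a non-trivial finite stabilizer in A. So take a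
   maximal nested E-invariant family S of such bad cuts. A bad cut is stabilized
   by torsion elements fixing a single point of P. If two cuts of S give two
   distinct points, then some vertex of the tree dual to S is fixed by an element
   of infinite order acting hyperbolically on the Bass-Serre tree of the free
   product, so S cannot generate the half-spaces of the latter; if they all give
   the same point, that point is fixed by A. A smallest cut not generated by S can
   then be made nested with S and with its translates, and it is not bad. *)

From HB Require Import structures.
Require Import Defs.
From mathcomp Require Import all_boot all_order all_algebra.
From mathcomp Require Import finmap generic_quotient.
From mathcomp Require Import boolp classical_sets cardinality reals.

Set Implicit Arguments.
Unset Strict Implicit.
Unset Printing Implicit Defensive.

Local Open Scope classical_set_scope.
Local Open Scope group_scope.

(** * Groups acting on trees *)

(** A smallest cut would give, as in Dunwoody's theorem, an E-invariant splitting over finite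
    groups, whereas a free splitting needs trivial edge stabilizers. The half-spaces of the free
    product do have trivial stabilizers, but they are nested with their A-translates only, not with
    their E-translates. The proof passes from one to the other by size. While no good cut is found,
    a bad family generating all cuts of size at most n is enlarged to one for size n + 1. Measuring
    cuts modulo the Boolean algebra generated by the family lets the size grow and still leaves a
    minimal cut to uncross. The process stops at the largest size s of a half-space, where the
    family would generate all half-spaces.

    The main finiteness is that A acts freely on the edges of the graph on P, so only finitely many
    A-translates of a cut separate two given points. Hence cuts have finite stabilizers in A, whose
    elements are torsion and fix points of P. Finiteness of H leaves finitely many A-orbits of
    edges, which makes the coboundaries of half-spaces finite. *)

Lemma neqb_negb (u v : bool) : u != v -> u = ~~ v.
Proof. by case: u v => -[]. Qed.

Lemma exists_argmin (X : Type) (P : X -> Prop) (f : X -> nat) (x0 : X) :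
  P x0 -> exists2 x, P x & forall y, P y -> (f x <= f y)%N.
Proof.
move=> Px0; have : exists k, `[< exists2 x, P x & f x = k >].
  by exists (f x0); apply/asboolP; exists x0.
move=> /ex_minnP[m /asboolP[x Px <-] min]; exists x => // y Py.
by apply: min; apply/asboolP; exists y.
Qed.

(* The edges are the pairs (a, j), joining a * src j to a * tgt j, so A acts
   freely on them. The set [tside j] is one of the two sides of the edge (1, j):
   as every edge separates its ends, there is no circuit. Connectedness is
   stated as an induction principle. *)
Record tree_action (A : groupType) := TreeAction {
  tvert :> Type;
  tact : A -> tvert -> tvert;
  tact1 : forall x, tact 1 x = x;
  tactM : forall a b x, tact (a * b) x = tact a (tact b x);
  tedge : finType;
  tsrc : tedge -> tvert;
  ttgt : tedge -> tvert;
  tside : tedge -> tvert -> Prop;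
  tside_src : forall j, ~ tside j (tsrc j);
  tside_tgt : forall j, tside j (ttgt j);
  tside_edge : forall j a j', (a, j') <> (1, j) ->
    tside j (tact a (tsrc j')) <-> tside j (tact a (ttgt j'));
  tconn : forall Q : tvert -> Prop,
    (forall a j, Q (tact a (tsrc j)) <-> Q (tact a (ttgt j))) ->
    forall x y, Q x -> Q y }.

Section TreeAction.
Variables (A : groupType) (T : tree_action A).
Implicit Types (x y z : T) (a b : A) (e : A * tedge T).

Definition esource e : T := tact e.1 (tsrc e.2).
Definition etarget e : T := tact e.1 (ttgt e.2).
Definition emul a e : A * tedge T := (a * e.1, e.2).
(** The two half-trees of [e]; [o] selects the one containing [eend e o]. *)
Definition side e (o : bool) : set T :=
  [set x | if o then tside e.2 (tact e.1^-1 x) else ~ tside e.2 (tact e.1^-1 x)].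
Definition eend e (o : bool) : T := if o then etarget e else esource e.

Lemma tactK a x : tact a^-1 (tact a x) = x.
Proof. by rewrite -tactM mulVg tact1. Qed.

Lemma tactVK a x : tact a (tact a^-1 x) = x.
Proof. by rewrite -tactM mulgV tact1. Qed.

Lemma sideN e o x : side e (~~ o) x <-> ~ side e o x.
Proof. by case: o => /=; rewrite /side /= ?notK //; split=> // /contrapT. Qed.

Lemma side_end e o : side e o (eend e o).
Proof.
case: o; rewrite /side /eend /esource /etarget /= tactK; first exact: tside_tgt.
exact: tside_src.
Qed.

Lemma side_endN e o : ~ side e o (eend e (~~ o)).
Proof. by apply/sideN; apply: side_end. Qed.

Lemma side_edge e e' o p : e <> e' ->
  side e o (eend e' p) -> side e o (eend e' (~~ p)).
Proof.
move=> ee'.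
have h : (e.1^-1 * e'.1, e'.2) <> (1, e.2).
  case: e e' ee' => a j [b k] /= ne [E kj]; apply: ne; rewrite kj.
  by congr pair; apply: (@mulgI _ a^-1); rewrite mulVg E.
have /= := tside_edge h; rewrite !tactM => {}h.
by case: o p => -[]; rewrite /side /eend /esource /etarget /=; tauto.
Qed.

Lemma side_mul a e o x : side (emul a e) o (tact a x) <-> side e o x.
Proof.
by rewrite /side /emul /= invgM tactM tactK.
Qed.

Lemma eend_mul a e o : eend (emul a e) o = tact a (eend e o).
Proof. by case: o; rewrite /eend /esource /etarget /emul /= tactM. Qed.

Lemma edge_conn (Q : T -> Prop) :
  (forall e o, Q (eend e o) -> Q (eend e (~~ o))) -> forall x y, Q x -> Q y.
Proof.
move=> h; apply: tconn => a j; split.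
  exact: (h (a, j) false).
exact: (h (a, j) true).
Qed.

(** The difference of the two half-trees is closed under passing along edges: it could only be left
    through [e], whose end in [side e o] lies in [side e' o'], or through [e'], which has no end in
    [side e o]. If non-empty it would reach [eend e o]. *)
Lemma side_sub e o e' o' : e <> e' -> ~ side e o (eend e' true) ->
  side e' o' (eend e o) -> side e o `<=` side e' o'.
Proof.
move=> ee' e'o eo' y ey; apply: contrapT => nQ.
pose Q z := side e o z /\ ~ side e' o' z.
suff : Q (eend e o) by case.
have Qy : Q y by [].
apply: (@edge_conn Q _ y) => // e'' p [H1 H2].
have [E|ne] := pselect (e = e'').
  subst e''; exfalso; case: (eqVneq p o) => [pE|]; first by subst p.
  by move=> /neqb_negb pE; subst p; exact: (@side_endN e o).
split; first exact: side_edge.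
have [E|ne'] := pselect (e' = e''); last first.
  by move=> /(side_edge ne'); rewrite negbK.
subst e''; exfalso; case: p H1 H2 => // H1 _; apply: e'o.
exact: side_edge ne H1.
Qed.

Definition nested_sets (X : Type) (C D : set X) :=
  [\/ C `<=` D, C `<=` ~` D, ~` C `<=` D | ~` C `<=` ~` D].

Lemma sideC e o : ~` side e o = side e (~~ o).
Proof. by apply/seteqP; split=> x h; apply/sideN. Qed.

Lemma sideP e x : exists o, side e o x.
Proof.
by case: (pselect (side e true x)) => h; [exists true|exists false; apply/(sideN e true)].
Qed.

Lemma side_uniq e o o' x : side e o x -> side e o' x -> o = o'.
Proof. by case: o o' => -[] //; rewrite /side /=. Qed.

(** The half-tree of [e] away from [e'] lies in a half-tree of [e']; the other cases follow by
    complementation. *)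
Lemma sides_nested e o e' o' : nested_sets (side e o) (side e' o').
Proof.
have [E|ne] := pselect (e = e').
  subst e'; case: (eqVneq o o') => [->|]; first by constructor 1.
  by move=> /neqb_negb ->; constructor 2; rewrite sideC.
have [p hp] := sideP e (eend e' true).
have [q hq] := sideP e' (eend e (~~ p)).
have hn : ~ side e (~~ p) (eend e' true) by move=> /sideN.
have := side_sub ne hn hq.
have Nb (u v : bool) : u <> v -> u = ~~ v by case: u v => -[].
case: (pselect (o = ~~ p)) => [->|/Nb ->]; case: (pselect (o' = q)) => [->|/Nb ->];
  rewrite -?sideC ?setCK => h.
- by constructor 1.
- by constructor 2; rewrite setCK.
- by constructor 3.
- by constructor 4; rewrite setCK.
Qed.

(** This is the first edge of the path from [x] to [y], obtained without defining paths. *)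
Lemma adjacent_sep x y : x <> y ->
  exists e o, eend e o = x /\ ~ side e o y.
Proof.
move=> xy; apply: contrapT => H; apply: xy.
pose Q z := z = x \/ exists e o, eend e o = x /\ ~ side e o z.
have : Q y.
  apply: (@edge_conn Q _ x); last by left.
  move=> e o [E|[e' [o' [E ne]]]].
    by right; exists e, o; split=> //; apply: side_endN.
  have [E'|ne'] := pselect (e' = e).
    subst e'; case: (eqVneq o o') => [->|].
      by right; exists e, o'; split=> //; apply: side_endN.
    by rewrite eq_sym => /neqb_negb h; left; rewrite -E h.
  right; exists e', o'; split=> // h; apply: ne.
  by have := side_edge ne' h; rewrite negbK.
by case=> // h; exfalso; apply: H.
Qed.

(** The edges of the geodesic from [x] to [y]; their number serves as the distance. *)
Definition sep x y : set (A * tedge T) :=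
  [set e | exists o, side e o x /\ ~ side e o y].

Lemma sep_finite x y : finite_set (sep x y).
Proof.
apply: (@edge_conn (fun y => finite_set (sep x y)) _ x) => [e o h|]; last first.
  suff -> : sep x x = set0 by exact: finite_set0.
  by apply/seteqP; split=> // e [o []].
apply: (@sub_finite_set _ _ (sep x (eend e o) `|` [set e])).
  move=> e' [p [h1 h2]]; have [->|ne] := pselect (e' = e); first by right.
  by left; exists p; split=> // /(side_edge ne).
by rewrite finite_setU.
Qed.

Lemma sep_mul a e x y : sep (tact a x) (tact a y) (emul a e) <-> sep x y e.
Proof. by split=> -[o [h1 h2]]; exists o; move: h1 h2; rewrite !side_mul. Qed.

Lemma emulVK a e : emul a (emul a^-1 e) = e.
Proof. by case: e => b j; rewrite /emul /= mulVKg. Qed.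

Lemma emul_free a e : emul a e = e -> a = 1.
Proof. by case: e => b j [/(canRL (mulgK b)) ->]; rewrite mulgV. Qed.

Lemma adjacent_sub e o e' o' : e <> e' -> eend e o = eend e' o' ->
  side e (~~ o) `<=` side e' o'.
Proof.
move=> ne E; have ne' : e' <> e by move=> h; apply: ne.
have k p : side e o (eend e' p).
  case: (eqVneq p o') => [->|/neqb_negb ->]; first by rewrite -E; apply: side_end.
  by apply: side_edge => //; rewrite -E; apply: side_end.
have k' : side e' o' (eend e (~~ o)).
  by apply: side_edge => //; rewrite E; apply: side_end.
by apply: side_sub => // /sideN; apply.
Qed.

Lemma adjacent_sep_unique x y e o e' o' :
  eend e o = x -> ~ side e o y -> eend e' o' = x -> ~ side e' o' y -> e = e'.
Proof.
move=> ex ey ex' ey'; apply: contrapT => ne; apply: ey'.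
by apply: (@adjacent_sub e o) => //; [rewrite ex|apply/sideN].
Qed.

Lemma fixed_unique a x y : a <> 1 -> tact a x = x -> tact a y = y -> x = y.
Proof.
move=> a1 ax ay; apply: contrapT => /adjacent_sep [e [o [ex ny]]].
apply: a1; apply: (@emul_free _ e); apply: (@adjacent_sep_unique x y _ o _ o) => //.
  by rewrite eend_mul ex.
by rewrite -ay => /side_mul.
Qed.

Lemma emulA a b e : emul (a * b) e = emul a (emul b e).
Proof. by rewrite /emul /= mulgA. Qed.

(* At a vertex x of minimal displacement, if a moves x, the first edge e on the
   way from x to a x satisfies a W < W, where W is the side of e away from x;
   hence a has infinite order. *)
Lemma finite_order_fixed a n x0 : 0 < n -> a ^+ n = 1 -> exists x, tact a x = x.
Proof.
move=> n0 an; have [->|a1] := pselect (a = 1); first by exists x0; rewrite tact1.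
pose d x := #|` fset_set (sep x (tact a x))|.
have [x _ dx] := exists_argmin (P := fun=> True) d (x0 := x0) I.
exists x; apply: contrapT => /nesym /adjacent_sep [e [o [ex eax]]].
have ne : e <> emul a e by move=> /esym /emul_free.
have ne' : emul a e <> e by move=> /emul_free.
pose x' := eend e (~~ o).
have ax'E : tact a x' = eend (emul a e) (~~ o) by rewrite eend_mul.
have axE : tact a x = eend (emul a e) o by rewrite eend_mul ex.
have eax' : side e (~~ o) (tact a x').
  by rewrite ax'E; apply: side_edge => //; rewrite -axE; apply/sideN.
have xx' e' p : e <> e' -> side e' p x' <-> side e' p x.
  move=> h; have h' : e' <> e by move=> k; apply: h.
  split; first by move=> /(side_edge h'); rewrite negbK ex.
  by rewrite -ex => /(side_edge h').
have axax' e' p : emul a e <> e' -> side e' p (tact a x') <-> side e' p (tact a x).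
  move=> h; rewrite -(emulVK a e') !side_mul; apply: xx' => k; apply: h.
  by rewrite k emulVK.
(* Otherwise [x'] would have smaller displacement: the edges separating [x'] from [a x'] would all
   separate [x] from [a x], and [e] is not among them. *)
have Nsep : ~ sep x (tact a x) (emul a e).
  move=> S; have /(_ x' I) := dx; apply/negP; rewrite -ltnNge /d.
  apply: (@leq_ltn_trans #|` fset_set (sep x (tact a x)) `\ e|%fset); last first.
    rewrite [X in (_ < X)%N](cardfsD1 e) in_fset_set; last exact: sep_finite.
    by rewrite mem_set //; exists o; split=> //; rewrite -ex; apply: side_end.
  apply: fsubset_leq_card; apply/fsubsetP => e'.
  rewrite in_fset_set; last exact: sep_finite.
  move=> /set_mem [p [h1 h2]]; rewrite !inE in_fset_set; last exact: sep_finite.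
  have e'e : e <> e'.
    move=> ee'; subst e'; apply: h2; suff -> : p = ~~ o by [].
    by apply: side_uniq h1 _; apply: side_end.
  apply/andP; split; first by apply/eqP => h; apply: e'e.
  apply/mem_set; have [<- //|ne2] := pselect (emul a e = e').
  by exists p; rewrite -xx' // -axax'.
have sub : side (emul a e) (~~ o) `<=` side e (~~ o).
  apply: side_sub => //; last by rewrite -ax'E.
  move=> h; have {}h : side (emul a e) (~~ o) x.
    rewrite -ex; case: (eqVneq o true) => oE; first by rewrite {2}oE.
    have -> : eend e o = eend e (~~ true) by congr eend; apply: neqb_negb.
    exact: side_edge ne' h.
  apply: Nsep; exists (~~ o); split=> //.
  by rewrite axE => /sideN; apply; apply: side_end.
have subn k : side (emul (a ^+ k.+1) e) (~~ o) `<=` side (emul a e) (~~ o).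
  elim: k => [|k IH]; first by rewrite expg1.
  apply: subset_trans IH => z; rewrite expgSr emulA -{1 2}(tactVK (a ^+ k.+1) z).
  by rewrite !side_mul => /sub.
(* As [a ^+ n = 1], the half-tree of [e] would lie in its own image under [a], which misses
   [a x]. *)
have := subn n.-1; rewrite prednK // an /emul mul1g -surjective_pairing => /(_ (tact a x)).
move=> h; have : side (emul a e) (~~ o) (tact a x) by apply: h; apply/sideN.
by rewrite axE => /sideN; apply; apply: side_end.
Qed.

End TreeAction.

(** * A subtree of orbit representatives *)

Section Transversal.
Variables (A : groupType) (T : tree_action A).

Definition same_orbit (x y : T) : Prop := exists a, y = tact a x.

Definition adjacent (x y : T) : Prop :=
  exists e o, eend e o = x /\ eend e (~~ o) = y.

(** The [r g] span the lift of a maximal tree of the quotient; the last clause is its connectedness.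
    Every vertex orbit contains an end of one of the finitely many edges [(1, j)], so some partial
    transversal leaves the fewest of these ends uncovered; an edge leaving the orbits it covers
    would extend it. *)
Lemma transversal (j0 : tedge T) :
  exists (G : finType) (g0 : G) (r : G -> T),
  [/\ (forall g h, same_orbit (r g) (r h) -> g = h),
      (forall x, exists g, same_orbit (r g) x) &
      (forall Q : G -> Prop, (forall g h, adjacent (r g) (r h) -> Q g -> Q h) ->
         forall g h, Q g -> Q h)].
Proof.
pose lv (k : bool * tedge T) := eend (1, k.2) k.1.
have lvP x : exists k, same_orbit (lv k) x.
  apply: (@edge_conn _ _ (fun x => exists k, same_orbit (lv k) x) _ (tsrc j0)).
    move=> [a j] o _; exists (~~ o, j), a.
    by rewrite /lv -eend_mul /emul /= mulg1.
  by exists (false, j0), 1; rewrite /lv /= /esource /= !tact1.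
pose X := {G : finType & G -> T}.
pose good (R : X) := inhabited (tag R) /\
  (forall g h, same_orbit (tagged R g) (tagged R h) -> g = h) /\
  (forall Q : tag R -> Prop,
     (forall g h, adjacent (tagged R g) (tagged R h) -> Q g -> Q h) ->
     forall g h, Q g -> Q h).
pose unc (R : X) := #|[set k | ~~ `[< exists g, same_orbit (tagged R g) (lv k) >]]%SET|.
pose R0 : X := existT (fun G : finType => G -> T) unit (fun=> tsrc j0).
have g0 : good R0.
  by split; [constructor; exact: tt|split=> [[] []|Q h [] []]].
have [[G r] [[pt] /= [rinj rconn]] rmin] := exists_argmin unc g0.
exists G, pt, r; split=> // x; apply: contrapT => nx.
have [e [o [[u [a eu]] ne]]] : exists e o, (exists u, same_orbit (r u) (eend e o)) /\
    ~ (exists u, same_orbit (r u) (eend e (~~ o))).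
  apply: contrapT => H; apply: nx.
  apply: (@edge_conn _ _ (fun x => exists g, same_orbit (r g) x) _ (r pt)).
    by move=> e o hu; apply: contrapT => hn; apply: H; exists e, o.
  by exists pt, 1; rewrite tact1.
pose y := eend e (~~ o).
pose y' := tact a^-1 y.
pose r' (g : option G) := if g is Some g then r g else y'.
pose R' : X := existT (fun G : finType => G -> T) (option G) r'.
have ny' w : ~ same_orbit (r w) y'.
  by move=> [b E]; apply: ne; exists w, (a * b); rewrite tactM -E /y' tactVK.
have good' : good R'.
  split; first by constructor; exact: None.
  split=> /=.
    case=> [g|] [h|] //= [b E].
    - by congr Some; apply: rinj; exists b.
    - by case: (@ny' g); exists b.
    - by case: (@ny' h); exists b^-1; rewrite E tactK.
  have adjuy : adjacent (r u) y' /\ adjacent y' (r u).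
    have E1 : eend (emul a^-1 e) o = r u by rewrite eend_mul eu tactK.
    have E2 : eend (emul a^-1 e) (~~ o) = y' by rewrite eend_mul.
    by split; [exists (emul a^-1 e), o|exists (emul a^-1 e), (~~ o); rewrite negbK].
  move=> Q Qa; have QG (g h : G) : Q (Some g) -> Q (Some h).
    by apply: (rconn (fun g => Q (Some g))) => g1 g2 ad; apply: Qa.
  have Qu : Q (Some u) <-> Q None.
    by split; apply: Qa => /=; tauto.
  by case=> [g|] [h|] //; [exact: QG|move/QG/Qu|move/Qu/QG].
have := rmin R' good'; rewrite leqNgt => /negP; apply.
apply: proper_card; apply/properP; split.
  apply/fintype.subsetP => k; rewrite !inE => /asboolPn h; apply/asboolPn => -[g hg].
  by apply: h; exists (Some g).
have [k [b E]] := lvP y'; exists k; rewrite !inE ?negbK.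
  by apply/asboolPn => -[g [c Ec]]; apply: (@ny' g); exists (b * c); rewrite tactM -Ec.
by apply/asboolP; exists None, b^-1; rewrite /= E tactK.
Qed.

End Transversal.

(** * The structure theorem of Bass and Serre for free edge stabilizers *)

Section Development.
Variables (A : groupType) (T : tree_action A) (G : Type) (r : G -> T).
Hypothesis r_inj : forall g h, same_orbit (r g) (r h) -> g = h.
Variables (vx : tedge T -> bool -> G) (gam : tedge T -> bool -> A).
Hypothesis gamP : forall j o, eend (1, j) o = tact (gam j o) (r (vx j o)).
Variables (K : groupType) (q : G -> A -> K) (k : tedge T -> K).
Hypothesis qM : forall g x y, tact x (r g) = r g -> tact y (r g) = r g ->
  q g (x * y) = q g x * q g y.

(* A homomorphism from the fundamental group to K corresponds to a function
   Phi g : A -> K for each vertex orbit g, compatible with the given maps on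
   stabilizers and stable letters; then Phi g (a * y) = F a * Phi g y. *)
Definition equivariant (Phi : G -> A -> K) : Prop :=
  (forall g y s, tact s (r g) = r g -> Phi g (y * s) = Phi g y * q g s) /\
  (forall j a, Phi (vx j true) (a * gam j true) =
               Phi (vx j false) (a * gam j false) * k j).

Lemma eendE e o : eend e o = tact (e.1 * gam e.2 o) (r (vx e.2 o)).
Proof.
rewrite tactM -gamP -eend_mul /emul /= mulg1.
by rewrite -surjective_pairing.
Qed.

Lemma r_cover (g0 : G) x : exists g a, x = tact a (r g).
Proof.
apply: (@edge_conn _ _ (fun x => exists g a, x = tact a (r g)) _ (r g0)).
  by move=> e o _; exists (vx e.2 (~~ o)), (e.1 * gam e.2 (~~ o)); apply: eendE.
by exists g0, 1; rewrite tact1.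
Qed.

(** Both conditions change [Phi] and [Psi] by the same right factors, so the quotient depends only
    on the vertex and is constant along edges. Equivariant families thus differ by a left
    constant. *)
Lemma equivariant_unique Phi Psi : equivariant Phi -> equivariant Psi ->
  forall g h y z, Psi g y * (Phi g y)^-1 = Psi h z * (Phi h z)^-1.
Proof.
move=> [P1 P2] [Q1 Q2] g h y z; set c := RHS.
pose Q x := forall g y, tact y (r g) = x -> Psi g y * (Phi g y)^-1 = c.
have Q1' g1 y1 : Psi g1 y1 * (Phi g1 y1)^-1 = c -> Q (tact y1 (r g1)).
  move=> E g2 y2 E2; have Eg : g1 = g2.
    by apply: r_inj; exists (y2^-1 * y1); rewrite tactM -E2 tactK.
  subst g2; rewrite -E -(mulVKg y1 y2); have s1 : tact (y1^-1 * y2) (r g1) = r g1.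
    by rewrite tactM E2 tactK.
  by rewrite P1 // Q1 // invgM mulgA mulgK.
suff : Q (tact y (r g)) by apply.
apply: (@edge_conn _ _ Q _ (tact z (r h))); last exact: Q1'.
move=> [a j] o Qe; rewrite eendE /=; apply: Q1'.
have /= := Qe _ _ (esym (eendE (a, j) o)).
by case: o {Qe} => /= <-; rewrite P2 Q2 invgM mulgA mulgK.
Qed.

Hypothesis g0 : G.
Let o0 : T := r g0.

Let parent x : (x <> o0) -> {p : A * tedge T * bool |
  eend p.1 p.2 = x /\ ~ side p.1 p.2 o0}.
Proof.
move=> /adjacent_sep H.
by apply: cid; case: H => e [o [h1 h2]]; exists (e, o).
Qed.

Let dist x := #|` fset_set (sep x o0)|.

Lemma sep_parent e o : ~ side e o o0 ->
  sep (eend e o) o0 = e |` sep (eend e (~~ o)) o0 /\ ~ sep (eend e (~~ o)) o0 e.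
Proof.
move=> h; split; last first.
  case=> o' [h1 h2]; apply: h2; suff -> : o' = ~~ o by apply/sideN.
  by apply: side_uniq h1 _; apply: side_end.
apply/seteqP; split=> e'.
  move=> [p [h1 h2]]; have [->|ne] := pselect (e' = e); first by left.
  by right; exists p; split=> //; apply: side_edge.
case=> [->|]; first by exists o; split=> //; apply: side_end.
move=> [p [h1 h2]]; have [E|ne] := pselect (e' = e); last first.
  by exists p; split=> //; have := side_edge ne h1; rewrite negbK.
subst e'; exfalso; apply: h2; suff -> : p = ~~ o by apply/sideN.
by apply: side_uniq h1 _; apply: side_end.
Qed.

Lemma dist_parent e o : ~ side e o o0 ->
  dist (eend e o) = (dist (eend e (~~ o))).+1.
Proof.
move=> /sep_parent [E nE]; rewrite /dist E.
rewrite fset_setU1; last exact: sep_finite.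
rewrite cardfsU1 in_fset_set; last exact: sep_finite.
by rewrite memNset.
Qed.

(** The only function at the other end of [e] compatible with the function [f] at its end [o]. *)
Let transport (e : A * tedge T) (o : bool) (f : A -> K) : A -> K := fun y =>
  f (e.1 * gam e.2 o) * (if o then (k e.2)^-1 else k e.2) *
  q (vx e.2 (~~ o)) ((e.1 * gam e.2 (~~ o))^-1 * y).

Let dev := fix dev (n : nat) (x : T) : A -> K :=
  match n, pselect (x = o0) with
  | n'.+1, right h => let p := sval (parent h) in
      transport p.1 (~~ p.2) (dev n' (eend p.1 (~~ p.2)))
  | _, _ => q g0
  end.

(* Phi is extended from a base vertex along the edges, by recursion on the
   distance; every other vertex has a unique edge towards the base vertex. *)
Lemma development : exists2 Phi, equivariant Phi & Phi g0 1 = 1.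
Proof.
have q1 g : q g 1 = 1.
  by apply: (@mulgI _ (q g 1)); rewrite -qM ?tact1 // !mulg1.
pose D x := dev (dist x) x.
have Do : D o0 = q g0 by rewrite /D; case: (dist _) => //= n; case: pselect.
have DE e o : ~ side e o o0 -> D (eend e o) = transport e (~~ o) (D (eend e (~~ o))).
  move=> h; rewrite /D (dist_parent h) /=; case: pselect => [E|ne].
    by exfalso; apply: h; rewrite -E; apply: side_end.
  case: (parent ne) => -[e' o'] /= [E1 E2].
  have Ee : e = e' by apply: adjacent_sep_unique (erefl _) h E1 E2.
  subst e'; suff -> : o' = o by [].
  by apply: (@side_uniq _ _ e _ _ (eend e o)); [rewrite -E1|]; apply: side_end.
have Dgood x g y s : tact y (r g) = x -> tact s (r g) = r g ->
    D x (y * s) = D x y * q g s.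
  move=> E Es; have [xo|xo] := pselect (x = o0).
    have Eg : g0 = g by apply: r_inj; exists y^-1; rewrite -/o0 -xo -E tactK.
    subst g; rewrite xo Do qM //.
    by rewrite E xo.
  have [e [o [e1 e2]]] := adjacent_sep xo; rewrite -e1 DE //.
  rewrite /transport negbK -!mulgA; congr (_ * (_ * _)); rewrite !mulgA.
  have Eg : vx e.2 o = g.
    by apply: r_inj; exists (y^-1 * (e.1 * gam e.2 o)); rewrite tactM -eendE e1 -E tactK.
  rewrite Eg qM //; rewrite tactM E -e1 eendE Eg tactK //.
exists (fun g y => D (tact y (r g)) y); last first.
  by rewrite tact1 -/o0 Do q1.
split=> [g y s Es|j a].
  by rewrite tactM Es; apply: Dgood.
have /= E o := esym (eendE (a, j) o); rewrite !E.
have [o ho] : exists o, ~ side (a, j) o o0.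
  by have [o h] := sideP (a, j) o0; exists (~~ o); move=> /sideN.
have := DE _ _ ho; case: o {ho} => /= ->; rewrite /transport /= ?negbK.
  by rewrite mulVg q1 mulg1.
by rewrite mulVg q1 mulg1 mulgVK.
Qed.

End Development.

(** * Subgroups as groups *)

Section SubgroupType.
Variables (G : groupType) (S : set G).
Hypothesis S_subgroup : is_subgroup S.

(* The proof is kept as a parameter so that the group structure, which needs
   it, is found by unification. *)
Definition subgroup_type : Type := let _ := S_subgroup in {x : G | S x}.

HB.instance Definition _ := gen_eqMixin subgroup_type.
HB.instance Definition _ := gen_choiceMixin subgroup_type.

Implicit Types x y z : subgroup_type.

Lemma subgroup_mem1 : S 1. Proof. exact: S_subgroup.1. Qed.

Lemma subgroup_memV a : S a -> S a^-1.
Proof. by move=> /(S_subgroup.2 _ _ subgroup_mem1); rewrite mul1g. Qed.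

Lemma subgroup_memM a b : S a -> S b -> S (a * b).
Proof. by move=> Sa /subgroup_memV /(S_subgroup.2 _ _ Sa); rewrite invgK. Qed.

Definition sub_one : subgroup_type := exist _ 1 subgroup_mem1.
Definition sub_inv x : subgroup_type :=
  exist _ (sval x)^-1 (subgroup_memV (svalP x)).
Definition sub_mul x y : subgroup_type :=
  exist _ (sval x * sval y) (subgroup_memM (svalP x) (svalP y)).

Lemma sub_val_inj x y : sval x = sval y -> x = y.
Proof.
by case: x y => x Sx [y Sy] /= E; subst y; rewrite (Prop_irrelevance Sx Sy).
Qed.

Fact sub_mulA : associative sub_mul.
Proof. by move=> x y z; apply: sub_val_inj; rewrite /= mulgA. Qed.
Fact sub_mul1 : left_id sub_one sub_mul.
Proof. by move=> x; apply: sub_val_inj; rewrite /= mul1g. Qed.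
Fact sub_1mul : right_id sub_one sub_mul.
Proof. by move=> x; apply: sub_val_inj; rewrite /= mulg1. Qed.
Fact sub_mulV : left_inverse sub_one sub_inv sub_mul.
Proof. by move=> x; apply: sub_val_inj; rewrite /= mulVg. Qed.
Fact sub_Vmul : right_inverse sub_one sub_inv sub_mul.
Proof. by move=> x; apply: sub_val_inj; rewrite /= mulgV. Qed.

HB.instance Definition _ := isGroup.Build subgroup_type
  sub_mulA sub_mul1 sub_1mul sub_mulV sub_Vmul.

Definition sub_incl (x : subgroup_type) : G := sval x.
Fact sub_incl_morph : {morph sub_incl : x y / x * y}. Proof. by []. Qed.
HB.instance Definition _ :=
  isMultiplicative.Build subgroup_type G sub_incl sub_incl_morph.

End SubgroupType.

Definition to_multiplicative (G K : groupType) (f : G -> K)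
    (fM : {morph f : x y / x * y}) : {multiplicative G -> K} :=
  HB.pack_for {multiplicative G -> K} f (isMultiplicative.Build G K f fM).

Lemma multiplicative1 (G K : groupType) (f : {multiplicative G -> K}) : f 1 = 1.
Proof. by apply: (@mulgI _ (f 1)); rewrite -gmulfM !mulg1. Qed.

Lemma multiplicativeV (G K : groupType) (f : {multiplicative G -> K}) x :
  f x^-1 = (f x)^-1.
Proof. by symmetry; apply: mulg1_eq; rewrite -gmulfM mulgV multiplicative1. Qed.

Lemma connect_invariant (V : finType) (e : rel V) (Q : V -> Prop) :
  (forall u v, e u v -> Q u -> Q v) -> forall u v, connect e u v -> Q u -> Q v.
Proof.
move=> h u v /connectP[p]; elim: p u => [|w p IH] u /= => [_ -> //|].
by move=> /andP[uw wp] E Qu; apply: IH wp E _; apply: h uw Qu.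
Qed.

(** * The quotient graph of groups and its Bass-Serre tree *)

Section Realization.
Variables (A : groupType) (T : tree_action A) (G : finType) (r : G -> T) (g0 : G).
Hypothesis r_inj : forall g h, same_orbit (r g) (r h) -> g = h.
Variables (vx : tedge T -> bool -> G) (gam : tedge T -> bool -> A).
Hypothesis gamP : forall j o, eend (1, j) o = tact (gam j o) (r (vx j o)).
Variable F : {set tedge T}.
Hypothesis F_gam : forall j, j \in F -> gam j false = gam j true.
Hypothesis F_conn : forall Q : G -> Prop,
  (forall j, j \in F -> Q (vx j false) <-> Q (vx j true)) -> forall g h, Q g -> Q h.

Definition stabilizer (x : T) : set A := [set a | tact a x = x].

Lemma stabilizer_subgroup x : is_subgroup (stabilizer x).
Proof.
split; first exact: tact1.
by move=> a b ax bx; rewrite /stabilizer /= tactM -[in LHS]bx tactK.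
Qed.

Lemma trivial_subgroup : is_subgroup [set (1 : A)].
Proof. by split=> // x y -> ->; rewrite /= mulgV. Qed.

Let VG (g : G) : groupType := subgroup_type (stabilizer_subgroup (r g)).
Let EG : groupType := subgroup_type trivial_subgroup.

Fact one_morph (g : G) : {morph (fun=> 1 : VG g) : x y / (x * y : EG) >-> x * y}.
Proof. by move=> x y; rewrite mulg1. Qed.

Lemma one_injective g : injective (to_multiplicative (@one_morph g)).
Proof. by move=> [x xE] [y yE] _; apply: sub_val_inj; rewrite /= xE yE. Qed.

Definition quotient_graph : graph_of_groups :=
  @GraphOfGroups G (tedge T) (vx^~ false) (vx^~ true) VG (fun=> EG)
    (fun e => to_multiplicative (@one_morph (vx e false)))
    (fun e => to_multiplicative (@one_morph (vx e true)))
    (fun e => @one_injective _) (fun e => @one_injective _).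

(** There is no circuit because [lift j] separates the lifted ends of [j] in the tree, and no other
    lifted edge of [F] crosses it. *)
Lemma quotient_spanning : @spanning_tree quotient_graph F.
Proof.
split.
- by apply/card_gt0P; exists g0.
- move=> u v; apply: (@F_conn (connect (@gadj quotient_graph F) u) _ u) => //.
  by move=> j jF; split=> h; apply: (connect_trans h); apply: connect1;
     apply/existsP; exists j; rewrite jF /= !eqxx ?orbT.
- move=> j jF; apply/negP => H.
  pose lift j := ((gam j false)^-1, j).
  have liftE i o : i \in F -> eend (lift i) o = r (vx i o).
    by move=> iF; rewrite (eendE gamP) /=; case: o; rewrite -?F_gam // mulVg tact1.
  have : side (lift j) false (r (vx j true)).
    apply: (connect_invariant (Q := fun u => side (lift j) false (r u)) _ H); last first.
      by have := side_end (lift j) false; rewrite liftE.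
    move=> u v /existsP[i /andP[]]; rewrite !inE => /andP[ij iF].
    have ne : lift j <> lift i by move=> /(congr1 snd) /= E; rewrite E eqxx in ij.
    by case/orP => /andP[/eqP <- /eqP <-]; rewrite -!liftE //; apply: side_edge.
  by rewrite -liftE //; apply: (@side_endN _ _ (lift j) false).
Qed.

Definition stable_letter (j : tedge T) : A := (gam j false)^-1 * gam j true.

Lemma stable_letter_tree j : j \in F -> stable_letter j = 1.
Proof. by move=> jF; rewrite /stable_letter F_gam // mulVg. Qed.

Lemma stable_letter_rel (e : gedge quotient_graph) (x : egroup e) :
  stable_letter e * sub_incl (etgt e x) * (stable_letter e)^-1 = sub_incl (esrc e x).
Proof. by rewrite /sub_incl /= mulg1 mulgV. Qed.

Definition quotient_hom : @pi1_hom quotient_graph F A :=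
  @Pi1Hom quotient_graph F A
    (fun g => to_multiplicative (@sub_incl_morph _ _ (stabilizer_subgroup (r g))))
    stable_letter stable_letter_tree stable_letter_rel.

(** The required homomorphism is [Phi g0]. Translating [Phi] by [a] gives another equivariant
    family, hence a left multiple of [Phi]; the factor is [Phi g0 a], because [Phi g 1 = 1] along
    the maximal tree. *)
Lemma quotient_pi1 : is_pi1 quotient_hom.
Proof.
move=> K q.
(* [development] takes total functions; the value 1 off the stabilizer is arbitrary. *)
pose qx g x : K := if pselect (tact x (r g) = r g) is left h
  then vhom q g (exist (stabilizer (r g)) x h) else 1.
have qxE g (x : VG g) : qx g (sval x) = vhom q g x.
  rewrite /qx; case: pselect => h; last by case: (h (svalP x)).
  by congr (vhom q g _); apply: sub_val_inj.
have qxM g x y : tact x (r g) = r g -> tact y (r g) = r g ->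
    qx g (x * y) = qx g x * qx g y.
  move=> hx hy.
  rewrite -[x]/(sval (exist (stabilizer (r g)) x hx : VG g)).
  rewrite -[y]/(sval (exist (stabilizer (r g)) y hy : VG g)).
  by rewrite -[X in qx g X]/(sval (_ * _ : VG g)) !qxE gmulfM.
have [Phi Phi_eq Phi1] := development r_inj gamP (stable q) qxM g0.
have Phi1' g : Phi g 1 = 1.
  apply: (@F_conn (fun g => Phi g 1 = 1) _ g0) => // j jF.
  have := Phi_eq.2 j (gam j false)^-1.
  rewrite -F_gam // !mulVg stable_tree // mulg1 => ->.
  by [].
have PhiM a g y : Phi g (a * y) = Phi g0 a * Phi g y.
  have Psi_eq : equivariant r vx gam qx (stable q) (fun g y => Phi g (a * y)).
    split=> [h z s hs|j b]; first by rewrite mulgA (Phi_eq.1 _ (a * z)).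
    by rewrite /= !mulgA Phi_eq.2.
  have := equivariant_unique r_inj gamP Phi_eq Psi_eq g g0 y 1.
  by rewrite mulg1 Phi1 invg1 mulg1 => <-; rewrite mulgVK.
pose f := to_multiplicative (fun a b => PhiM a g0 b : (fun a => Phi g0 a) (a * b) = _).
exists f; split; first split.
- move=> g x; have := Phi_eq.1 g 1 (sval x) (svalP x).
  by rewrite mul1g Phi1' mul1g qxE => <-; have := PhiM (sval x) g 1; rewrite mulg1 Phi1' mulg1.
- move=> j; have := Phi_eq.2 j (gam j false)^-1.
  rewrite mulVg Phi1' mul1g => <-.
  by have := PhiM (stable_letter j) (vx j true) 1; rewrite mulg1 Phi1' mulg1.
move=> f' [f'v f'e] a.
have Psi_eq : equivariant r vx gam qx (stable q) (fun g y => f' y).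
  split=> [g y s hs|j b].
    by rewrite gmulfM -[s]/(sval (exist (stabilizer (r g)) s hs : VG g)) qxE -f'v.
  by rewrite -f'e -gmulfM /= /stable_letter !mulgA mulgK.
have := equivariant_unique r_inj gamP Phi_eq Psi_eq g0 g0 a 1.
rewrite /= Phi1 multiplicative1 mulgV => E.
by apply/divg1_eq.
Qed.

Definition quotient_marked : marked_graph_of_groups A :=
  MarkedGraphOfGroups quotient_spanning quotient_pi1.

Lemma quotient_edges : edge_groups_trivial quotient_marked.
Proof. by move=> e [x xE]; apply: sub_val_inj; rewrite /= xE. Qed.

Definition to_tree (p : bs_vertex quotient_marked) : T :=
  tact (sval (cid (svalP p))) (r (sval p).1).

Lemma to_tree_mk g a : to_tree (@bs_mk _ quotient_marked g a) = tact a (r g).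
Proof.
rewrite /to_tree; case: cid => b /= E.
have : @vcoset _ quotient_marked g a a by exists 1; rewrite multiplicative1 mulg1.
by rewrite E => -[[x hx] ->]; rewrite tactM /= /sub_incl /= hx.
Qed.

Lemma to_tree_act a p : to_tree (bs_act a p) = tact a (to_tree p).
Proof. by have [v [b ->]] := bs_mkP p; rewrite bs_act_mk !to_tree_mk tactM. Qed.

Lemma to_tree_bij : bijective to_tree.
Proof.
apply: inj_surj_bij => [p q|x].
  have [v [a ->]] := bs_mkP p; have [w [b ->]] := bs_mkP q; rewrite !to_tree_mk => E.
  have vw : v = w by apply: r_inj; exists (b^-1 * a); rewrite tactM E tactK.
  subst w; apply: bs_eqP; congr pair; apply/funext => y; apply/propext.
  have h c d : tact c (r v) = tact d (r v) ->
      @vcoset _ quotient_marked v c y -> @vcoset _ quotient_marked v d y.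
    move=> cd [x ->].
    have hx : tact (d^-1 * (c * sval x)) (r v) = r v.
      by rewrite !tactM (svalP x) cd tactK.
    by exists (exist (stabilizer (r v)) _ hx); rewrite /= /sub_incl /= mulVKg.
  by split; apply: h.
have [g [a ->]] := r_cover gamP g0 x.
by exists (@bs_mk _ quotient_marked g a); rewrite to_tree_mk.
Qed.

Lemma to_tree_joined p q :
  bs_joined [set: gedge quotient_marked]%SET p q <-> adjacent (to_tree p) (to_tree q).
Proof.
have sE (e : tedge T) a : to_tree (@bs_mk _ quotient_marked (vx e false) a) =
    eend (a * (gam e false)^-1, e) false.
  by rewrite to_tree_mk (eendE gamP) /= mulgVK.
have tE (e : tedge T) a : to_tree (@bs_mk _ quotient_marked (vx e true) (a * stable_letter e)) =
    eend (a * (gam e false)^-1, e) true.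
  by rewrite to_tree_mk (eendE gamP) /= !mulgA.
split.
  move=> [e [a [_ [[-> ->]|[-> ->]]]]].
    by exists (a * (gam e false)^-1, e), false; rewrite sE tE.
  by exists (a * (gam e false)^-1, e), true; rewrite sE tE.
move=> [[a e] [o [E1 E2]]]; exists e, (a * gam e false); split; first by rewrite inE.
have ti := bij_inj to_tree_bij.
by case: o E1 E2 => E1 E2; [right|left]; split; apply: ti;
  rewrite -?E1 -?E2 ?sE ?tE ?mulgK.
Qed.

End Realization.

(** The maximal tree consists of the edges with a translate joining two representatives. Carrying
    this translate back takes a single element for both ends, so the stable letter is 1. The last
    clause will show that the splitting is relative. *)
Theorem bass_serre (A : groupType) (T : tree_action A) (j0 : tedge T) :
  exists (S : marked_graph_of_groups A) (phi : bs_vertex S -> T),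
  [/\ edge_groups_trivial S, bijective phi,
      (forall a p, phi (bs_act a p) = tact a (phi p)),
      (forall p q, bs_joined [set: gedge S]%SET p q <-> adjacent (phi p) (phi q)) &
      (forall v a, tact a (phi (bs_mk v 1)) = phi (bs_mk v 1) ->
        exists x : vgroup v, a = vhom (mhom S) v x)].
Proof.
have [G [g0 [r [r_inj r_cov r_conn]]]] := transversal j0.
pose liftable j := exists c g h, eend (c, j) false = r g /\ eend (c, j) true = r h.
have key j : exists (v : bool -> G) (c : bool -> A),
    (forall o, eend (1, j) o = tact (c o) (r (v o))) /\
    (liftable j -> c false = c true).
  have [[c [g [h [E1 E2]]]]|nl] := pselect (liftable j).
    exists (fun o => if o then h else g), (fun=> c^-1); split=> // -[].
      by rewrite -E2 -eend_mul /emul /= mulVg.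
    by rewrite -E1 -eend_mul /emul /= mulVg.
  have [g [a E1]] := r_cov (eend (1, j) false).
  have [h [b E2]] := r_cov (eend (1, j) true).
  by exists (fun o => if o then h else g), (fun o => if o then b else a); split=> // -[].
pose vx j := sval (cid (key j)).
pose gam j := sval (cid (svalP (cid (key j)))).
have gamP j o : eend (1, j) o = tact (gam j o) (r (vx j o)).
  exact: (svalP (cid (svalP (cid (key j))))).1.
pose F := [set j | `[< liftable j >]]%SET.
have F_gam j : j \in F -> gam j false = gam j true.
  by rewrite inE => /asboolP; exact: (svalP (cid (svalP (cid (key j))))).2.
have F_conn (Q : G -> Prop) :
    (forall j, j \in F -> Q (vx j false) <-> Q (vx j true)) -> forall g h, Q g -> Q h.
  move=> QF; apply: r_conn => g h [[c j] [o [E1 E2]]].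
  have jF : j \in F.
    by rewrite inE; apply/asboolP; case: o E1 E2 => E1 E2;
       [exists c, h, g | exists c, g, h].
  have vE p w : eend (c, j) p = r w -> vx j p = w.
    by rewrite (eendE gamP) => E; apply: r_inj; exists (c * gam j p); rewrite -E.
  by rewrite -(vE _ _ E1) -(vE _ _ E2); case: (o); have := QF _ jF; tauto.
exists (quotient_marked g0 r_inj gamP F_gam F_conn).
exists (@to_tree _ _ _ _ g0 r_inj _ _ gamP _ F_gam F_conn).
split.
- exact: quotient_edges.
- exact: to_tree_bij.
- exact: to_tree_act.
- exact: to_tree_joined.
- move=> v a; rewrite !to_tree_mk tact1 => h.
  by exists (exist (stabilizer (r v)) a h).
Qed.

(** * Nested cuts in a connected graph *)

Section Nested.
Variable P : Type.
Implicit Types C D M : set P.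

Lemma nested_symC C D : nested_sets C D -> nested_sets D C.
Proof.
case=> h.
- by constructor 4 => x nD /h.
- by constructor 2 => x Dx /h.
- by constructor 3 => x nD; apply: contrapT => nC; apply: nD; apply: h.
- by constructor 1 => x Dx; apply: contrapT => nC; apply: (h x).
Qed.

Lemma nestedCr C D : nested_sets C D -> nested_sets C (~` D).
Proof.
case=> h; [constructor 2|constructor 1|constructor 4|constructor 3] => //;
  by rewrite setCK.
Qed.

Lemma nestedCl C D : nested_sets C D -> nested_sets (~` C) D.
Proof. by move=> /nested_symC/nestedCr/nested_symC. Qed.

Lemma crossCr C D : ~ nested_sets C D -> ~ nested_sets C (~` D).
Proof. by move=> h /nestedCr; rewrite setCK. Qed.

Lemma crossCl C D : ~ nested_sets C D -> ~ nested_sets (~` C) D.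
Proof. by move=> h /nestedCl; rewrite setCK. Qed.

Lemma not_subset C D : ~ (C `<=` D) -> exists2 x, C x & ~ D x.
Proof.
move=> h; apply: contrapT => H; apply: h => x Cx; apply: contrapT => Dx.
by apply: H; exists x.
Qed.

Lemma crossP C D : ~ nested_sets C D ->
  [/\ exists2 x, C x & D x, exists2 x, C x & ~ D x,
      exists2 x, ~ C x & D x & exists2 x, ~ C x & ~ D x].
Proof.
move=> h; split; apply: contrapT => H; apply: h.
- by constructor 2 => x Cx Dx; apply: H; exists x.
- by constructor 1 => x Cx; apply: contrapT => Dx; apply: H; exists x.
- by constructor 4 => x Cx Dx; apply: H; exists x.
- by constructor 3 => x Cx; apply: contrapT => Dx; apply: H; exists x.
Qed.

(** Crossing excludes the mixed cases: [M] inside [C] and its complement inside [D], for instance,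
    would make [C] and [D] nested. *)
Lemma nested_corner M C D : ~ nested_sets C D ->
  nested_sets M C -> nested_sets M D -> nested_sets M (C `&` D).
Proof.
move=> CD [] hC [] hD.
- by constructor 1 => x Mx; split; [apply: hC|apply: hD].
- by constructor 2 => x Mx [_ Dx]; apply: (hD x).
- exfalso; apply: CD; constructor 3 => x nC; apply: hD => Mx; apply: nC; exact: hC.
- exfalso; apply: CD; constructor 4 => x nC Dx; apply: (hD x) => // Mx.
  by apply: nC; apply: hC.
- by constructor 2 => x Mx [Cx _]; apply: (hC x).
- by constructor 2 => x Mx [Cx _]; apply: (hC x).
- by constructor 2 => x Mx [Cx _]; apply: (hC x).
- by constructor 2 => x Mx [Cx _]; apply: (hC x).
- exfalso; apply: CD; constructor 3 => x nC; apply: hD; apply: contrapT => Mx.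
  by apply: nC; apply: hC.
- by constructor 2 => x Mx [_ Dx]; apply: (hD x).
- by constructor 3 => x Mx; split; [apply: hC|apply: hD].
- by constructor 4 => x Mx [_ Dx]; apply: (hD x).
- exfalso; apply: CD; constructor 1 => x Cx; apply: hD; apply: contrapT => Mx.
  by apply: (hC x).
- by constructor 4 => x Mx [Cx _]; apply: (hC x).
- by constructor 4 => x Mx [Cx _]; apply: (hC x).
- by constructor 4 => x Mx [Cx _]; apply: (hC x).
Qed.

(** Used contrapositively: a set crossing two opposite corners of [C] and [D] crosses [C], and by
    symmetry [D]. *)
Lemma nested_opposite_corner M C D : nested_sets M C ->
  nested_sets M (C `&` D) \/ nested_sets M (~` C `&` ~` D).
Proof.
case=> h.
- by right; constructor 2 => x Mx [nC _]; apply: nC; apply: h.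
- by left; constructor 2 => x Mx [Cx _]; apply: (h x).
- by right; constructor 4 => x nM [nC _]; apply: nC; apply: h.
- by left; constructor 4 => x nM [Cx _]; apply: (h x).
Qed.

(** The Boolean algebra spanned by [S]. *)
Inductive generated (S : set (set P)) : set P -> Prop :=
| generated_in C of S C : generated S C
| generated0 : generated S set0
| generatedC C of generated S C : generated S (~` C)
| generatedI C D of generated S C & generated S D : generated S (C `&` D).

Lemma generatedU S C D : generated S C -> generated S D -> generated S (C `|` D).
Proof.
move=> /generatedC hC /generatedC hD.
by rewrite -[_ `|` _]setCK setCU; apply/generatedC/generatedI.
Qed.

Lemma generatedCN S C : ~ generated S C -> ~ generated S (~` C).
Proof. by move=> h /generatedC; rewrite setCK. Qed.

Lemma generated_sub S S' C : S `<=` generated S' -> generated S C -> generated S' C.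
Proof.
move=> h; elim=> [D /h //| |D _|D E _ IHD _ IHE].
- exact: generated0.
- exact: generatedC.
- exact: generatedI.
Qed.

End Nested.

(** * Counting in finite sets *)

Definition csize (X : choiceType) (S : set X) : nat := #|` fset_set S|.

Section CardinalityOfFiniteSets.
Variable X : choiceType.
Implicit Types S B : set X.

Lemma csize_sub S B : finite_set B -> S `<=` B -> (csize S <= csize B)%N.
Proof.
move=> fB SB; have fS := sub_finite_set SB fB.
by apply: fsubset_leq_card; rewrite -fset_set_sub.
Qed.

Lemma csize_lt S B x : finite_set B -> S `<=` B -> B x -> ~ S x ->
  (csize S < csize B)%N.
Proof.
move=> fB SB Bx Sx; have fS := sub_finite_set SB fB.
apply: fproper_ltn_card; rewrite fproperE; apply/andP; split; first by rewrite -fset_set_sub.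
apply/fsubsetPn; exists x; rewrite in_fset_set //; first by rewrite mem_set.
by rewrite memNset.
Qed.

Lemma csizeUI S B : finite_set S -> finite_set B ->
  (csize S + csize B = csize (S `|` B) + csize (S `&` B))%N.
Proof. by move=> fS fB; rewrite /csize fset_setU // fset_setI // cardfsUI. Qed.

Variables S1 S2 B1 B2 : set X.
Hypotheses (fB1 : finite_set B1) (fB2 : finite_set B2).
Hypotheses (U : S1 `|` S2 `<=` B1 `|` B2) (I : S1 `&` S2 `<=` B1 `&` B2).

Let fB : finite_set (B1 `|` B2). Proof. by rewrite finite_setU. Qed.
Let fS1 : finite_set S1.
Proof. by apply: sub_finite_set fB; apply: subset_trans U; apply: subsetUl. Qed.
Let fS2 : finite_set S2.
Proof. by apply: sub_finite_set fB; apply: subset_trans U; apply: subsetUr. Qed.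
Let fI : finite_set (B1 `&` B2).
Proof. by apply: sub_finite_set fB1 => x []. Qed.

(** The two inclusions compare multiplicities: what is counted twice on the left is counted twice on
    the right. Applied to corners, this is submodularity of the coboundary size. *)
Lemma csize2_le : (csize S1 + csize S2 <= csize B1 + csize B2)%N.
Proof. by rewrite (csizeUI fS1 fS2) (csizeUI fB1 fB2); apply: leq_add; apply: csize_sub. Qed.

Lemma csize2_lt x : (B1 `|` B2) x -> ~ (S1 `|` S2) x ->
  (csize S1 + csize S2 < csize B1 + csize B2)%N.
Proof.
move=> h1 h2; rewrite (csizeUI fS1 fS2) (csizeUI fB1 fB2) -addSn; apply: leq_add; last exact: csize_sub.
exact: csize_lt h1 h2.
Qed.

End CardinalityOfFiniteSets.

Lemma csize_image (X Y : choiceType) (f : X -> Y) (S : set X) :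
  finite_set S -> (csize (f @` S) <= csize S)%N.
Proof.
by move=> fS; rewrite /csize fset_set_image //; apply: leq_imfset_card.
Qed.

(** * Coboundaries and tight cuts *)

Section Coboundary.
Variable P : choiceType.
Implicit Types (X : set (P * P)) (C D N U : set P) (e : P * P).

Definition coboundary X C : set (P * P) := [set e | X e /\ ~ (C e.1 <-> C e.2)].

Definition graph_connected X : Prop :=
  forall U, (forall e, X e -> U e.1 <-> U e.2) -> forall x y, U x -> U y.

Definition connected_in X C : Prop :=
  forall U, (forall e, X e -> C e.1 -> C e.2 -> U e.1 <-> U e.2) ->
  forall x y, C x -> C y -> U x -> U y.

Definition tight X C : Prop := connected_in X C /\ connected_in X (~` C).

Lemma coboundaryC X C : coboundary X (~` C) = coboundary X C.
Proof.
apply/seteqP; split=> e [Xe h]; split=> // h'; apply: h.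
  by rewrite /setC /=; tauto.
by have := EM (C e.1); have := EM (C e.2); move: h'; rewrite /setC /=; tauto.
Qed.

Lemma coboundary_corner C D X :
  coboundary X (C `&` D) `|` coboundary X (~` C `&` ~` D) `<=`
    coboundary X C `|` coboundary X D /\
  coboundary X (C `&` D) `&` coboundary X (~` C `&` ~` D) `<=`
    coboundary X C `&` coboundary X D.
Proof.
split=> e; rewrite /coboundary /setI /setU /setC /=;
  have := EM (C e.1); have := EM (C e.2); have := EM (D e.1); have := EM (D e.2);
  tauto.
Qed.

Lemma corner_finite X C D : finite_set (coboundary X C) ->
  finite_set (coboundary X D) -> finite_set (coboundary X (C `&` D)).
Proof.
move=> fC fD; have [h _] := coboundary_corner C D X.
apply: sub_finite_set (_ : finite_set (coboundary X C `|` coboundary X D)).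
  by apply: subset_trans h; apply: subsetUl.
by rewrite finite_setU.
Qed.

Lemma corner_csize X C D : finite_set (coboundary X C) ->
  finite_set (coboundary X D) ->
  (csize (coboundary X (C `&` D)) + csize (coboundary X (~` C `&` ~` D)) <=
   csize (coboundary X C) + csize (coboundary X D))%N.
Proof. by move=> fC fD; have [h1 h2] := coboundary_corner C D X; apply: csize2_le. Qed.

Lemma csize0 (Y : choiceType) (S : set Y) : finite_set S -> csize S = 0%N -> S = set0.
Proof.
move=> fS /eqP; rewrite cardfs_eq0 => /eqP E; apply/seteqP; split=> // x Sx.
by have : x \in fset0 by rewrite -E in_fset_set // mem_set.
Qed.

(* By induction on the size: either e is a bridge, which determines C, or
   C also separates an edge of a fixed path joining the ends of e. *)
Lemma tight_through_finite m X e : finite_set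
  [set C | [/\ tight X C, finite_set (coboundary X C), csize (coboundary X C) = m &
               coboundary X C e]].
Proof.
elim: m X e => [|m IH] X e.
  apply: (@sub_finite_set _ _ set0); last exact: finite_set0.
  by move=> C [_ fC /(csize0 fC) ->].
pose X' := X `\ e.
have [[U [U1 U2]]|nobridge] :=
    pselect (exists U, (forall e', X' e' -> U e'.1 <-> U e'.2) /\ ~ (U e.1 <-> U e.2)).
  have key C V : connected_in X C -> coboundary X C e ->
      (forall e', X' e' -> V e'.1 <-> V e'.2) -> forall x y, C x -> C y -> V x -> V y.
    move=> cC [_ Ce] hV; apply: cC => e' Xe' C1 C2; apply: hV; split=> // E.
    by apply: Ce; rewrite -E; tauto.
  apply: (@sub_finite_set _ _ [set U; ~` U]); last exact: finite_set2.
  move=> C [[c1 c2] _ _ Ce].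
  have Ce' : coboundary X (~` C) e by rewrite coboundaryC.
  have UN : forall e', X' e' -> (~` U) e'.1 <-> (~` U) e'.2.
    by move=> e' /U1; rewrite /setC /=; tauto.
  have k1 := key _ _ c1 Ce U1; have k2 := key _ _ c1 Ce UN.
  have k3 := key _ _ c2 Ce' U1; have k4 := key _ _ c2 Ce' UN.
  have eqU p q : C p -> ~ C q -> U p -> ~ U q -> C = U.
    move=> Cp Cq Up Uq; apply/seteqP; split=> x Hx; first exact: (k1 p x).
    by apply: contrapT => nC; apply: (k4 q x).
  have eqNU p q : C p -> ~ C q -> ~ U p -> U q -> C = ~` U.
    move=> Cp Cq Up Uq; apply/seteqP; split=> x Hx; first exact: (k2 p x).
    by apply: contrapT => nC; apply: Hx; apply: (k3 q x).
  have := eqU e.1 e.2; have := eqU e.2 e.1; have := eqNU e.1 e.2; have := eqNU e.2 e.1.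
  have := EM (C e.1); have := EM (C e.2); have := EM (U e.1); have := EM (U e.2).
  case: Ce => _; rewrite /=; tauto.
(* [L] plays the role of the edges of a path from [e.1] to [z] avoiding [e]. *)
pose Q z := exists L, [/\ finite_set L, L `<=` X' &
  forall C, ~ (C e.1 <-> C z) -> exists2 e', L e' & coboundary X C e'].
have Q1 : Q e.1 by exists set0; split=> // C; tauto.
have QX e' : X' e' -> Q e'.1 <-> Q e'.2.
  move=> Xe'; split=> -[L [fL LX hL]]; exists (e' |` L); split.
  - by rewrite finite_setU.
  - by move=> z [->|/LX].
  - move=> C h; have [/hL[z Lz Cz]|h'] := EM (~ (C e.1 <-> C e'.1)).
      by exists z => //; right.
    by exists e'; [left|split; [case: Xe'|move: h h'; tauto]].
  - by rewrite finite_setU.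
  - by move=> z [->|/LX].
  - move=> C h; have [/hL[z Lz Cz]|h'] := EM (~ (C e.1 <-> C e'.2)).
      by exists z => //; right.
    by exists e'; [left|split; [case: Xe'|move: h h'; tauto]].
have [L [fL LX hL]] : Q e.2.
  apply: contrapT => Q2; apply: nobridge; exists Q; split=> //.
  by tauto.
apply: (@sub_finite_set _ _ (\bigcup_(e' in L)
  [set C | [/\ tight X' C, finite_set (coboundary X' C),
               csize (coboundary X' C) = m & coboundary X' C e']])); last first.
  by apply: bigcup_finite => // e' _; apply: IH.
move=> C [[c1 c2] fC sC Ce]; have [e' Le' Ce'] := hL C Ce.2.
have E : coboundary X' C = coboundary X C `\ e.
  by apply/seteqP; split=> z; rewrite /coboundary /X' /setD /=; tauto.
have cX D : connected_in X D -> coboundary X D e -> connected_in X' D.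
  move=> cD [_ De] V hV; apply: cD => z Xz D1 D2; apply: hV => //; split=> // Ez.
  by apply: De; rewrite -Ez; tauto.
exists e' => //; split.
- split; first exact: cX.
  by apply: cX => //; rewrite coboundaryC.
- by rewrite E; apply: sub_finite_set fC => z [].
- apply: succn_inj; rewrite -sC E /csize fset_setD // fset_set1.
  by rewrite [in RHS](cardfsD1 e) in_fset_set // mem_set.
- by split; [exact: LX|case: Ce'].
Qed.

End Coboundary.

(** * Finiteness and tightness in a connected graph *)

Section ConnectedGraph.
Variables (P : choiceType) (X : set (P * P)).
Hypothesis X_conn : graph_connected X.
Implicit Types (C D N M : set P).
Local Notation d := (coboundary X).
Local Notation size C := (csize (coboundary X C)).

Definition separates C (x y : P) := ~ (C x <-> C y).

Lemma coboundary_proper C x y : C x -> ~ C y -> exists e, d C e.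
Proof.
move=> Cx Cy; apply: contrapT => H; apply: Cy; apply: (@X_conn C _ x y) => // e Xe.
by apply: contrapT => h; apply: H; exists e.
Qed.

Lemma tight_sep_finite n x y : finite_set
  [set C | [/\ tight X C, finite_set (d C), (size C <= n)%N & separates C x y]].
Proof.
pose F (y : P) := [set C | [/\ tight X C, finite_set (d C), (size C <= n)%N & separates C x y]].
have step u v (e : P * P) : X e -> (e = (u, v) \/ e = (v, u)) ->
    finite_set (F u) -> finite_set (F v).
  move=> Xe E fu; apply: (@sub_finite_set _ _ (F u `|` \bigcup_(m in `I_n.+1)
    [set C | [/\ tight X C, finite_set (d C), size C = m & d C e]])); last first.
    rewrite finite_setU; split=> //; apply: bigcup_finite => [|m _].
      exact: finite_II.
    exact: tight_through_finite.
  move=> C [tC fC sC Cxv]; have [Cuv|Cuv] := EM (C u <-> C v).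
    by left; split=> //; move: Cxv; rewrite /separates; tauto.
  right; exists (size C); first by rewrite /= ltnS.
  by split=> //; split=> //; case: E => -> /=; tauto.
apply: (@X_conn (fun y => finite_set (F y)) _ x) => [[u v] Xe /=|].
  by split; apply: (step _ _ _ Xe); tauto.
suff -> : F x = set0 by exact: finite_set0.
by apply/seteqP; split=> // C [_ _ _]; rewrite /separates; tauto.
Qed.

Lemma connected_in_cross N C : connected_in X N -> (exists2 x, N x & C x) ->
  (exists2 x, N x & ~ C x) -> exists e, [/\ d C e, N e.1 & N e.2].
Proof.
move=> cN [x Nx Cx] [y Ny Cy]; apply: contrapT => H; apply: Cy.
apply: (@cN C _ x y) => // e Xe N1 N2; apply: contrapT => h.
by apply: H; exists e.
Qed.

(** As [N] and its complement are connected and both meet [C] and its complement, [d C] has one edge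
    inside [N] and another outside. So [N] separates one of finitely many pairs of points. *)
Lemma tight_cross_finite n C : finite_set (d C) -> finite_set
  [set N | [/\ tight X N, finite_set (d N), (size N <= n)%N & ~ nested_sets N C]].
Proof.
move=> fC; apply: (@sub_finite_set _ _ (\bigcup_(e in d C) \bigcup_(e' in d C)
   [set N | [/\ tight X N, finite_set (d N), (size N <= n)%N & separates N e.1 e'.1]])).
  move=> N [[t1 t2] fN sN /crossP[h1 h2 h3 h4]].
  have [e [e1 e2 _]] := connected_in_cross t1 h1 h2.
  have [e' [e1' e2' _]] := connected_in_cross t2 h3 h4.
  by exists e => //; exists e' => //; split=> // -[/(_ e2)].
by apply: bigcup_finite => // e _; apply: bigcup_finite => // e' _; apply: tight_sep_finite.
Qed.

Definition small n : set (set P) := [set C | finite_set (d C) /\ (size C < n)%N].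

(** If [C] fell into two parts, their coboundaries would be disjoint, non-empty and contained in
    that of [C]. Both parts would be smaller, hence generated, and so would be [C]. *)
Lemma minimal_connected_in (S : set (set P)) C : finite_set (d C) ->
  ~ generated S C -> small (size C) `<=` generated S -> connected_in X C.
Proof.
move=> fC nC sS U hU x y Cx Cy Ux; apply: contrapT => Uy; apply: nC.
have E : C = (C `&` U) `|` (C `&` ~` U).
  by apply/seteqP; split=> z; rewrite /setU /setI /setC /=; have := EM (U z); tauto.
have s1 : d (C `&` U) `<=` d C.
  move=> e [Xe]; have := hU e Xe; rewrite /coboundary /setI /=; tauto.
have s2 : d (C `&` ~` U) `<=` d C.
  move=> e [Xe]; have := hU e Xe; rewrite /coboundary /setI /setC /=; tauto.
have dj e : d (C `&` U) e -> ~ d (C `&` ~` U) e.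
  move=> [Xe h1] [_]; move: h1; have := hU e Xe; rewrite /setI /setC /=.
  have := EM (C e.1); have := EM (C e.2); have := EM (U e.1); have := EM (U e.2); tauto.
have [e1 he1] : exists e, d (C `&` U) e by apply: (@coboundary_proper _ x y); [|case].
have [e2 he2] : exists e, d (C `&` ~` U) e.
  by apply: (@coboundary_proper _ y x); [|case=> _; apply].
rewrite E; apply: generatedU; apply: sS; split.
- exact: sub_finite_set fC.
- by apply: (csize_lt (x := e2)) => //; [exact: s2|move=> /dj].
- exact: sub_finite_set fC.
- by apply: (csize_lt (x := e1)) => //; [exact: s1|exact: dj].
Qed.

Lemma minimal_tight (S : set (set P)) C : finite_set (d C) ->
  ~ generated S C -> small (size C) `<=` generated S -> tight X C.
Proof.
move=> fC nC sS; split; first exact: minimal_connected_in sS.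
apply: (minimal_connected_in (S := S)); rewrite ?coboundaryC //.
exact: generatedCN.
Qed.

End ConnectedGraph.

(** * Group actions and invariant nested families *)

Section Translates.
Variables (G : groupType) (P : choiceType) (act : G -> P -> P).
Hypothesis act1 : forall x, act 1 x = x.
Hypothesis actM : forall g h x, act (g * h) x = act g (act h x).
Implicit Types (g h : G) (C D : set P).

Definition translate g C : set P := [set x | C (act g^-1 x)].

Lemma translate1 C : translate 1 C = C.
Proof. by apply/seteqP; split=> x; rewrite /translate /= invg1 act1. Qed.

Lemma translateM g h C : translate (g * h) C = translate g (translate h C).
Proof. by apply/seteqP; split=> x; rewrite /translate /= invgM actM. Qed.

Lemma translateK g C : translate g^-1 (translate g C) = C.
Proof. by rewrite -translateM mulVg translate1. Qed.

Lemma translateVK g C : translate g (translate g^-1 C) = C.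
Proof. by rewrite -translateM mulgV translate1. Qed.

Lemma translate_act g C x : translate g C (act g x) <-> C x.
Proof. by rewrite /translate /= -actM mulVg act1. Qed.

Lemma translateC g C : translate g (~` C) = ~` translate g C.
Proof. by []. Qed.

Lemma translateS g C D : C `<=` D -> translate g C `<=` translate g D.
Proof. by move=> CD x /CD. Qed.

Lemma nested_translate g C D : nested_sets C D ->
  nested_sets (translate g C) (translate g D).
Proof.
by case=> h; [constructor 1|constructor 2|constructor 3|constructor 4] => x /h.
Qed.

Lemma generated_translate (S : set (set P)) g C :
  (forall g C, S C -> S (translate g C)) ->
  generated S C -> generated S (translate g C).
Proof.
move=> St; elim=> [D SD||D _|D E _ IHD _ IHE].
- by apply: generated_in; apply: St.
- exact: generated0.
- exact: generatedC.
- exact: (generatedI IHD IHE).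
Qed.

Variable X : set (P * P).
Hypothesis X_inv : forall g e, X e -> X (act g e.1, act g e.2).
Local Notation d := (coboundary X).
Local Notation size C := (csize (coboundary X C)).

Definition act2 g (e : P * P) : P * P := (act g e.1, act g e.2).

Lemma act2K g : cancel (act2 g) (act2 g^-1).
Proof. by case=> x y; rewrite /act2 /= -!actM mulVg !act1. Qed.

Lemma coboundary_translate g C : d (translate g C) = act2 g @` d C.
Proof.
apply/seteqP; split=> [e [Xe h]|_ [e [Xe h] <-]].
  exists (act2 g^-1 e); last by have := act2K g^-1 e; rewrite invgK.
  by split; [exact: X_inv|exact: h].
by split; [exact: X_inv|rewrite /= !translate_act].
Qed.

Lemma finite_translate g C : finite_set (d C) -> finite_set (d (translate g C)).
Proof. by move=> fC; rewrite coboundary_translate; apply: finite_image. Qed.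

Lemma size_translate g C : finite_set (d C) -> size (translate g C) = size C.
Proof.
move=> fC; apply/eqP; rewrite eqn_leq {1}coboundary_translate csize_image //=.
rewrite -{1}(translateK g C) coboundary_translate csize_image //.
exact: finite_translate.
Qed.

Hypothesis X_conn : graph_connected X.

(* The optimality condition [nf_opt] guarantees tightness, and lets a corner
   replace a cut crossing a member of the family. *)
Record nested_family (n : nat) (S : set (set P)) : Prop := NestedFamily {
  nf_size : forall C, S C -> finite_set (d C) /\ (size C <= n)%N;
  nf_opt : forall C, S C -> ~ generated (small X (size C)) C;
  nf_nested : forall C D, S C -> S D -> nested_sets C D;
  nf_compl : forall C, S C -> S (~` C);
  nf_translate : forall g C, S C -> S (translate g C) }.

Lemma nf_tight n S C : nested_family n S -> S C -> tight X C.
Proof.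
move=> nS SC; have [fC _] := nf_size nS SC.
apply: (minimal_tight X_conn fC (nf_opt nS SC)) => D hD.
exact: generated_in.
Qed.

(* Among the smallest cuts not generated by S, first minimize the number of
   members of S that are crossed, then the number of cuts of the same kind that
   are crossed. Uncrossing corners shows that both minima are 0 on translates. *)
Lemma new_nested_cut n S : nested_family n S -> small X n `<=` generated S ->
  (exists C, [/\ finite_set (d C), (size C <= n)%N & ~ generated S C]) ->
  exists C, [/\ finite_set (d C), size C = n, ~ generated S C,
    (forall N, S N -> nested_sets N C) & (forall g, nested_sets C (translate g C))].
Proof.
move=> nS sS [C0 [fC0 sC0 nC0]].
have big C : finite_set (d C) -> ~ generated S C -> (n <= size C)%N.
  by move=> fC; apply: contra_notT; rewrite -ltnNge => h; apply: sS; split.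
pose R C := [/\ finite_set (d C), size C = n & ~ generated S C].
have R_tight C : R C -> tight X C.
  by move=> [fC sC nC]; apply: (minimal_tight X_conn fC nC); rewrite sC.
have RC C : R C -> R (~` C).
  by move=> [fC sC nC]; split; rewrite ?coboundaryC //; apply: generatedCN.
have RI C : finite_set (d C) -> (size C <= n)%N -> ~ generated S C -> R C.
  by move=> fC sC nC; split=> //; apply/eqP; rewrite eqn_leq sC big.
have splitI C D : ~ generated S C ->
    ~ (generated S (C `&` D) /\ generated S (C `&` ~` D)).
  by move=> nC [h1 h2]; apply: nC; have := generatedU h1 h2; rewrite -setIUr setUv setIT.
have fI C D : finite_set (d C) -> finite_set (d D) -> finite_set (d (C `&` D)).
  exact: corner_finite.
have fN C : finite_set (d C) -> finite_set (d (~` C)) by rewrite coboundaryC.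
have finS C : R C -> finite_set [set N | S N /\ ~ nested_sets N C].
  move=> [fC _ _]; apply: sub_finite_set (tight_cross_finite X_conn n fC).
  move=> N [SN h]; have [fN' sN] := nf_size nS SN.
  by split=> //; apply: (nf_tight nS SN).
pose c1 C := csize [set N | S N /\ ~ nested_sets N C].
have [C1 RC1 minC1] : exists2 C, R C & forall D, R D -> (c1 C <= c1 D)%N.
  by apply: (@exists_argmin _ R c1 C0); apply: RI.
have C1S N : S N -> nested_sets N C1.
  move=> SN; apply: contrapT => cNC.
  suff [C' RC' [C'N C'M]] : exists2 C', R C' & nested_sets N C' /\
      forall M, nested_sets M N -> nested_sets M C1 -> nested_sets M C'.
    have := minC1 C' RC'; rewrite leqNgt => /negP; apply.
    apply: (@csize_lt _ _ _ N); first exact: finS.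
    - by move=> M [SM h]; split=> // h'; apply: h; apply: C'M => //; apply: (nf_nested nS SM SN).
    - by split.
    - by case.
  have cCN : ~ nested_sets C1 N by move=> /nested_symC.
  have [fN1 sN1] := nf_size nS SN; case: (RC1) => fC1 sC1 nC1.
  (* A corner in [R] is nested with [N] and with every member of [S] nested with [C1], so it crosses
     fewer members than [C1]. *)
  have pick C D : R (C `&` D) -> (C = C1 \/ C = ~` C1) -> (D = N \/ D = ~` N) ->
      exists2 C', R C' & nested_sets N C' /\
      forall M, nested_sets M N -> nested_sets M C1 -> nested_sets M C'.
    move=> RCD CE DE; exists (C `&` D) => //.
    have CN : ~ nested_sets C D.
      case: CE DE => -> [] ->; rewrite // => h; apply: cCN.
      - by rewrite -[N]setCK; apply: nestedCr.
      - by rewrite -[C1]setCK; apply: nestedCl.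
      - by rewrite -[N]setCK -[C1]setCK; apply: nestedCr; apply: nestedCl.
    split.
      by case: DE => ->; [constructor 4 => x nN [_ /nN]|constructor 2 => x Nx [_]; apply].
    move=> M MN MC; apply: nested_corner => //.
      by case: CE => ->; rewrite //; apply: nestedCr.
    by case: DE => ->; rewrite //; apply: nestedCr.
  have key D : S D -> finite_set (d D) -> (size D <= n)%N -> (D = N \/ D = ~` N) ->
      generated S (C1 `&` D) -> generated S (~` C1 `&` D) ->
      exists2 C', R C' & nested_sets N C' /\
      forall M, nested_sets M N -> nested_sets M C1 -> nested_sets M C'.
    move=> SD fD sD DE g1 g2.
    have DE' : ~` D = N \/ ~` D = ~` N by case: DE => ->; rewrite ?setCK; tauto.
    have n1 : ~ generated S (C1 `&` ~` D) by move=> h; apply: (@splitI C1 D).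
    have n2 : ~ generated S (~` C1 `&` ~` D).
      by move=> h; apply: (@splitI (~` C1) D) => //; apply: generatedCN.
    have [h|h] : (size D <= size (C1 `&` D))%N \/ (size D <= size (~` C1 `&` D))%N.
      apply: contrapT => H; apply: (nf_opt nS SD).
      have -> : D = (C1 `&` D) `|` (~` C1 `&` D) by rewrite -setIUl setUv setTI.
      by apply: generatedU; apply: generated_in; split; rewrite -?setIUl ?setUv ?setTI;
        (try by auto); rewrite ltnNge; apply/negP => h; apply: H; [left|right].
    - apply: (pick (~` C1) (~` D)) => //; last by right.
      apply: RI => //; first by auto.
      have := corner_csize fC1 fD; rewrite sC1 => h'.
      by rewrite -(leq_add2r (size D)) (leq_trans _ h') // addnC leq_add2r.
    - apply: (pick C1 (~` D)) => //; last by left.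
      apply: RI => //; first by auto.
      have := corner_csize (fN _ fC1) fD; rewrite coboundaryC sC1 setCK => h'.
      by rewrite -(leq_add2r (size D)) (leq_trans _ h') // addnC leq_add2r.
  have opp C : (C = C1 \/ C = ~` C1) -> ~ generated S (C `&` N) ->
      ~ generated S (~` C `&` ~` N) ->
      exists2 C', R C' & nested_sets N C' /\
      forall M, nested_sets M N -> nested_sets M C1 -> nested_sets M C'.
    move=> CE n1 n2; apply: (pick C N) => //; last by left.
    have fC : finite_set (d C) by case: CE => ->; auto.
    have sC : size C = n by case: CE => ->; rewrite ?coboundaryC.
    apply: RI => //; first by auto.
    have := corner_csize fC fN1; rewrite sC => h'.
    rewrite -(leq_add2r n); apply: leq_trans (leq_trans _ h') _.
      by rewrite leq_add2l; apply: big => //; auto.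
    by rewrite leq_add2l.
  have fNN : finite_set (d (~` N)) by auto.
  have sNN : (size (~` N) <= n)%N by rewrite coboundaryC.
  (* [C1] and its complement each have a non-generated corner. Either two such corners are opposite,
     or all lie on one side of [N] and [key] applies to the other side. *)
  have := opp C1; have := opp (~` C1); have := key _ SN fN1 sN1.
  have := key _ (nf_compl nS SN) fNN sNN; rewrite !setCK.
  have := @splitI C1 N nC1; have := @splitI (~` C1) N (generatedCN nC1).
  have := EM (generated S (C1 `&` N)); have := EM (generated S (C1 `&` ~` N)).
  have := EM (generated S (~` C1 `&` N)); have := EM (generated S (~` C1 `&` ~` N)).
  by tauto.
pose R' C := R C /\ forall N, S N -> nested_sets N C.
have R'C C : R' C -> R' (~` C).
  by move=> [h1 h2]; split; [exact: RC|move=> N /h2/nestedCr].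
have R'T g C : R' C -> R' (translate g C).
  move=> [[fC sC nC] h]; split; first split.
  - exact: finite_translate.
  - by rewrite size_translate.
  - move=> h'; apply: nC; rewrite -(translateK g C).
    by apply: generated_translate => //; apply: (nf_translate nS).
  - move=> N SN; rewrite -(translateVK g N); apply: nested_translate; apply: h.
    exact: (nf_translate nS).
have finR C : R C -> finite_set [set N | R' N /\ ~ nested_sets N C].
  move=> [fC _ _]; apply: sub_finite_set (tight_cross_finite X_conn n fC).
  by move=> N [[RN _] h]; split=> //; [exact: R_tight|case: RN|case: RN => _ -> _].
pose c2 C := csize [set N | R' N /\ ~ nested_sets N C].
have [C R'C0 minC] : exists2 C, R' C & forall D, R' D -> (c2 C <= c2 D)%N.
  exact: (@exists_argmin _ R' c2 C1).
have [[fC sC nC] CS] := R'C0.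
exists C; split=> // g; apply: contrapT => cross.
have R'D := R'T g _ R'C0.
have c2D : (c2 (translate g C) <= c2 C)%N.
  apply: leq_trans (csize_image (translate g) (finR C R'C0.1)).
  apply: csize_sub; first by apply: finite_image; apply: finR; case: R'C0.
  move=> M [R'M h]; exists (translate g^-1 M); last exact: translateVK.
  split; first exact: R'T.
  by move=> /(nested_translate g); rewrite translateVK.
have c2C D : c2 (~` D) = c2 D.
  congr csize; apply/seteqP; split=> M [R'M h]; split=> // h'; apply: h.
    exact: nestedCr.
  by rewrite -[D]setCK; apply: nestedCr.
have nI C' D : R' C' -> R' D -> ~ nested_sets C' D -> R (C' `&` D) -> R' (C' `&` D).
  by move=> [_ h1] [_ h2] cr RCD; split=> // N SN; apply: nested_corner; auto.
have final D : R' D -> (c2 D <= c2 C)%N -> ~ nested_sets C D ->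
    ~ generated S (C `&` D) -> ~ generated S (~` C `&` ~` D) -> False.
  move=> [[fD sD nD] DS] cD cr n1 n2.
  have h := corner_csize fC fD; rewrite sC sD in h.
  have b1 := big _ (fI _ _ fC fD) n1.
  have b2 := big _ (fI _ _ (fN _ fC) (fN _ fD)) n2.
  have R1 : R (C `&` D).
    apply: RI => //; first by auto.
    by rewrite -(leq_add2r n); apply: leq_trans h; rewrite leq_add2l.
  have R2 : R (~` C `&` ~` D).
    apply: RI => //; first by auto.
    by rewrite -(leq_add2l n); apply: leq_trans h; rewrite leq_add2r.
  have R'1 := nI _ _ R'C0 (conj (And3 fD sD nD) DS) cr R1.
  have R'2 := nI _ _ (R'C _ R'C0) (R'C _ (conj (And3 fD sD nD) DS))
    (crossCl (crossCr cr)) R2.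
  (* A set crossing a corner crosses [C] or [D], and one crossing both corners crosses both. The
     inequality is strict because [C] crosses [D] but neither corner. *)
  have lt : (c2 (C `&` D) + c2 (~` C `&` ~` D) < c2 C + c2 D)%N.
    apply: (@csize2_lt _ _ _ _ _ _ _ _ _ C).
    - by apply: finR; case: R'C0.
    - by apply: finR.
    - move=> M MM; have R'M : R' M by case: MM => -[].
      have [nMC|] := pselect (nested_sets M C); last by left.
      have [nMD|] := pselect (nested_sets M D); last by right.
      exfalso; case: MM => -[_]; apply; first exact: nested_corner.
      apply: nested_corner; [exact: crossCl (crossCr cr)|exact: nestedCr|exact: nestedCr].
    - move=> M [[R'M h1] [_ h2]]; split; split=> // nM.
        by case: (nested_opposite_corner D nM).
      by case: (nested_opposite_corner C nM); rewrite setIC // [~` D `&` _]setIC.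
    - by right; split.
    - case=> -[_]; apply; first by constructor 4 => x nCx [].
      by constructor 2 => x Cx [].
  have := minC _ R'1; have := minC _ R'2 => m2 m1.
  by have := leq_ltn_trans (leq_add m1 m2) lt; rewrite ltn_add2l ltnNge cD.
(* Neither [C] nor its translate is generated, so both sides of each have a non-generated corner;
   this forces two opposite ones. *)
have := final _ R'D c2D cross.
have := final _ (R'C _ R'D); rewrite c2C setCK => /(_ c2D (crossCr cross)).
case: (R'D) => -[_ _ nD] _.
have := @splitI C (translate g C) nC.
have := @splitI (~` C) (translate g C) (generatedCN nC).
have := @splitI _ C nD; have := @splitI _ C (generatedCN nD).
rewrite ![_ `&` C]setIC ![_ `&` ~` C]setIC.
have := EM (generated S (C `&` translate g C)).
have := EM (generated S (C `&` ~` translate g C)).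
have := EM (generated S (~` C `&` translate g C)).
have := EM (generated S (~` C `&` ~` translate g C)).
by tauto.
Qed.

End Translates.

(** * A nested cut with trivial stabilizer *)

Section FreeCuts.
Variables (G A : groupType) (P : choiceType) (act : G -> P -> P).
Hypothesis act1 : forall x, act 1 x = x.
Hypothesis actM : forall g h x, act (g * h) x = act g (act h x).
Variable X : set (P * P).
Hypothesis X_inv : forall g e, X e -> X (act g e.1, act g e.2).
Hypothesis X_conn : graph_connected X.
Variable inn : {multiplicative A -> G}.
Hypothesis inn_normal : forall g a, exists b, inn b = g * inn a * g^-1.
Hypothesis X_free : forall a e, X e -> act2 act (inn a) e = e -> a = 1.
Hypothesis torsion_fixed : forall a n, (0 < n)%N -> a ^+ n = 1 ->
  exists p, act (inn a) p = p.
Local Notation d := (coboundary X).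
Local Notation size C := (csize (coboundary X C)).
Local Notation tr := (translate act).
Local Notation "a .* x" := (act (inn a) x) (at level 40, left associativity).
Local Notation "a .: C" := (translate act (inn a) C) (at level 40, left associativity).
Implicit Types (a b f : A) (x y p q : P) (C D N M L W : set P).

(** What is retained of the half-spaces of the free product; only translates by [A] are involved. *)
Record free_cut W : Prop := FreeCut {
  fc_finite : finite_set (d W);
  fc_nested : forall a, nested_sets W (a .: W);
  fc_free : forall a, a .: W = W -> a = 1 }.

Variable s : nat.
Hypothesis free_cuts : forall p q, p <> q ->
  exists W, [/\ free_cut W, (size W <= s)%N, ~ W p & W q].

Lemma aact1 x : 1 .* x = x. Proof. by rewrite multiplicative1. Qed.
Lemma aactM a b x : (a * b) .* x = a .* (b .* x). Proof. by rewrite gmulfM. Qed.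
Lemma aactK a x : a^-1 .* (a .* x) = x. Proof. by rewrite -aactM mulVg aact1. Qed.
Lemma atr1 C : 1 .: C = C. Proof. by rewrite multiplicative1 translate1. Qed.
Lemma atrM a b C : (a * b) .: C = a .: (b .: C).
Proof. by rewrite gmulfM translateM. Qed.
Lemma atrK a C : a^-1 .: (a .: C) = C. Proof. by rewrite -atrM mulVg atr1. Qed.
Lemma atrVK a C : a .: (a^-1 .: C) = C. Proof. by rewrite -atrM mulgV atr1. Qed.
Lemma atrE a C x : (a .: C) x <-> C (a^-1 .* x).
Proof. by rewrite multiplicativeV. Qed.
Lemma atr_act a C x : (a .: C) (a .* x) <-> C x.
Proof. by rewrite translate_act. Qed.

(** If the translate by [a] separates the ends of an edge [e], then [a^-1] carries [e] into the
    finite set [d C]; by freeness this allows finitely many [a]. The general case follows along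
    edges. *)
Lemma separating_finite C x y : finite_set (d C) ->
  finite_set [set a | separates (a .: C) x y].
Proof.
move=> fC; pose F y := [set a | separates (a .: C) x y].
have fe e : X e -> finite_set [set a | separates (a .: C) e.1 e.2].
  move=> Xe; apply: (@sub_finite_set _ _ ((fun a => act2 act (inn a^-1) e) @^-1` d C)).
    move=> a /= h; split; first exact: X_inv.
    by move: h; rewrite /separates /= !atrE.
  apply: finite_preimage => // a b _ _ /= E; apply/divg1_eq; apply: (X_free Xe).
  have M u v : act2 act (inn (u * v)) e = act2 act (inn u) (act2 act (inn v) e).
    by rewrite /act2 /= !aactM.
  by rewrite M -E -M mulgV /act2 !aact1; case: (e).
apply: (@X_conn (fun y => finite_set (F y)) _ x) => [e Xe|].
  have sub u v : (e = (u, v) \/ e = (v, u)) -> finite_set (F u) -> finite_set (F v).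
    move=> E fu; apply: (@sub_finite_set _ _ (F u `|` [set a | separates (a .: C) e.1 e.2])).
      move=> a; rewrite /F /separates /setU /=; have := EM ((a .: C) u <-> (a .: C) v).
      by case: E => -> /=; tauto.
    by rewrite finite_setU; split=> //; apply: fe.
  by case: e Xe sub {fe} => u v Xe sub /=; split; apply: sub; tauto.
suff -> : F x = set0 by exact: finite_set0.
by apply/seteqP; split=> // a; rewrite /F /separates /=; tauto.
Qed.

Lemma finite_escape (S : set A) (u : nat -> A) J : finite_set S -> injective u ->
  exists2 j, (J <= j)%N & ~ S (u j).
Proof.
move=> fS ui; apply: contrapT => H; apply: infinite_nat.
have -> : [set: nat] = `I_J `|` (u @^-1` S).
  apply/seteqP; split=> // j _; have [h|h] := ltnP j J; first by left.
  by right; apply: contrapT => nS; apply: H; exists j.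
rewrite finite_setU; split; first exact: finite_II.
by apply: finite_preimage fS => j k _ _ /ui.
Qed.

Lemma finite_powers (S : set A) a : finite_set S -> (forall j, S (a ^+ j)) ->
  exists2 n, (0 < n)%N & a ^+ n = 1.
Proof.
move=> fS aS; apply: contrapT => H.
have ui : injective (fun j => a ^+ j).
  have key i k : (i <= k)%N -> a ^+ i = a ^+ k -> i = k.
    move=> ik E; apply/eqP; rewrite eqn_leq ik /= -subn_eq0 -leqn0 leqNgt.
    apply/negP => h; apply: H; exists (k - i)%N => //.
    by apply: (@mulgI _ (a ^+ i)); rewrite -expgnDr subnKC // mulg1.
  move=> i k E; have [/key|/ltnW /key] := leqP i k; first exact.
  by move=> h; symmetry; apply: h.
by have [j _] := finite_escape 0 fS ui; apply.
Qed.

(** All translates of [W] by powers of [f] contain [q] and miss [p], so [f] has finite order and the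
    inclusions close up into equalities. *)
Lemma increasing_fixed f W p q : finite_set (d W) -> f .* p = p -> ~ W p -> W q ->
  W `<=` f .: W -> f .: W = W.
Proof.
move=> fW fp Wp Wq inc.
have incn n : W `<=` (f ^+ n) .: W.
  elim: n => [|n IH]; first by rewrite expg0 atr1.
  by rewrite expgS atrM => x /inc; apply: translateS.
have fixn n : f ^+ n .* p = p.
  by elim: n => [|n IH]; rewrite ?expg0 ?aact1 // expgS aactM IH.
have [|n n0 fn] := @finite_powers _ f (separating_finite p q fW).
  move=> j; rewrite /separates /=; have : (f ^+ j .: W) q by apply: incn.
  have : ~ (f ^+ j .: W) p by rewrite -(fixn j) atr_act.
  by tauto.
apply/seteqP; split=> //; have := translateS (act := act) (g := inn f) (incn n.-1).
by rewrite -atrM -expgS prednK // fn atr1.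
Qed.

(** An inclusion between [W] and its translate would be an equality, giving [f = 1]; and the two
    cannot cover everything, as both miss [p]. *)
Lemma fixed_disjoint f W p q : free_cut W -> f <> 1 -> f .* p = p -> ~ W p -> W q ->
  f .: W `<=` ~` W.
Proof.
move=> fcW f1 fp Wp Wq; have fVp : f^-1 .* p = p by rewrite -{1}fp aactK.
case: (fc_nested fcW f) => h.
- case: f1; apply: (fc_free fcW).
  exact: increasing_fixed (fc_finite fcW) fp Wp Wq h.
- by move=> x fWx Wx; apply: (h x).
- by have := h p Wp; rewrite -{1}fp atr_act.
- case: f1; apply: invg_inj; rewrite invg1; apply: (fc_free fcW).
  apply: increasing_fixed (fc_finite fcW) fVp Wp Wq _ => x Wx.
  by rewrite atrE invgK; apply: contrapT => nW; apply: (h _ nW); rewrite atr_act.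
Qed.

Lemma fixed_point_unique f p q : f <> 1 -> f .* p = p -> f .* q = q -> p = q.
Proof.
move=> f1 fp fq; apply: contrapT => /free_cuts [W [fcW _ Wp Wq]].
have h := fixed_disjoint fcW f1 fp Wp Wq.
by apply: (h q) => //; rewrite -fq atr_act.
Qed.

Variables p1 p2 : P.
Hypothesis p12 : p1 <> p2.
Hypothesis point_stab : forall p, exists a, a <> 1 /\ a .* p = p.

Lemma no_global_fixed_point p : exists a, a .* p <> p.
Proof.
have [q pq] : exists q, q <> p.
  by have [E|ne] := pselect (p1 = p); [exists p2 => E'; apply: p12; rewrite E E'|exists p1].
have [a [a1 aq]] := point_stab q; exists a => ap.
by apply: pq; apply: fixed_point_unique a1 aq ap.
Qed.

(** Here [g] carries the complement of [W] into [W], and [f] carries [W] into its complement, so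
    [f * g] maps the complement into itself. It does so properly: otherwise [f * g = 1] and [f]
    would fix [q]. The point [x] is taken in the complement, outside its image. *)
Lemma ping_pong f (g : A) p q : f <> 1 -> g <> 1 -> f .* p = p -> g .* q = q -> p <> q ->
  exists W x, [/\ free_cut W, (size W <= s)%N,
    forall j, ~ W ((f * g) ^+ j .* x) & forall j, W ((f * g) ^- j.+1 .* x)].
Proof.
move=> f1 g1 fp gq pq; have [W [fcW sW Wp Wq]] := free_cuts pq.
have fcW' : free_cut (~` W).
  split; first by rewrite coboundaryC; apply: fc_finite.
    by move=> a; rewrite translateC; apply: nestedCr; apply: nestedCl; apply: fc_nested.
  by move=> a; rewrite translateC => /(congr1 setC); rewrite !setCK; apply: fc_free.
have fW := fixed_disjoint fcW f1 fp Wp Wq.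
have gW : g .: ~` W `<=` W.
  by have := fixed_disjoint fcW' g1 gq _ Wp; rewrite setCK; apply; apply.
pose a := f * g.
have aW : a .: ~` W `<=` ~` W.
  by rewrite atrM; apply: subset_trans fW; apply: translateS.
have [x xW ax] : exists2 x, ~ W x & ~ (a .: ~` W) x.
  apply: not_subset => h; have E : a .: W = W.
    by apply/seteqP; split=> x; have := h x; have := aW x; rewrite translateC /setC /=;
      have := EM (W x); have := EM ((a .: W) x); tauto.
  have fgV : f = g^-1 by apply/divg1_eq; rewrite invgK; exact: (fc_free fcW E).
  have gVq : f .* q = q by rewrite fgV -{1}gq aactK.
  by apply: (fW q) => //; rewrite -gVq atr_act.
exists W, x; split=> // j.
  elim: j => [|j IH]; first by rewrite expg0 aact1.
  by rewrite expgS aactM; apply: aW; rewrite atr_act.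
elim: j => [|j IH].
  by rewrite expg1; apply: contrapT => h; apply: ax; rewrite atrE.
rewrite expgSr invgM aactM; apply: contrapT => h; apply: (aW _ _ IH).
by rewrite atrE.
Qed.

Definition stab_fixes N p := exists f, [/\ f <> 1, f .: N = N & f .* p = p].

Lemma proper_generated (S : set (set P)) C : ~ generated S C ->
  (exists x, C x) /\ (exists x, ~ C x).
Proof.
move=> nC; split; apply: contrapT => H; apply: nC.
  suff -> : C = set0 by exact: generated0.
  by apply/seteqP; split=> // x Cx; apply: H; exists x.
suff -> : C = ~` set0 by apply/generatedC/generated0.
by apply/seteqP; split=> x _; [case|apply: contrapT => Cx; apply: H; exists x].
Qed.

(** Translating by an element of the stabilizer gives [N] again, which separates [x] from [y]. *)
Lemma stabilizer_finite N x y : finite_set (d N) -> N x -> ~ N y ->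
  finite_set [set a | a .: N = N].
Proof.
move=> fN Nx Ny; apply: sub_finite_set (separating_finite x y fN) => a /= E.
by rewrite /separates /= E; tauto.
Qed.

Lemma stabilizer_torsion N x y a : finite_set (d N) -> N x -> ~ N y -> a .: N = N ->
  exists2 n, (0 < n)%N & a ^+ n = 1.
Proof.
move=> fN Nx Ny aN; apply: finite_powers (stabilizer_finite fN Nx Ny) _ => j /=.
by elim: j => [|j IH]; rewrite ?expg0 ?atr1 // expgS atrM IH.
Qed.

Lemma ping_pong_infinite W a x : (forall j, ~ W (a ^+ j .* x)) ->
  (forall j, W (a ^- j.+1 .* x)) -> forall n, (0 < n)%N -> a ^+ n <> 1.
Proof.
move=> h1 h2 [|n] // _ E; apply: (h1 0%N); rewrite expg0 aact1.
by have := h2 n; rewrite E invg1 aact1.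
Qed.

Lemma infinite_group : ~ finite_set [set: A].
Proof.
move=> fA; have [f [f1 fp]] := point_stab p1; have [g [g1 gq]] := point_stab p2.
have [W [x [_ _ h1 h2]]] := ping_pong f1 g1 fp gq p12.
have [n n0] := @finite_powers _ (f * g) fA (fun=> I).
exact: ping_pong_infinite h1 h2 n n0.
Qed.

(** * A family of bad cuts cannot generate the half-spaces *)

Section Contradiction.
Variable S : set (set P).
Variable n : nat.
Hypothesis S_nested : nested_family act X n S.
Hypothesis S_stab : forall N, S N -> exists2 a, a <> 1 & a .: N = N.
Hypothesis S_generates : small X s.+1 `<=` generated S.

Lemma S_proper N : S N -> (exists x, N x) /\ (exists x, ~ N x).
Proof. by move=> /(nf_opt S_nested) /proper_generated. Qed.

Lemma S_finite N : S N -> finite_set (d N).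
Proof. by move=> /(nf_size S_nested) []. Qed.

Lemma stab_fixes_exists N : S N -> exists p, stab_fixes N p.
Proof.
move=> SN; have [[x Nx] [y Ny]] := S_proper SN; have [a a1 aN] := S_stab SN.
have [m m0 am] := stabilizer_torsion (S_finite SN) Nx Ny aN.
by have [p ap] := torsion_fixed m0 am; exists p, a.
Qed.

(** Two points would give, by ping-pong, an element of infinite order in the finite stabilizer of
    [N]. *)
Lemma stab_fixes_unique N p q : S N -> stab_fixes N p -> stab_fixes N q -> p = q.
Proof.
move=> SN [f [f1 fN fp]] [g [g1 gN gq]]; apply: contrapT => pq.
have [W [x [_ _ h1 h2]]] := ping_pong f1 g1 fp gq pq.
have [[y Ny] [z Nz]] := S_proper SN.
have fgN : (f * g) .: N = N by rewrite atrM gN.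
have [m m0] := stabilizer_torsion (S_finite SN) Ny Nz fgN.
exact: ping_pong_infinite h1 h2 _ m0.
Qed.

Lemma stab_fixesC N p : stab_fixes N p -> stab_fixes (~` N) p.
Proof. by move=> [f [f1 fN fp]]; exists f; split=> //; rewrite translateC fN. Qed.

Lemma stab_fixes_act a N p : stab_fixes N p -> stab_fixes (a .: N) (a .* p).
Proof.
move=> [f [f1 fN fp]]; exists (a * f * a^-1); split.
- move=> E; apply: f1; apply: (@mulgI _ a); apply: (@mulIg _ a^-1).
  by rewrite E mulg1 mulgV.
- by rewrite !atrM atrK fN.
- by rewrite !aactM aactK fp.
Qed.

(** A translate of [N] by an element moving [p] has another point. [S] is non-empty because it
    generates a proper cut. *)
Lemma two_fixed_points : exists N M p q,
  [/\ S N, S M, stab_fixes N p & stab_fixes M q] /\ p <> q.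
Proof.
apply: contrapT => H.
have [W [fcW sW W1 W2]] := free_cuts p12.
have [N SN] : exists N, S N.
  apply: contrapT => nS.
  have : generated S W by apply: S_generates; split; [exact: fc_finite|].
  have key D : generated S D -> D = set0 \/ D = ~` set0.
    elim=> [E SE||E _ [] ->|E F _ [] -> _ [] ->]; rewrite ?setCK ?setI0 ?set0I; try by auto.
      by case: nS; exists E.
    by right; apply/seteqP; split=> // z.
  by move=> /key [] E; [have := W2; rewrite E|apply: W1; rewrite E; case].
have [p Np] := stab_fixes_exists SN.
have [a ap] := no_global_fixed_point p; apply: H.
exists (a .: N), N, (a .* p), p; split=> //; split=> //.
  exact: (nf_translate S_nested).
exact: stab_fixes_act.
Qed.

Lemma between_finite N M : S N -> S M -> finite_set
  [set L | [/\ S L, N `<=` L, L `<=` M, L <> N & L <> M]].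
Proof.
move=> SN SM; have [[x Nx] _] := S_proper SN; have [_ [y My]] := S_proper SM.
apply: sub_finite_set (tight_sep_finite X_conn n x y) => L [SL NL LM _ _].
have [fL sL] := nf_size S_nested SL; split=> //; first exact: (nf_tight X_conn S_nested).
by move=> [/(_ (NL _ Nx)) /LM].
Qed.

Definition adjacent_in N M := [/\ S N, S M, N `<=` M, N <> M &
  forall L, S L -> N `<=` L -> L `<=` M -> L = N \/ L = M].

(* In the tree dual to S, the edges N and M then share a vertex. *)
Lemma adjacent_fixed_points : exists N M p q,
  [/\ adjacent_in N M, stab_fixes N p, stab_fixes M q & p <> q].
Proof.
have SC := nf_compl S_nested.
pose R (Q : set P * set P) := [/\ S Q.1, S Q.2, Q.1 `<=` Q.2 &
  exists p q, [/\ stab_fixes Q.1 p, stab_fixes Q.2 q & p <> q]].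
have [Q0 RQ0] : exists Q, R Q.
  have [N [M [p [q [[SN SM Np Mq] pq]]]]] := two_fixed_points.
  have := stab_fixesC Np; have := stab_fixesC Mq => Mq' Np'.
  by case: (nf_nested S_nested SN SM) => h; [exists (N, M)|exists (N, ~` M)|
    exists (~` N, M)|exists (~` N, ~` M)]; split; rewrite /=; auto; exists p, q.
pose c (Q : set P * set P) :=
  csize [set L | [/\ S L, Q.1 `<=` L, L `<=` Q.2, L <> Q.1 & L <> Q.2]].
have [[N M] [/= SN SM NM [p [q [Np Mq pq]]]] Qmin] := exists_argmin c RQ0.
exists N, M, p, q; split=> //; split=> //.
  by move=> E; apply: pq; apply: stab_fixes_unique SN Np _; rewrite E.
move=> L SL NL LM; apply: contrapT => H.
have LN : L <> N by tauto.
have LM' : L <> M by tauto.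
have [r Lr] := stab_fixes_exists SL.
have smaller N' M' : R (N', M') -> N `<=` N' -> M' `<=` M -> (L = N' \/ L = M') -> False.
  move=> RNM NN' MM' LE; have := Qmin _ RNM; rewrite leqNgt => /negP; apply.
  apply: (csize_lt (x := L)); first exact: between_finite.
  - move=> K [/= SK h1 h2 h3 h4]; split=> //.
    + exact: subset_trans h1.
    + exact: subset_trans MM'.
    + by move=> E; apply: h3; apply/seteqP; split=> //; rewrite E.
    + by move=> E; apply: h4; apply/seteqP; split=> //; rewrite E.
  - by [].
  - by move=> /= [_ _ _ h1 h2]; case: LE.
(* The point of [L] differs from that of [N] or from that of [M], so [L] can replace the other of
   the two cuts. *)
have [rp|rp] := pselect (r = p); last first.
  by apply: (smaller N L) => //; [split=> //; exists p, r; split=> // E; apply: rp|right].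
by apply: (smaller L M) => //; [split=> //; exists p, q; rewrite -rp in Np pq *|left].
Qed.

(* In the dual tree, the end of the edge N outside N does not lie in L. *)
Definition outside N L := L `<=` N \/ (L `<=` ~` N /\ L <> ~` N).

Lemma adjacentC N M : adjacent_in N M -> adjacent_in (~` M) (~` N).
Proof.
move=> [SN SM NM neq adj]; have SC := nf_compl S_nested.
split; [exact: SC|exact: SC|by move=> x Mx /NM| |].
  by move=> /(congr1 setC); rewrite !setCK => E; apply: neq.
move=> L SL h1 h2; have [] := adj (~` L) (SC _ SL).
- by move=> x Nx Lx; apply: (h2 x).
- by move=> x; apply: contra_notP => Mx; apply: h1.
- by move=> <-; rewrite setCK; right.
- by move=> <-; rewrite setCK; left.
Qed.

(** The edges [N] and [M] share a vertex: the end of [N] outside [N] and of [M] inside [M]. A member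
    of [S] telling these ends apart would, up to complement, lie strictly between [N] and [M]. *)
Lemma outside_adjacent_sub N M L : adjacent_in N M -> S L ->
  outside N L -> outside (~` M) L.
Proof.
move=> [SN SM NM neq adj] SL oN; apply: contrapT => oM.
have [[x Nx] _] := S_proper SN; have [_ [y My]] := S_proper SM.
have ML : L <> ~` M by move=> E; apply: oM; left; rewrite E.
case: (nf_nested S_nested SL SM) => h.
- have LM : L = M by apply: contrapT => ne; apply: oM; right; rewrite setCK.
  case: oN => [|[+ _]]; rewrite LM.
    by move=> MN; apply: neq; apply/seteqP; split.
  by move=> /(_ x (NM _ Nx)).
- by apply: oM; left.
- have h' z : ~ M z -> L z by move=> Mz; apply: contrapT => /h.
  case: oN => [LN|[LN LN']].
    by apply: (My); apply: NM; apply: LN; apply: h'.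
  have [] := adj (~` L) (nf_compl S_nested SL).
  + by move=> z Nz Lz; apply: (LN z).
  + exact: h.
  + by move=> E; apply: LN'; rewrite -E setCK.
  + by move=> E; apply: ML; rewrite -E setCK.
- have h' z : M z -> L z by move=> Mz; apply: contrapT => /h.
  case: oN => [LN|[LN _]].
    by apply: neq; apply/seteqP; split=> // z /h' /LN.
  by apply: (LN x) => //; apply/h'/NM.
Qed.

Lemma outside_adjacent N M L : adjacent_in N M -> S L ->
  outside N L <-> outside (~` M) L.
Proof.
move=> adj SL; split; first exact: outside_adjacent_sub.
by rewrite -{1}[N]setCK; apply: outside_adjacent_sub => //; apply: adjacentC.
Qed.

Lemma outside_translate a N L : outside (a .: N) (a .: L) <-> outside N L.
Proof.
have sub b C D : C `<=` D -> b .: C `<=` b .: D by exact: translateS.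
split=> [[h|[h1 h2]]|[h|[h1 h2]]].
- by left; have := sub a^-1 _ _ h; rewrite !atrK.
- right; split; first by have := sub a^-1 _ _ h1; rewrite -translateC !atrK.
  by move=> E; apply: h2; rewrite E.
- by left; apply: sub.
- right; split; first by rewrite -translateC; apply: sub.
  by rewrite -translateC => /(congr1 (fun C => a^-1 .: C)); rewrite !atrK.
Qed.

Lemma outside_or N L : S N -> S L -> outside N L \/ outside N (~` L).
Proof.
move=> SN SL; case: (nf_nested S_nested SL SN) => h.
- by left; left.
- have [->|ne] := pselect (L = ~` N); first by right; left; rewrite setCK.
  by left; right.
- by right; left.
- have [->|ne] := pselect (L = N); first by left; left.
  by right; right; split=> // /(congr1 setC); rewrite !setCK.
Qed.

(* a = f * g fixes the vertex of the dual tree shared by N and M. Hence each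
   member of S, and so each generated cut, contains either finitely many or
   almost all of the points a^j x, j in Z, whereas the cut W given by ping-pong
   separates the positive powers from the negative ones. *)
Lemma no_such_family : False.
Proof.
have ST := nf_translate S_nested.
have [N [M [p [q [adj Np Mq pq]]]]] := adjacent_fixed_points.
have [SN SM _ _ _] := adj.
have [f [f1 fN fp]] := Np; have [g [g1 gM gq]] := Mq.
have [W [x0 [fcW sW W1 W2]]] := ping_pong f1 g1 fp gq pq.
set a := f * g in W1 W2; have a_inf := ping_pong_infinite W1 W2.
have [[x Nx] [y Ny]] := S_proper SN.
(* In the dual tree, [Z b] says that [b] fixes the end of [N] outside [N]. *)
pose Z b := forall L, S L -> outside N L <-> outside (b .: N) L.
have Zmul b c : Z b -> Z c -> Z (b * c).
  move=> Zb Zc L SL; rewrite (Zb L SL) -{1}(atrVK b L) outside_translate.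
  by rewrite (Zc _ (ST _ _ SL)) -(outside_translate b) atrVK atrM.
have ZV b : Z b -> Z b^-1.
  move=> Zb L SL; rewrite -(outside_translate b (b^-1 .: N)) atrVK.
  by rewrite (Zb _ (ST _ _ SL)) outside_translate.
(* [f] fixes this vertex as it stabilizes [N], and [g] fixes it as an end of [M]. *)
have Za : Z a.
  move=> L SL; rewrite /a atrM -{2}(atrVK f L) outside_translate.
  set L' := f^-1 .: L; have SL' : S L' by apply: ST.
  rewrite -{1}(atrVK g L') outside_translate (outside_adjacent adj (ST _ _ SL')).
  rewrite -(outside_translate g (~` M)) atrVK translateC gM -(outside_adjacent adj SL').
  by rewrite -(outside_translate f N L') fN atrVK.
have Zpos j : Z (a ^+ j).
  by elim: j => [|j IH]; [move=> L _; rewrite expg0 atr1|rewrite expgS; apply: Zmul].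
pose u (o : bool) j := if o then a ^+ j else a ^- j.
have Zu o j : Z (u o j) by case: o => /=; [|apply: ZV]; apply: Zpos.
have free_power m : (0 < m)%N -> a ^+ m .: N <> N.
  move=> m0 /(stabilizer_torsion (S_finite SN) Nx Ny) [k k0].
  by rewrite -expgnA; apply: a_inf; rewrite muln_gt0 m0.
have inj_u o o' i j : (i < j)%N -> u o i .: N <> u o' j .: N.
  move=> ij E; rewrite /u in E.
  have j0 : (0 < j)%N by apply: leq_ltn_trans ij.
  have expB : a ^- i * a ^+ j = a ^+ (j - i).
    by rewrite -{1}(subnKC (ltnW ij)) expgnDr mulKg.
  have expB' : a ^+ j * a ^- i = a ^+ (j - i).
    by rewrite -{1}(subnK (ltnW ij)) expgnDr mulgK.
  case: o o' E => -[] E.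
  - apply: (@free_power (j - i)%N); first by rewrite subn_gt0.
    by rewrite -expB atrM -E atrK.
  - apply: (@free_power (j + i)%N); first by rewrite addn_gt0 j0.
    by rewrite expgnDr atrM E atrVK.
  - apply: (@free_power (i + j)%N); first by rewrite addn_gt0 j0 orbT.
    by rewrite expgnDr atrM -E atrVK.
  - apply: (@free_power (j - i)%N); first by rewrite subn_gt0.
    by rewrite -expB' atrM E atrVK.
(* The translates of [N] by the powers of [a] point away from one vertex. A cut [L] pointing away
   from it lies in each such translate whose marked point it contains; two of these would coincide,
   against [inj_u]. *)
have onceL L o o' i j : S L -> outside N L -> L (u o i .* x) -> L (u o' j .* x) ->
    (i < j)%N -> False.
  move=> SL oN Li Lj /(@inj_u o o'); apply.
  have NN : outside N N by left.
  have uu t k t' k' : outside (u t k .: N) (u t' k' .: N).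
    have SuN := ST (inn (u t' k')) _ SN.
    by rewrite -(Zu t k _ SuN) (Zu t' k' _ SuN) outside_translate.
  have sub t k : L (u t k .* x) -> L `<=` u t k .: N.
    move=> Lt; have := oN; rewrite (Zu t k _ SL) => -[//|[h _]].
    by case: (h _ Lt); rewrite atr_act.
  have sub2 t k t' k' : L (u t k .* x) -> L (u t' k' .* x) ->
      u t k .: N `<=` u t' k' .: N.
    move=> h h'; case: (uu t' k' t k) => [//|[hd _]].
    by case: (hd (u t k .* x)); [rewrite atr_act|apply: sub h].
  by apply/seteqP; split; apply: sub2.
have once L : S L -> outside N L -> exists J, forall j o, (J <= j)%N -> ~ L (u o j .* x).
  move=> SL oN; have [[i [o Li]]|H] := pselect (exists i o, L (u o i .* x)).
    by exists i.+1 => j o' ij Lj; apply: onceL SL oN Li Lj ij.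
  by exists 0%N => j o _ Lj; apply: H; exists j, o.
have phi D : generated S D -> exists J,
    (forall j o, (J <= j)%N -> D (u o j .* x)) \/
    (forall j o, (J <= j)%N -> ~ D (u o j .* x)).
  elim=> [L SL||C _ [J H]|C E _ [J H] _ [J' H']].
  - have [oN|oN] := outside_or SN SL.
      by have [J H] := once _ SL oN; exists J; right.
    have [J H] := once _ (nf_compl S_nested SL) oN.
    by exists J; left=> j o /(H j o) /contrapT.
  - by exists 0%N; right=> ? ? _.
  - by exists J; case: H => H; [right=> j o /(H j o) h; apply|left].
  - exists (maxn J J'); case: H H' => H [] H'; [left|right|right|right] => j o;
      rewrite geq_max => /andP[/(H j o) h /(H' j o) h'] //; by [split|case].
have uinj o : injective (u o).
  move=> i j E; have [ij|ji|//] := ltngtP i j; exfalso.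
    by apply: (inj_u o o _ _ ij (congr1 (fun b => b .: N) E)).
  by apply: (inj_u o o _ _ ji (congr1 (fun b => b .: N) (esym E))).
have fsep := separating_finite x x0 (fc_finite fcW).
(* Ping-pong follows [x0], while [phi] follows a point [x] of [N]. Only finitely many powers carry
   the two to opposite sides of [W]. *)
have far o J : exists2 j, (J < j)%N & W (u o j .* x) <-> W (u o j .* x0).
  have vinj : injective (fun j => (u o j)^-1) by move=> i j /invg_inj /uinj.
  have [j Jj h] := finite_escape J.+1 fsep vinj; exists j => //.
  by have := contrapT h; rewrite !atrE !invgK.
have [J HJ] : exists J, (forall j o, (J <= j)%N -> W (u o j .* x)) \/
    (forall j o, (J <= j)%N -> ~ W (u o j .* x)).
  by apply: phi; apply: S_generates; split; [exact: fc_finite|].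
have [j Jj Ej] := far true J; have [[//|k] Jk Ek] := far false J.
case: HJ => H.
  by apply: (W1 j); apply/Ej; apply: H; apply: ltnW.
by apply: (H k.+1 false (ltnW Jk)); apply/Ek; apply: W2.
Qed.

End Contradiction.

Lemma nested_familyS n S : nested_family act X n S -> nested_family act X n.+1 S.
Proof. by case=> h1 h2 h3 h4 h5; split=> // C /h1 [fC sC]; split=> //; apply: leqW. Qed.

(** Zorn's lemma gives a maximal family of bad cuts of size at most [n.+1] containing [S]. If it
    missed a cut of size [n.+1], [new_nested_cut] would give one nested with the family and with its
    own translates; it would be bad since no good cut exists, and its orbit could be added. *)
Lemma bigger_family n S :
  ~ (exists C, [/\ finite_set (d C), (exists x, C x), (exists x, ~ C x),
      (forall g, nested_sets C (tr g C)) & (forall a, a .: C = C -> a = 1)]) ->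
  nested_family act X n S -> (forall N, S N -> exists2 a, a <> 1 & a .: N = N) ->
  small X n.+1 `<=` generated S ->
  exists S', [/\ nested_family act X n.+1 S',
    (forall N, S' N -> exists2 a, a <> 1 & a .: N = N) &
    small X n.+2 `<=` generated S'].
Proof.
move=> noC nS stS genS.
pose good Y := nested_family act X n.+1 (S `|` Y) /\
  (forall N, (S `|` Y) N -> exists2 a, a <> 1 & a .: N = N).
have goodU F : F `<=` good -> total_on F subset -> good (\bigcup_(Y in F) Y).
  move=> Fg Ft; have [[Y0 FY0]|F0] := pselect (exists Y, F Y); last first.
    have -> : \bigcup_(Y in F) Y = set0.
      by apply/seteqP; split=> // C [Y FY]; case: F0; exists Y.
    by rewrite /good setU0; split=> //; apply: nested_familyS.
  have one C : (S `|` \bigcup_(Y in F) Y) C -> exists2 Y, F Y & (S `|` Y) C.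
    by case=> [SC|[Y FY YC]]; [exists Y0 => //; left|exists Y => //; right].
  have two C D : (S `|` \bigcup_(Y in F) Y) C -> (S `|` \bigcup_(Y in F) Y) D ->
      exists2 Y, F Y & (S `|` Y) C /\ (S `|` Y) D.
    move=> /one[Y FY YC] /one[Y' FY' YD].
    have [h|h] := Ft _ _ FY FY'; [exists Y' => //|exists Y => //]; split=> //.
      by case: YC => [?|/h ?]; [left|right].
    by case: YD => [?|/h ?]; [left|right].
  have up Y : F Y -> S `|` Y `<=` S `|` \bigcup_(Y in F) Y.
    by move=> FY C [?|YC]; [left|right; exists Y].
  split; first split.
  - by move=> C /one[Y /Fg[h _]]; apply: (nf_size h).
  - by move=> C /one[Y /Fg[h _]]; apply: (nf_opt h).
  - by move=> C D CU DU; have [Y /Fg[h _] []] := two _ _ CU DU; apply: (nf_nested h).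
  - by move=> C /one[Y FY YC]; apply: (up Y) => //; apply: (nf_compl (Fg _ FY).1).
  - by move=> g C /one[Y FY YC]; apply: (up Y) => //; apply: (nf_translate (Fg _ FY).1).
  - by move=> C /one[Y /Fg[_ h]]; apply: h.
have [Y [[nY stY] maxY]] := Zorn_bigcup goodU.
exists (S `|` Y); split=> // C1 smallC1; apply: contrapT => nC1.
have genSY : small X n.+1 `<=` generated (S `|` Y).
  move=> D /genS; apply: generated_sub => N SN; apply: generated_in; by left.
have [C [fC sC nC CS Cnest]] : exists C, [/\ finite_set (d C), size C = n.+1,
    ~ generated (S `|` Y) C, (forall N, (S `|` Y) N -> nested_sets N C) &
    (forall g, nested_sets C (tr g C))].
  apply: (new_nested_cut act1 actM X_inv X_conn nY genSY).
  by case: smallC1 => fC1 sC1; exists C1.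
have [[x Cx] [y Cy]] := proper_generated nC.
have [f f1 fC'] : exists2 f, f <> 1 & f .: C = C.
  apply: contrapT => H; apply: noC; exists C; split=> //; [by exists x|by exists y|].
  by move=> a aC; apply: contrapT => a1; apply: H; exists a.
pose O : set (set P) := [set D | exists g, D = tr g C \/ D = ~` tr g C].
apply: (maxY (Y `|` O)).
  split; first by apply: subsetUl.
  move=> h; apply: nC; apply: generated_in; right; apply: h; right.
  by exists 1; left; rewrite (translate1 act1).
have nfC := nf_compl nY; have nfT := nf_translate nY.
have OE D : O D -> [/\ finite_set (d D), size D = n.+1 & ~ generated (S `|` Y) D].
  have T g : [/\ finite_set (d (tr g C)), size (tr g C) = n.+1 &
      ~ generated (S `|` Y) (tr g C)].
    split; first exact: finite_translate.
      by rewrite size_translate.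
    move=> h; apply: nC; rewrite -(translateK act1 actM g C).
    exact: generated_translate.
  move=> [g [->|->]] //; have [h1 h2 h3] := T g.
  by split; rewrite ?coboundaryC //; apply: generatedCN.
have nO E : (forall g, nested_sets E (tr g C)) -> forall D, O D -> nested_sets E D.
  by move=> h D [g [->|->]]; [|apply: nestedCr]; apply: h.
have OT g : O (tr g C) by exists g; left.
have oldO N D : (S `|` Y) N -> O D -> nested_sets N D.
  move=> SN; apply: nO => g; rewrite -(translateVK act1 actM g N).
  by apply: nested_translate; apply: CS; apply: nfT.
have OO D D' : O D -> O D' -> nested_sets D D'.
  move=> OD; apply: (nO) => g; apply: nested_symC; apply: (nO) OD => h.
  rewrite -(translateVK act1 actM g (tr h C)); apply: nested_translate.
  by rewrite -translateM.
have cases D : (S `|` (Y `|` O)) D -> (S `|` Y) D \/ O D.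
  by case=> [?|[?|?]]; [left; left|left; right|right].
have inl D : (S `|` Y) D -> (S `|` (Y `|` O)) D by case=> ?; [left|right; left].
have inr D : O D -> (S `|` (Y `|` O)) D by move=> ?; right; right.
split; first split.
- by move=> D /cases[/(nf_size nY)|/OE[? -> _]].
(* The new cuts are optimal: the family generates all cuts smaller than [n.+1], but not [D]. *)
- move=> D /cases[/(nf_opt nY)|/OE[fD sD nD]] //.
  by rewrite sD => h; apply: nD; apply: generated_sub h; apply: genSY.
- move=> D D' /cases[SD|OD] /cases[SD'|OD'].
  + exact: (nf_nested nY).
  + exact: oldO.
  + by apply: nested_symC; apply: oldO.
  + exact: OO.
- move=> D /cases[/nfC /inl //|[g [->|->]]]; apply: inr; exists g; first by right.
  by rewrite setCK; left.
- move=> g D /cases[/(nfT g) /inl //|[h [->|->]]]; apply: inr; exists (g * h).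
    by left; rewrite translateM.
  by right; rewrite translateM.
- move=> D /cases[/stY //|[g D_eq]].
  have [b bE] := inn_normal g f; exists b.
    move=> b1; apply: f1; have [e Ce] := coboundary_proper X_conn Cx Cy.
    apply: (X_free Ce.1); have -> : inn f = 1.
      apply: (@mulgI _ g); apply: (@mulIg _ g^-1).
      by rewrite -bE b1 multiplicative1 mulg1 mulgV.
    by rewrite /act2 !act1; case: (e).
  have gC : b .: tr g C = tr g C.
    by rewrite bE !translateM // translateK // fC'.
  by case: D_eq => ->; rewrite ?translateC gC.
Qed.

(** The empty family starts the induction, since a cut with empty coboundary in a connected graph is
    trivial. At [s] the family would generate all the [free_cuts] supplied. *)
Theorem exists_free_nested_cut : exists C, [/\ finite_set (d C),
  (exists x, C x), (exists x, ~ C x), (forall g, nested_sets C (tr g C)) &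
  (forall a, a .: C = C -> a = 1)].
Proof.
apply: contrapT => noC.
have key n : exists S, [/\ nested_family act X n S,
    (forall N, S N -> exists2 a, a <> 1 & a .: N = N) & small X n.+1 `<=` generated S].
  elim: n => [|n [S [nS stS genS]]]; last exact: bigger_family nS stS genS.
  exists set0; split=> //.
  move=> D [fD]; rewrite ltnS leqn0 => /eqP /(csize0 fD) dD.
  apply: contrapT => /proper_generated[[x Dx] [y Dy]].
  by have [e] := coboundary_proper X_conn Dx Dy; rewrite dD.
have [S [nS stS genS]] := key s; exact: (no_such_family nS stS genS).
Qed.

End FreeCuts.

(** * The tree dual to a nested orbit of cuts *)

Section CutTree.
Variables (G A : groupType) (P : choiceType) (act : G -> P -> P).
Hypothesis act1 : forall x, act 1 x = x.
Hypothesis actM : forall g h x, act (g * h) x = act g (act h x).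
Variable X : set (P * P).
Hypothesis X_inv : forall g e, X e -> X (act g e.1, act g e.2).
Hypothesis X_conn : graph_connected X.
Variable inn : {multiplicative A -> G}.
Hypothesis inn_normal : forall g a, exists b, inn b = g * inn a * g^-1.
Hypothesis X_free : forall a e, X e -> act2 act (inn a) e = e -> a = 1.
Hypothesis torsion_fixed : forall a n, (0 < n)%N -> a ^+ n = 1 ->
  exists p, act (inn a) p = p.
Hypothesis point_stab : forall p, exists a, a <> 1 /\ act (inn a) p = p.
Hypothesis A_infinite : ~ finite_set [set: A].
Variables (I : finType) (rep : I -> G).
Hypothesis repP : forall g, exists a i, g = inn a * rep i.
Local Notation d := (coboundary X).
Local Notation tr := (translate act).
Local Notation "a .* x" := (act (inn a) x) (at level 40, left associativity).
Local Notation "a .: C" := (translate act (inn a) C) (at level 40, left associativity).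
Variable C : set P.
Hypothesis C_finite : finite_set (d C).
Variables (x0 y0 : P) (Cx0 : C x0) (Cy0 : ~ C y0).
Hypothesis C_nested : forall g, nested_sets C (tr g C).
Hypothesis C_free : forall a, a .: C = C -> a = 1.
Implicit Types (W D : set P) (a b : A) (g : G).

Let trM := translateM actM.
Let trK := translateK act1 actM.
Let trVK := translateVK act1 actM.
Let tr1 := translate1 act1.

Definition orbit_cut : set (set P) := [set D | exists g, D = tr g C \/ D = ~` tr g C].
Local Notation O := orbit_cut.

Lemma orbit_cutC W : O W -> O (~` W).
Proof. by move=> [g [->|->]]; exists g; [right|left; rewrite setCK]. Qed.

Lemma orbit_cut_tr g W : O W -> O (tr g W).
Proof. by move=> [h [->|->]]; exists (g * h); [left|right]; rewrite trM. Qed.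

Lemma orbit_cut_proper W : O W -> (exists x, W x) /\ (exists x, ~ W x).
Proof.
have T g : (exists x, tr g C x) /\ (exists x, ~ tr g C x).
  by split; [exists (act g x0)|exists (act g y0)]; rewrite translate_act.
move=> [g [->|->]] //; have [[x hx] [y hy]] := T g.
by split; [exists y|exists x => h; apply: h].
Qed.

Lemma orbit_cut_nested W D : O W -> O D -> nested_sets W D.
Proof.
have T g h : nested_sets (tr g C) (tr h C).
  rewrite -(trVK g (tr h C)); apply: nested_translate; rewrite -trM; exact: C_nested.
move=> [g [->|->]] [h [->|->]]; first exact: T.
- exact/nestedCr/T.
- exact/nestedCl/T.
- exact/nestedCl/nestedCr/T.
Qed.

Lemma inn_inj1 a : inn a = 1 -> a = 1.
Proof.
move=> a1; have [e Ce] := coboundary_proper X_conn Cx0 Cy0.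
by apply: (X_free Ce.1); rewrite a1 /act2 !act1; case: (e).
Qed.

(** Then [a ^+ 2] stabilizes [C], so [a] is torsion and fixes a point, which would lie on both sides
    of [C]. *)
Lemma no_inversion a : a .: C <> ~` C.
Proof.
move=> aC; have aa : (a * a) .: C = C by rewrite gmulfM trM aC translateC aC setCK.
have [p ap] := torsion_fixed (n := 2) isT (C_free aa : a ^+ 2 = 1).
have := @translate_act _ _ act act1 actM (inn a) C p; rewrite ap aC /setC /=; tauto.
Qed.

Lemma orbit_cut_free W a : O W -> a .: W = W -> a = 1.
Proof.
have T g : a .: tr g C = tr g C -> a = 1.
  move=> E; have [b bE] := inn_normal g^-1 a; rewrite invgK in bE.
  have b1 : b = 1 by apply: C_free; rewrite bE !trM E trK.
  apply: inn_inj1; apply: (@mulgI _ g^-1); apply: (@mulIg _ g).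
  by rewrite -bE b1 multiplicative1 mulg1 mulVg.
move=> [g [->|->]]; first exact: T.
by rewrite translateC => /(congr1 setC); rewrite !setCK; exact: T.
Qed.

Lemma orbit_cut_inversion W a : O W -> a .: W <> ~` W.
Proof.
have T g : a .: tr g C <> ~` tr g C.
  move=> E; have [b bE] := inn_normal g^-1 a; rewrite invgK in bE.
  by apply: (@no_inversion b); rewrite bE !trM E translateC trK.
move=> [g [->|->]]; first exact: T.
by rewrite translateC => /(congr1 setC); rewrite !setCK; exact: T.
Qed.

(** By [repP] the cuts form finitely many [A]-orbits up to complement, each with finitely many cuts
    separating [x] from [y]. *)
Lemma orbit_cut_sep_finite x y : finite_set [set W | O W /\ separates W x y].
Proof.
apply: (@sub_finite_set _ _ (\bigcup_(i in [set: I])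
   ((fun a => a .: tr (rep i) C) @` [set a | separates (a .: tr (rep i) C) x y] `|`
    (fun a => ~` (a .: tr (rep i) C)) @` [set a | separates (a .: tr (rep i) C) x y]))).
  move=> W [[g gE] sW]; have [a [i E]] := repP g; exists i => //.
  rewrite E trM in gE; case: gE => WE; rewrite WE in sW *; [left|right]; exists a => //.
  by move: sW; rewrite /separates /setC /=; have := EM ((a .: tr (rep i) C) x);
     have := EM ((a .: tr (rep i) C) y); tauto.
apply: bigcup_finite; first exact: finite_finset.
move=> i _; have fS : finite_set [set a | separates (a .: tr (rep i) C) x y].
  apply: (separating_finite act1 actM X_inv X_conn X_free).
  exact: finite_translate.
by rewrite finite_setU; split; apply: finite_image.
Qed.

(* A vertex orients every cut consistently, and differs on finitely many cuts
   from the orientation towards a point. *)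
Record vertex_axioms (v : set (set P)) : Prop := VertexAxioms {
  va_sub : v `<=` O;
  va_or : forall W, O W -> v W \/ v (~` W);
  va_xor : forall W, v W -> ~ v (~` W);
  va_up : forall W D, v W -> W `<=` D -> O D -> v D;
  va_fin : exists p, finite_set [set W | O W /\ ~ (v W <-> W p)] }.

Definition vertex : Type := {v : set (set P) | vertex_axioms v}.

Lemma vertex_eq (v w : vertex) : sval v = sval w -> v = w.
Proof.
by case: v w => v hv [w hw] /= E; subst w; rewrite (Prop_irrelevance hv hw).
Qed.

Lemma va_fin_all v p : vertex_axioms v -> finite_set [set W | O W /\ ~ (v W <-> W p)].
Proof.
move=> hv; have [q fq] := va_fin hv.
have fU : finite_set ([set W | O W /\ ~ (v W <-> W q)] `|` [set W | O W /\ separates W p q]).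
  by rewrite finite_setU; split=> //; apply: orbit_cut_sep_finite.
apply: sub_finite_set fU => W [OW h]; have [sW|sW] := EM (separates W p q).
  by right.
by left; split=> //; move: h sW; rewrite /separates; tauto.
Qed.

Lemma principal_axioms p : vertex_axioms [set W | O W /\ W p].
Proof.
split.
- by move=> W [].
- by move=> W OW; have [Wp|Wp] := EM (W p); [left|right]; split=> //; apply: orbit_cutC.
- by move=> W [_ Wp] [_].
- by move=> W D [_ Wp] WD OD; split=> //; apply: WD.
- exists p; apply: (@sub_finite_set _ _ set0); last exact: finite_set0.
  by move=> W /= [OW]; tauto.
Qed.

Definition principal p : vertex := exist _ _ (principal_axioms p).

(* The only vertex in which W is minimal: an end of the edge W of the tree. *)
Definition head W : set (set P) :=
  [set D | O D /\ (W `<=` D \/ (~` W `<=` D /\ ~` W <> D))].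

Lemma head_axioms W : O W -> vertex_axioms (head W).
Proof.
move=> OW; have [[x Wx] [y Wy]] := orbit_cut_proper OW; split.
- by move=> D [].
- move=> D OD; have OD' := orbit_cutC OD.
  case: (orbit_cut_nested OW OD) => h.
  + by left; split=> //; left.
  + by right; split=> //; left.
  + have [E|ne] := pselect (~` W = D); last by left; split=> //; right.
    by right; split=> //; left; rewrite -E setCK.
  + have [E|ne] := pselect (~` W = ~` D); last by right; split=> //; right.
    by left; split=> //; left; rewrite -[W]setCK E setCK.
- move=> D [_ h] [_ h']; case: h h' => [h|[h ne]] [h'|[h' ne']].
  + by apply: (h' x) => //; apply: h.
  + apply: ne'; congr setC; apply/seteqP; split=> // z Dz.
    by apply: contrapT => Wz; apply: (h' z).
  + apply: ne; apply/seteqP; split=> // z Dz Wz; exact: (h' z).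
  + by apply: (h' y) => //; apply: h.
- move=> D E [_ h] DE OE; split=> //; case: h => [h|[h ne]].
    by left; apply: subset_trans DE.
  right; split; first by apply: subset_trans DE.
  by move=> E'; apply: ne; apply/seteqP; split=> //; rewrite E'.
(* A cut on which the head of [W] disagrees with the point [x] of [W] separates [x] from the outside
   point [y]. *)
- exists x; apply: sub_finite_set (orbit_cut_sep_finite x y) => D [OD h].
  split=> // sD; apply: h; split.
    by case=> _ [h|[h _]]; [apply: h|apply/sD; apply: h].
  move=> Dx; split=> //; case: (orbit_cut_nested OW OD) => h.
  + by left.
  + by case: (h x).
  + have [E|ne] := pselect (~` W = D); last by right.
    by exfalso; rewrite -E in Dx; apply: Dx.
  + by exfalso; apply: (h y) => //; apply/sD.
Qed.

Definition vhead W (OW : O W) : vertex := exist _ _ (head_axioms OW).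

Lemma gact_axioms g v : vertex_axioms v -> vertex_axioms [set W | v (tr g^-1 W)].
Proof.
move=> hv; split.
- by move=> W /= /(va_sub hv) /(orbit_cut_tr g); rewrite trVK.
- by move=> W OW /=; have := va_or hv (orbit_cut_tr g^-1 OW).
- by move=> W /= /(va_xor hv).
- move=> W D /= vW WD OD; apply: (va_up hv) vW _ _; first exact: translateS.
  exact: orbit_cut_tr.
- have [p fp] := va_fin hv; exists (act g p).
  apply: sub_finite_set (finite_image (tr g) fp) => W [OW h].
  exists (tr g^-1 W); last exact: trVK.
  split; first exact: orbit_cut_tr.
  have E : (tr g^-1 W) p <-> W (act g p) by rewrite /translate /= invgK.
  by move: h E => /=; tauto.
Qed.

Definition gact g (v : vertex) : vertex := exist _ _ (gact_axioms g (svalP v)).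

Lemma gact1 v : gact 1 v = v.
Proof. by apply: vertex_eq; apply/seteqP; split=> W /=; rewrite invg1 tr1. Qed.

Lemma gactM g h v : gact (g * h) v = gact g (gact h v).
Proof. by apply: vertex_eq; apply/seteqP; split=> W /=; rewrite invgM trM. Qed.

Lemma gact_principal g p : gact g (principal p) = principal (act g p).
Proof.
apply: vertex_eq; apply/seteqP; split=> W /= [OW h]; split.
- by rewrite -(trVK g W); apply: orbit_cut_tr.
- by rewrite -(trVK g W) translate_act.
- exact: orbit_cut_tr.
- by rewrite -(trVK g W) translate_act // in h.
Qed.

Lemma gact_head g W (OW : O W) (OgW : O (tr g W)) : gact g (vhead OW) = vhead OgW.
Proof.
have sub h D E : tr h D `<=` tr h E <-> D `<=` E.
  by split=> [/(translateS (act := act) (g := h^-1))|]; rewrite ?trK //; apply: translateS.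
apply: vertex_eq; apply/seteqP; split=> D /= [OD h].
  split; first by rewrite -(trVK g D); apply: orbit_cut_tr.
  case: h => [h|[h ne]].
    by left; rewrite -(trVK g D); apply/sub.
  right; rewrite -translateC; split; first by rewrite -(trVK g D); apply/sub.
  by move=> E; apply: ne; rewrite -E trK.
split; first exact: orbit_cut_tr.
case: h => [h|[h ne]]; first by left; apply/(sub g); rewrite trVK.
right; rewrite -translateC in h ne; split; first by apply/(sub g); rewrite trVK.
by move=> E; apply: ne; rewrite E trVK.
Qed.

(** Several [rep i] may give the same [A]-orbit of unoriented edges. One index is kept per class,
    since [tree_action] requires each edge to be named once. *)
Definition equivalent_rep (i k : I) : Prop :=
  exists a, tr (rep k) C = a .: tr (rep i) C \/ tr (rep k) C = ~` (a .: tr (rep i) C).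

Lemma equivalent_rep_sym i k : equivalent_rep i k -> equivalent_rep k i.
Proof.
move=> [a h]; exists a^-1; rewrite multiplicativeV.
by case: h => ->; [left|right]; rewrite ?translateC trK ?setCK.
Qed.

Lemma equivalent_rep_trans i k l :
  equivalent_rep i k -> equivalent_rep k l -> equivalent_rep i l.
Proof.
move=> [a h] [b h']; exists (b * a); rewrite gmulfM trM.
by case: h h' => -> [] ->; rewrite ?translateC ?setCK; tauto.
Qed.

Definition canon (i : I) : I := odflt i [pick k | `[< equivalent_rep i k >]].

Lemma canonP i : equivalent_rep i (canon i).
Proof.
rewrite /canon; case: pickP => [k /asboolP //|/(_ i) /asboolP []].
by exists 1; left; rewrite multiplicative1 tr1.
Qed.

Lemma canon_eq i k : equivalent_rep i k -> canon i = canon k.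
Proof.
move=> ik; rewrite /canon.
have E : (fun l => `[< equivalent_rep i l >]) =1 (fun l => `[< equivalent_rep k l >]).
  move=> l; apply/asboolP/asboolP; last exact: equivalent_rep_trans.
  exact/equivalent_rep_trans/equivalent_rep_sym.
rewrite (eq_pick E); case: pickP => // /(_ k) /asboolP [].
by exists 1; left; rewrite multiplicative1 tr1.
Qed.

Definition edge_rep : finType := {i : I | canon i == i}.

Definition Rcut (j : edge_rep) : set P := tr (rep (val j)) C.

Lemma Rcut_O j : O (Rcut j). Proof. by exists (rep (val j)); left. Qed.

Lemma Rcut_cover W : O W -> exists a j, W = a .: Rcut j \/ W = ~` (a .: Rcut j).
Proof.
move=> [g h]; have [a [i E]] := repP g; rewrite E trM in h.
have ci : canon (canon i) == canon i by apply/eqP; symmetry; apply/canon_eq/canonP.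
have [b h'] := equivalent_rep_sym (canonP i).
exists (a * b), (exist (fun i => canon i == i) _ ci : edge_rep); rewrite gmulfM trM /Rcut /=.
by case: h h' => -> [] ->; rewrite ?translateC ?setCK; tauto.
Qed.

Lemma Rcut_eq a j k : Rcut j = a .: Rcut k \/ Rcut j = ~` (a .: Rcut k) ->
  j = k /\ a = 1.
Proof.
move=> h; have jk : j = k.
  apply: val_inj; rewrite -(eqP (valP j)) -(eqP (valP k)); symmetry.
  by apply: canon_eq; exists a.
subst k; split=> //; case: h => [/esym|E]; first exact/orbit_cut_free/Rcut_O.
by case: (@orbit_cut_inversion (Rcut j) a (Rcut_O j)); rewrite {2}E setCK.
Qed.

Lemma head_flip W D : D <> W -> D <> ~` W -> head (~` W) D <-> head W D.
Proof.
move=> h1 h2; rewrite /head /= setCK.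
have h1' : W <> D by move=> E; apply: h1.
have h2' : ~` W <> D by move=> E; apply: h2.
by tauto.
Qed.

Lemma vertex_diff_finite (v w : vertex) :
  finite_set [set W | sval v W /\ ~ sval w W].
Proof.
have fU : finite_set ([set W | O W /\ ~ (sval v W <-> W x0)] `|`
                      [set W | O W /\ ~ (sval w W <-> W x0)]).
  by rewrite finite_setU; split; apply: va_fin_all; apply: svalP.
apply: sub_finite_set fU => W [vW wW].
have OW := va_sub (svalP v) vW.
have [h|h] := EM (sval v W <-> W x0); [right|left]; split=> //.
by tauto.
Qed.

Lemma minimal_head (v : vertex) W (OW : O W) : sval v W ->
  (forall D, sval v D -> D `<=` W -> D = W) -> v = vhead OW.
Proof.
move=> vW vmin; have hv := svalP v; apply: vertex_eq; apply/seteqP; split=> D.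
  move=> vD; have OD := va_sub hv vD; split=> //.
  case: (orbit_cut_nested OW OD) => h.
  - by left.
  - by case: (va_xor hv vD); apply: (va_up hv) vW h (orbit_cutC OD).
  - have [E|ne] := pselect (~` W = D); last by right.
    by case: (va_xor hv vW); rewrite E.
  - have -> : D = W by apply: vmin => // z Dz; apply: contrapT => Wz; apply: (h z).
    by left.
move=> [OD [h|[h ne]]]; first exact: (va_up hv) vW h OD.
have [//|vD] := va_or hv OD; exfalso; apply: ne; rewrite -[D]setCK; congr setC.
symmetry; apply: vmin => // z Dz; apply: contrapT => Wz; apply: Dz; exact: h.
Qed.

(** Induction on the number of cuts of [v] not in [w]. A minimal such cut [W] is minimal in [v],
    because [w] is upward closed, so [v] is the head of [W]; crossing the edge replaces [W] by its
    complement and changes no other cut. *)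
Lemma vertex_conn (Q : vertex -> Prop) :
  (forall W (OW : O W) (OW' : O (~` W)), Q (vhead OW) -> Q (vhead OW')) ->
  forall v w, Q v -> Q w.
Proof.
move=> hQ v w; pose D (v : vertex) := [set W | sval v W /\ ~ sval w W].
have [n] := ubnP (csize (D v)); elim: n v => // n IH v; rewrite ltnS => vn Qv.
have fD := vertex_diff_finite v w : finite_set (D v).
have [[W0 DW0]|D0] := pselect (exists W, D v W); last first.
  suff <- : v = w by [].
  apply: vertex_eq; apply/seteqP; split=> W.
    by move=> vW; apply: contrapT => wW; apply: D0; exists W.
  move=> wW; have OW := va_sub (svalP w) wW; have [//|vW] := va_or (svalP v) OW.
  exfalso; apply: D0; exists (~` W); split=> //; exact: (va_xor (svalP w) wW).
have [W DW Wmin] := exists_argmin (fun W => csize [set E | D v E /\ E `<=` W]) DW0.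
have [vW wW] := DW; have OW := va_sub (svalP v) vW; have OW' := orbit_cutC OW.
have vE : v = vhead OW.
  apply: minimal_head => // E vE EW; apply: contrapT => ne.
  have DE : D v E by split=> // wE; apply: wW; apply: (va_up (svalP w)) wE EW OW.
  have := Wmin E DE; rewrite leqNgt => /negP; apply.
  apply: (csize_lt (x := W)).
  - by apply: sub_finite_set fD => ? [].
  - by move=> F [DF FE]; split=> //; apply: subset_trans EW.
  - by split.
  - by case=> _ WE; apply: ne; apply/seteqP.
apply: (IH (vhead OW')); last by apply: hQ; rewrite -vE.
apply: leq_trans vn; apply: (csize_lt (x := W)) => //.
- move=> E [/= hE wE].
  have EW' : E <> ~` W.
    by move=> E'; case: (va_or (svalP w) OW) => //; rewrite -E'.
  have EW : E <> W.
    move=> E'; rewrite E' in hE; have [] := va_xor (head_axioms OW') (W := ~` W).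
      by split=> //; left.
    by rewrite setCK.
  by rewrite /D vE; split=> //; apply/(head_flip EW EW').
- case=> /= hE _; have [] := va_xor (head_axioms OW') (W := ~` W).
    by split=> //; left.
  by rewrite setCK.
Qed.

Definition edge_end (j : edge_rep) (o : bool) : vertex :=
  if o then vhead (Rcut_O j) else vhead (orbit_cutC (Rcut_O j)).

Lemma vhead_irr W D (OW : O W) (OD : O D) : W = D -> vhead OW = vhead OD.
Proof. by move=> E; subst D; rewrite (Prop_irrelevance OW OD). Qed.

Lemma gact_edge_end g j o : exists W (OW : O W),
  gact g (edge_end j o) = vhead OW /\
  forall OW' : O (~` W), gact g (edge_end j (~~ o)) = vhead OW'.
Proof.
have OR := Rcut_O j; have OR' := orbit_cutC OR.
have OgR := orbit_cut_tr g OR; have OgR' := orbit_cut_tr g OR'.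
case: o; [exists _, OgR|exists _, OgR'] => /=; split=> [|OW']; try exact: gact_head.
by rewrite (gact_head _ OgR); apply: vhead_irr; rewrite translateC setCK.
Qed.

Lemma edge_cut W (OW : O W) (OW' : O (~` W)) : exists a j o,
  gact (inn a) (edge_end j o) = vhead OW /\
  gact (inn a) (edge_end j (~~ o)) = vhead OW'.
Proof.
have [a [j h]] := Rcut_cover OW; exists a, j.
have OR := Rcut_O j; have OR' := orbit_cutC OR.
have OgR := orbit_cut_tr (inn a) OR; have OgR' := orbit_cut_tr (inn a) OR'.
case: h => E; [exists true|exists false] => /=;
  rewrite (gact_head _ OgR) (gact_head _ OgR'); split; apply: vhead_irr;
  by rewrite E ?translateC ?setCK.
Qed.

Lemma edge_side_src j : ~ sval (edge_end j false) (Rcut j).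
Proof.
move=> h; have [] := va_xor (head_axioms (orbit_cutC (Rcut_O j))) (W := ~` Rcut j).
  by split; [exact: orbit_cutC (Rcut_O j)|left].
by rewrite setCK.
Qed.

Lemma edge_side_tgt j : sval (edge_end j true) (Rcut j).
Proof. by split; [exact: Rcut_O|left]. Qed.

Lemma edge_side_edge j a j' : (a, j') <> (1, j) ->
  sval (gact (inn a) (edge_end j' false)) (Rcut j) <->
  sval (gact (inn a) (edge_end j' true)) (Rcut j).
Proof.
move=> ne; rewrite /=; apply: head_flip => E; apply: ne.
  have [-> ->] // : j = j' /\ a = 1 by apply: Rcut_eq; left; rewrite -E trVK.
have [-> ->] // : j = j' /\ a = 1.
by apply: Rcut_eq; right; rewrite -translateC -E trVK.
Qed.

Lemma edge_conn_inv (Q : vertex -> Prop) :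
  (forall a j, Q (gact (inn a) (edge_end j false)) <->
               Q (gact (inn a) (edge_end j true))) ->
  forall v w, Q v -> Q w.
Proof.
move=> hQ; apply: vertex_conn => W OW OW'.
have [a [j [o [<- <-]]]] := edge_cut OW OW'.
by case: o => /=; rewrite ?hQ //; have := hQ a j; rewrite /=; tauto.
Qed.

Definition cut_tree : tree_action A :=
  @TreeAction A vertex (fun a => gact (inn a))
    (fun v => etrans (congr1 (gact^~ v) (multiplicative1 inn)) (gact1 v))
    (fun a b v => etrans (congr1 (gact^~ v) (gmulfM (s := inn) a b)) (gactM _ _ v))
    edge_rep (edge_end^~ false) (edge_end^~ true) (fun j v => sval v (Rcut j))
    edge_side_src edge_side_tgt edge_side_edge edge_conn_inv.

Lemma cut_tree_adjacent (v w : cut_tree) : adjacent v w <->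
  exists W (OW : O W) (OW' : O (~` W)), v = vhead OW /\ w = vhead OW'.
Proof.
split.
  move=> [[a j] [o [<- <-]]]; have [W [OW [E1 E2]]] := gact_edge_end (inn a) j o.
  exists W, OW, (orbit_cutC OW); rewrite -E1 -E2.
  by case: o {E1 E2}.
move=> [W [OW [OW' [-> ->]]]]; have [a [j [o [E1 E2]]]] := edge_cut OW OW'.
by exists (a, j), o; rewrite -E1 -E2; case: o {E1 E2}.
Qed.

Lemma gact_adjacent g (v w : cut_tree) : adjacent v w ->
  adjacent (gact g v : cut_tree) (gact g w : cut_tree).
Proof.
move=> /cut_tree_adjacent [W [OW [OW' [-> ->]]]]; apply/cut_tree_adjacent.
have OgW := orbit_cut_tr g OW; have OgW' := orbit_cut_tr g OW'.
by exists _, OgW, OgW'; split; apply: gact_head.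
Qed.

Lemma cut_tree_edge : exists j : tedge cut_tree, True.
Proof.
have OC : O C by exists 1; left; rewrite tr1.
by have [a [j _]] := Rcut_cover OC; exists j.
Qed.

(** A fixed vertex contains all [A]-translates of some cut [W]. It agrees with any point up to
    finitely many cuts, so each point lies in almost all translates. For [f] fixing a point [p]
    outside [W], this makes [f] torsion and [W] disjoint from its translate by [f]; yet, [A] being
    infinite, some [a] carries both to cuts containing [p]. *)
Lemma cut_tree_no_fixed : ~ exists v : cut_tree, forall a, tact a v = v.
Proof.
move=> [v vfix]; have hv := svalP v.
have OC : O C by exists 1; left; rewrite tr1.
have [W OW vW] : exists2 W, O W & sval v W.
  have [vC|vC] := va_or hv OC; first by exists C.
  by exists (~` C) => //; apply: orbit_cutC.
have vaW a : sval v (a .: W).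
  by rewrite -(vfix a) /= trK.
have [_ [p Wp]] := orbit_cut_proper OW.
have Winj : injective (fun a => a .: W).
  move=> a b /= E; apply/divg1_eq.
  have h : (b^-1 * a) .: W = W by rewrite gmulfM trM E -trM -gmulfM mulVg multiplicative1 tr1.
  have /(canRL (mulKg _)) -> := orbit_cut_free OW h.
  by rewrite invgK mulg1 mulgV.
have fp q : finite_set [set a | ~ (a .: W) q].
  apply: (@sub_finite_set _ _ ((fun a => a .: W) @^-1` [set D | O D /\ ~ (sval v D <-> D q)])).
    move=> a /= h; split; first exact: orbit_cut_tr.
    by have := vaW a; tauto.
  apply: finite_preimage; last exact: va_fin_all.
  by move=> a b _ _ /Winj.
have [f [f1 fpp]] := point_stab p.
have fixn n : f ^+ n .* p = p.
  elim: n => [|n IH]; first by rewrite expg0 multiplicative1 act1.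
  by rewrite expgS gmulfM actM IH.
have [|n n0 fn] := finite_powers (a := f) (fp p).
  by move=> j /= h; apply: Wp; move: h; rewrite -{1}(fixn j) translate_act.
have fn1 : f ^+ n.-1 = f^-1.
  by apply: (@mulgI _ f); rewrite -expgS prednK // fn mulgV.
have incr b : W `<=` b .: W -> b ^+ n = 1 -> b .: W = W.
  move=> inc bn; have incn k : W `<=` (b ^+ k) .: W.
    elim: k => [|k IH]; first by rewrite expg0 multiplicative1 tr1.
    by rewrite expgS gmulfM trM => x /inc; apply: translateS.
  apply/seteqP; split=> //; have := translateS (act := act) (g := inn b) (incn n.-1).
  by rewrite -trM -gmulfM -expgS prednK // bn multiplicative1 tr1.
have fW : ~ (f .: W) p by move=> h; apply: Wp; move: h; rewrite -{1}fpp translate_act.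
case: (orbit_cut_nested OW (orbit_cut_tr (inn f) OW)) => h.
- by apply: f1; apply: (orbit_cut_free OW); apply: incr.
- apply: A_infinite.
  apply: (@sub_finite_set _ _ ([set a | ~ (a .: W) p] `|` (fun a => a * f) @^-1` [set a | ~ (a .: W) p])).
    move=> a _; have [aWp|] := pselect ((a .: W) p); last by left.
    right => /= h'; rewrite gmulfM trM in h'.
    by apply: (h (act (inn a)^-1 p)); [exact: aWp|exact: h'].
  rewrite finite_setU; split=> //; apply: finite_preimage => // a b _ _.
  exact: mulIg.
- by apply: fW; apply: h.
- apply: f1; apply: invg_inj; rewrite invg1; apply: (orbit_cut_free OW); apply: incr.
    move=> z Wz; rewrite multiplicativeV /translate /= invgK; apply: contrapT => nW.
    by apply: (h _ nW); rewrite translate_act.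
  by rewrite expVgn fn invg1.
Qed.

End CutTree.

(** * The tree of a free product *)

Section Wreath.
Variable A : groupType.

(* The semidirect product of the functions A -> Z/2 by A; its homomorphic
   sections over A are derivations. *)
Definition wreath : Type := ((A -> bool) * A)%type.
HB.instance Definition _ := gen_eqMixin wreath.
HB.instance Definition _ := gen_choiceMixin wreath.

Definition wreath_mul (u v : wreath) : wreath :=
  (fun g => u.1 g (+) v.1 (u.2^-1 * g), u.2 * v.2).
Definition wreath_one : wreath := (fun=> false, 1).
Definition wreath_inv (u : wreath) : wreath := (fun g => u.1 (u.2 * g), u.2^-1).

Fact wreath_mulA : associative wreath_mul.
Proof.
move=> u v w; congr pair; last by rewrite /= mulgA.
by apply/funext => g /=; rewrite invgM mulgA addbA.
Qed.
Fact wreath_mul1 : left_id wreath_one wreath_mul.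
Proof. by case=> f a; congr pair; [apply/funext => g|]; rewrite /= ?invg1 mul1g. Qed.
Fact wreath_1mul : right_id wreath_one wreath_mul.
Proof. by case=> f a; congr pair; [apply/funext => g|]; rewrite /= ?addbF ?mulg1. Qed.
Fact wreath_mulV : left_inverse wreath_one wreath_inv wreath_mul.
Proof.
case=> f a; congr pair; last by rewrite /= mulVg.
by apply/funext => g; rewrite /= invgK addbb.
Qed.
Fact wreath_Vmul : right_inverse wreath_one wreath_inv wreath_mul.
Proof.
case=> f a; congr pair; last by rewrite /= mulgV.
by apply/funext => g; rewrite /= mulVKg addbb.
Qed.

HB.instance Definition _ := isGroup.Build wreath
  wreath_mulA wreath_mul1 wreath_1mul wreath_mulV wreath_Vmul.

Definition wreath_section (a : A) : wreath := (fun=> false, a).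
Fact wreath_section_morph : {morph wreath_section : a b / a * b}.
Proof. by []. Qed.

(** The conjugate of [wreath_section] by the indicator function of 1, that is, a principal
    derivation. *)
Definition wreath_twisted (a : A) : wreath :=
  (fun g => (g == 1) (+) (a^-1 * g == 1), a).
Fact wreath_twisted_morph : {morph wreath_twisted : a b / a * b}.
Proof.
move=> a b; congr pair; apply/funext => g /=.
by rewrite invgM mulgA addbA -(addbA (g == 1)) addbb addbF.
Qed.

Definition wreath_snd (u : wreath) : A := u.2.
Fact wreath_snd_morph : {morph wreath_snd : u v / u * v}. Proof. by []. Qed.

End Wreath.

Definition comp_multiplicative (G H K : groupType) (f : {multiplicative H -> K})
    (g : {multiplicative G -> H}) : {multiplicative G -> K} :=
  to_multiplicative (fun x y => etrans (congr1 f (gmulfM (s := g) x y))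
    (gmulfM (s := f) (g x) (g y)) : (f \o g) (x * y) = _).

Definition id_multiplicative (G : groupType) : {multiplicative G -> G} :=
  to_multiplicative (fun x y => erefl : id (x * y) = _).

Definition one_multiplicative (G K : groupType) : {multiplicative G -> K} :=
  to_multiplicative (fun x y => esym (mulg1 1) : (fun=> 1 : K) (x * y) = 1 * 1).

Section FreeProduct.
Variables (A : groupType) (n : nat) (Ai : 'I_n -> groupType) (B : groupType).
Variables (iA : forall i : 'I_n, {multiplicative Ai i -> A}).
Variable iB : {multiplicative B -> A}.
Hypothesis A_free_product : is_free_product iA iB.
Variables (k : nat) (b : 'I_k -> B).
Hypothesis B_free : forall (K : groupType) (f : 'I_k -> K),
  exists F : {multiplicative B -> K},
    (forall i, F (b i) = f i) /\
    forall F' : {multiplicative B -> K}, (forall i, F' (b i) = f i) -> F' =1 F.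

Definition bl (l : 'I_k) : A := iB (b l).

Lemma hom_exists (K : groupType) (f : forall i, {multiplicative Ai i -> K})
    (c : 'I_k -> K) : exists F : {multiplicative A -> K},
  (forall i x, F (iA i x) = f i x) /\ (forall l, F (bl l) = c l).
Proof.
have [F0 [F0c _]] := B_free c; have [F [[F1 F2] _]] := A_free_product f F0.
by exists F; split=> // l; rewrite /bl F2 F0c.
Qed.

Lemma hom_unique (K : groupType) (F F' : {multiplicative A -> K}) :
  (forall i x, F (iA i x) = F' (iA i x)) -> (forall l, F (bl l) = F' (bl l)) -> F =1 F'.
Proof.
move=> h1 h2; have [F0 [F0c F0u]] := B_free (fun l => F (bl l)).
have E1 := F0u (comp_multiplicative F iB) (fun l => erefl).
have E2 := F0u (comp_multiplicative F' iB) (fun l => esym (h2 l)).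
have [H [_ Hu]] := A_free_product (fun i => comp_multiplicative F (iA i)) F0.
move=> a; transitivity (H a); [|symmetry]; apply: Hu; split=> //.
by move=> i x; rewrite -h1.
Qed.

Lemma generated_by_factors (S : set A) : is_subgroup S ->
  (forall i x, S (iA i x)) -> (forall l, S (bl l)) -> forall a, S a.
Proof.
move=> hS SA SB a.
have fM i : {morph (fun x => exist S _ (SA i x) : subgroup_type hS) : x y / x * y}.
  by move=> x y; apply: sub_val_inj; rewrite /= gmulfM.
have [F [F1 F2]] := hom_exists (fun i => to_multiplicative (fM i))
  (fun l => exist S _ (SB l) : subgroup_type hS).
have <- : sval (F a) = a.
  apply: (hom_unique (F := comp_multiplicative
    (to_multiplicative (@sub_incl_morph _ _ hS)) F) (F' := id_multiplicative A)).
    by move=> i x; rewrite /= F1.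
  by move=> l; rewrite /= F2.
exact: svalP.
Qed.

Lemma retraction i : exists r : {multiplicative A -> Ai i},
  [/\ (forall x, r (iA i x) = x), (forall j x, j <> i -> r (iA j x) = 1) &
      (forall y, r (iB y) = 1)].
Proof.
pose f j : {multiplicative Ai j -> Ai i} := match pselect (j = i) with
  | left e => eq_rect_r (fun j => {multiplicative Ai j -> Ai i}) (id_multiplicative (Ai i)) e
  | right _ => one_multiplicative _ _ end.
have [F [[F1 F2] _]] := A_free_product f (one_multiplicative B (Ai i)).
exists F; split=> [x|j x ji|y]; rewrite ?F1 ?F2 /f //; case: pselect => // e.
by rewrite (Prop_irrelevance e erefl).
Qed.

Lemma retraction_B : exists r : {multiplicative A -> B},
  (forall y, r (iB y) = y) /\ (forall j x, r (iA j x) = 1).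
Proof.
have [F [[F1 F2] _]] := A_free_product (fun i => one_multiplicative (Ai i) B)
  (id_multiplicative B).
by exists F; split=> *; rewrite ?F1 ?F2.
Qed.

Lemma iA_eq1 i x : iA i x = 1 -> x = 1.
Proof. by have [r [rK _ _]] := retraction i; rewrite -{2}(rK x) => ->; apply: multiplicative1. Qed.

Definition edge_type : finType := ('I_n + 'I_k)%type.

(* d a g tells whether the edge (g, j) of the tree separates 1 from a; this is
   a derivation, hence it is determined freely on the factors. No normal form
   theorem is needed. *)
Lemma derivation (j : edge_type) : exists d : A -> A -> bool,
  [/\ (forall a a' g, d (a * a') g = d a g (+) d a' (a^-1 * g)),
      (forall i x g, d (iA i x) g =
         (j == inl i) && ((g == 1) (+) ((iA i x)^-1 * g == 1))) &
      (forall l g, d (bl l) g = (j == inr l) && (g == 1))].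
Proof.
pose f i : {multiplicative Ai i -> wreath A} :=
  comp_multiplicative (if j == inl i then to_multiplicative (@wreath_twisted_morph A)
                       else to_multiplicative (@wreath_section_morph A)) (iA i).
pose c l : wreath A := (fun g => (j == inr l) && (g == 1), bl l).
have [F [F1 F2]] := hom_exists f c.
have Fsnd : forall a, (F a).2 = a.
  apply: (@hom_unique _ (comp_multiplicative (to_multiplicative (@wreath_snd_morph A)) F)
    (id_multiplicative A)).
    by move=> i x /=; rewrite F1 /f /=; case: eqP.
  by move=> l /=; rewrite F2.
exists (fun a => (F a).1); split=> [a a' g|i x g|l g].
- by rewrite gmulfM /= Fsnd.
- by rewrite F1 /f /=; case: eqP.
- by rewrite F2.
Qed.

Definition crossing (j : edge_type) : A -> A -> bool := sval (cid (derivation j)).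

Lemma crossingM j a a' g : crossing j (a * a') g = crossing j a g (+) crossing j a' (a^-1 * g).
Proof. by rewrite /crossing; case: cid => d []. Qed.

Lemma crossing_iA j i x g : crossing j (iA i x) g =
  (j == inl i) && ((g == 1) (+) ((iA i x)^-1 * g == 1)).
Proof. by rewrite /crossing; case: cid => d []. Qed.

Lemma crossing_bl j l g : crossing j (bl l) g = (j == inr l) && (g == 1).
Proof. by rewrite /crossing; case: cid => d []. Qed.

Lemma crossing1 j g : crossing j 1 g = false.
Proof. by have := crossingM j 1 1 g; rewrite mulg1 invg1 mul1g addbb. Qed.

Definition factor (o : option 'I_n) : set A :=
  if o is Some i then [set y | exists x, y = iA i x] else [set 1].

Lemma factor_subgroup o : is_subgroup (factor o).
Proof.
case: o => [i|]; last exact: trivial_subgroup.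
split; first by exists 1; rewrite multiplicative1.
by move=> _ _ [x ->] [y ->]; exists (x * y^-1); rewrite gmulfM multiplicativeV.
Qed.

(* The vertices are the elements of A and the cosets of the A_i; a is joined to
   a A_i and to a b_l. *)
Definition left_coset o (a : A) : set A := [set y | factor o (a^-1 * y)].

Definition fp_vertex : Type :=
  {v : option 'I_n * set A | exists a, v.2 = left_coset v.1 a}.

Definition vmk o a : fp_vertex := exist _ (o, left_coset o a) (ex_intro _ a erefl).

Lemma vmk_eq o a o' a' : vmk o a = vmk o' a' <-> o = o' /\ factor o (a^-1 * a').
Proof.
have S := factor_subgroup o; have S1 := subgroup_mem1 S.
have SV := subgroup_memV S; have SM := subgroup_memM S.
split.
  move=> /(congr1 sval) [<- E]; split=> //.
  have : left_coset o a' a' by rewrite /left_coset /= mulVg.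
  by rewrite -E.
move=> [<- h]; have E : left_coset o a = left_coset o a'.
  apply/seteqP; split=> y; rewrite /left_coset /= => hy.
    rewrite (_ : a'^-1 * y = (a^-1 * a')^-1 * (a^-1 * y)); first exact/SM/hy/SV.
    by rewrite invgM invgK -!mulgA mulVKg.
  by rewrite -(mulVKg a' y) mulgA; apply: SM.
rewrite /vmk; move: (ex_intro _ a _) (ex_intro _ a' _) => /=; rewrite E => p q.
by rewrite (Prop_irrelevance p q).
Qed.

Lemma vmkP (v : fp_vertex) : exists o a, v = vmk o a.
Proof.
case: v => -[o c] hv; case: (hv) => a /= E; exists o, a; subst c.
by rewrite /vmk; congr exist; apply: Prop_irrelevance.
Qed.

Lemma fp_act_subproof (a : A) (v : fp_vertex) :
  exists c, [set y | (sval v).2 (a^-1 * y)] = left_coset (sval v).1 c.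
Proof.
have [o [c ->]] := vmkP v; exists (a * c); apply/seteqP.
by split=> y; rewrite /left_coset /= invgM -mulgA.
Qed.

Definition fp_act a v : fp_vertex := exist _ (_, _) (fp_act_subproof a v).

Lemma fp_act_mk a o c : fp_act a (vmk o c) = vmk o (a * c).
Proof.
rewrite /fp_act /vmk; move: (fp_act_subproof _ _) (ex_intro _ (a * c) _) => /=.
have -> : [set y | left_coset o c (a^-1 * y)] = left_coset o (a * c).
  by apply/seteqP; split=> y; rewrite /left_coset /= invgM -mulgA.
by move=> p q; rewrite (Prop_irrelevance p q).
Qed.

(** Whether the edge [(1, j)] separates the vertex 1 from [vmk o a]: go first to the element [a],
    then, for a coset, across the edge [(a, inl i)]. *)
Definition level (j : edge_type) o a : bool :=
  crossing j a 1 (+) (if o is Some i then (j == inl i) && (a == 1) else false).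

Lemma level_coset j o a h : factor o h -> level j o (a * h) = level j o a.
Proof.
case: o => [i [x ->]|->]; last by rewrite mulg1.
rewrite /level crossingM crossing_iA mulg1; case: (j == inl i); rewrite ?addbF //=.
rewrite invg_eq1.
have -> : ((iA i x)^-1 * a^-1 == 1) = (a * iA i x == 1).
  by rewrite -invgM invg_eq1.
by case: (crossing j a 1) (a == 1) (a * _ == 1) => [] [] [].
Qed.

Definition fp_side (j : edge_type) (v : fp_vertex) : Prop :=
  exists o a, v = vmk o a /\ level j o a.

Lemma fp_sideE j o a : fp_side j (vmk o a) <-> level j o a.
Proof.
split; last by exists o, a.
move=> [o' [a' [/esym/vmk_eq [<- h] l]]].
by rewrite -(level_coset j a' h) mulVKg in l.
Qed.

Definition fp_src (j : edge_type) : fp_vertex := vmk None 1.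
Definition fp_tgt (j : edge_type) : fp_vertex :=
  match j with inl i => vmk (Some i) 1 | inr l => vmk None (bl l) end.

Lemma fp_side_src j : ~ fp_side j (fp_src j).
Proof. by rewrite fp_sideE /level crossing1. Qed.

Lemma fp_side_tgt j : fp_side j (fp_tgt j).
Proof. by case: j => [i|l]; rewrite fp_sideE /level ?crossing1 ?crossing_bl !eqxx. Qed.

Lemma fp_side_edge j a j' : (a, j') <> (1, j) ->
  fp_side j (fp_act a (fp_src j')) <-> fp_side j (fp_act a (fp_tgt j')).
Proof.
move=> ne; have ne' : (j == j') && (a == 1) = false.
  by apply/negP => /andP[/eqP jj /eqP aa]; apply: ne; rewrite jj aa.
case: j' ne' {ne} => [i|l] ne; rewrite !fp_act_mk !fp_sideE /level mulg1 ?crossingM ?ne //.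
by rewrite crossing_bl mulg1 invg_eq1 ne !addbF.
Qed.

Lemma fp_conn (Q : fp_vertex -> Prop) :
  (forall a j, Q (fp_act a (fp_src j)) <-> Q (fp_act a (fp_tgt j))) ->
  forall v w, Q v -> Q w.
Proof.
move=> hQ; pose S : set A := [set c | forall a, Q (vmk None a) <-> Q (vmk None (a * c))].
have hA i a : Q (vmk None a) <-> Q (vmk (Some i) a).
  by have := hQ a (inl i); rewrite !fp_act_mk mulg1.
have S_all : forall c, S c.
  apply: generated_by_factors.
  - split=> [a|c c' Sc Sc' a]; first by rewrite mulg1.
    by rewrite (Sc a) (Sc' (a * (c * c'^-1))) mulgA mulgVK.
  - move=> i x a; rewrite (hA i a) (hA i (a * iA i x)).
    suff -> : vmk (Some i) a = vmk (Some i) (a * iA i x) by [].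
    by apply/vmk_eq; split=> //; exists x; rewrite mulKg.
  - by move=> l a; have := hQ a (inr l); rewrite !fp_act_mk mulg1.
have N v : exists a, Q v <-> Q (vmk None a).
  by have [[i|] [c ->]] := vmkP v; exists c; [apply: iff_sym; apply: hA|].
move=> v w; have [a ->] := N v; have [a' ->] := N w.
by rewrite (S_all (a^-1 * a') a) mulVKg.
Qed.

Lemma fp_act1 v : fp_act 1 v = v.
Proof. by have [o [a ->]] := vmkP v; rewrite fp_act_mk mul1g. Qed.

Lemma fp_actM a c v : fp_act (a * c) v = fp_act a (fp_act c v).
Proof. by have [o [a' ->]] := vmkP v; rewrite !fp_act_mk mulgA. Qed.

Definition fp_tree : tree_action A :=
  @TreeAction A fp_vertex fp_act fp_act1 fp_actM edge_type fp_src fp_tgt fp_side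
    fp_side_src fp_side_tgt fp_side_edge fp_conn.

Lemma fp_stabilizer a o c : tact a (vmk o c : fp_tree) = vmk o c <->
  factor o (c^-1 * a * c).
Proof.
have S := factor_subgroup o; rewrite /= fp_act_mk vmk_eq.
have E : ((a * c)^-1 * c)^-1 = c^-1 * a * c by rewrite invgM invgK mulgA.
by rewrite -E; split=> [[_ /(subgroup_memV S)]|/(subgroup_memV S)]; rewrite ?invgK.
Qed.

End FreeProduct.

Local Open Scope quotient_scope.

(** * The invariant splitting *)

Section InvariantSplitting.
Variables (A : groupType) (n : nat) (Ai : 'I_n -> groupType) (B : groupType).
Variables (iA : forall i : 'I_n, {multiplicative Ai i -> A}).
Variable iB : {multiplicative B -> A}.
Hypothesis A_free_product : is_free_product iA iB.
Variables (k : nat) (b : 'I_k -> B).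
Hypothesis B_free : forall (K : groupType) (f : 'I_k -> K),
  exists F : {multiplicative B -> K},
    (forall i, F (b i) = f i) /\
    forall F' : {multiplicative B -> K}, (forall i, F' (b i) = f i) -> F' =1 F.
Variable H : set (Out A).
Hypothesis H_subgroup : is_subgroup H.
Hypothesis H_rel : forall h : Out A, H h -> Out_rel iA h.
Hypothesis H_finite : finite_set H.

Local Notation T := (fp_tree A_free_product B_free).
Local Notation bl := (bl iB b).

Lemma preimage_subgroup : is_subgroup [set f : automorphism A | H (\pi_(Out A) f)].
Proof.
split; first exact: H_subgroup.1.
move=> f g Hf Hg; have := H_subgroup.2 _ _ Hf Hg.
by rewrite /= -[(_ g)^-1]/(Out_inv _) Out_pi_inv -[_ * _]/(Out_mul _ _) Out_pi_mul.
Qed.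

Definition autgroup : groupType := subgroup_type preimage_subgroup.

Definition conj_fun (a y : A) : A := a * y * a^-1.
Lemma conj_morph a : {morph conj_fun a : x y / x * y}.
Proof. by move=> x y; rewrite /conj_fun !mulgA mulgVK. Qed.
Lemma conj_bij a : bijective (conj_fun a).
Proof.
by exists (conj_fun a^-1) => y; rewrite /conj_fun invgK !mulgA ?mulVg ?mulgV mul1g ?mulgK ?mulgVK.
Qed.
Definition conj_aut a : automorphism A := Automorphism (@conj_morph a) (conj_bij a).

Lemma conj_aut_mem a : H (\pi_(Out A) (conj_aut a)).
Proof.
suff -> : \pi_(Out A) (conj_aut a) = 1 by exact: H_subgroup.1.
by apply/esym/eqP/Out_eqP; exists a.
Qed.

Definition inner a : autgroup := exist _ (conj_aut a) (conj_aut_mem a).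
Lemma inner_morph : {morph inner : x y / x * y}.
Proof.
move=> x y; apply: sub_val_inj; apply: autP => z /=.
by rewrite /conj_fun invgM !mulgA.
Qed.
Definition inn : {multiplicative A -> autgroup} := to_multiplicative inner_morph.

Lemma autgroup_eq (g h : autgroup) : (forall x, sval g x = sval h x) -> g = h.
Proof. by move=> E; apply: sub_val_inj; apply: autP. Qed.

Lemma inn_conj (g : autgroup) a : inn (sval g a) = g * inn a * g^-1.
Proof.
apply: autgroup_eq => y /=; rewrite /conj_fun.
by rewrite !aut_morph autV -[aut_inv_fun _ y]/(aut_inv (sval g) y) [sval g (aut_inv _ y)]aut_invK.
Qed.

Definition conjugate i a : set A := [set y | exists x, y = a * iA i x * a^-1].

(* The points are the conjugates of the non-trivial A_i, permuted by the group
   of automorphisms above H; each is its own stabilizer in A. *)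
Definition is_point (p : set A) : Prop :=
  exists i a, nontrivial_group (Ai i) /\ p = conjugate i a.

Definition point : Type := {p : set A | is_point p}.
HB.instance Definition _ := gen_eqMixin point.
HB.instance Definition _ := gen_choiceMixin point.

Lemma point_eq (p q : point) : sval p = sval q -> p = q.
Proof.
by case: p q => p hp [q hq] /= E; subst q; rewrite (Prop_irrelevance hp hq).
Qed.

Lemma pact_is_point (g : autgroup) (p : point) :
  is_point [set y | sval p (aut_inv (sval g) y)].
Proof.
have [i [a [[x0 x01] ->]]] := svalP p.
have [j [c hc]] := H_rel (svalP g) (erefl _) i.
exists j, (sval g a * c); split.
  have [x E] := (hc (sval g (iA i x0))).1 (ex_intro _ x0 erefl).
  exists x => x1; apply: x01; apply: (iA_eq1 A_free_product).
  apply: (bij_inj (aut_bij (sval g))).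
  by rewrite aut1 E x1 multiplicative1 mulg1 mulgV.
have gK y : sval g (aut_inv (sval g) y) = y by exact: aut_invK.
apply/seteqP; split=> y [x E].
  have [x' E'] := (hc _).1 (ex_intro _ x erefl).
  exists x'; rewrite -[y]gK E !aut_morph E' autV invgM !mulgA.
  by [].
have [x' E'] := (hc _).2 (ex_intro _ x erefl).
exists x'; apply: (bij_inj (aut_bij (sval g))).
by rewrite gK E !aut_morph -E' autV invgM !mulgA.
Qed.

Definition pact (g : autgroup) (p : point) : point := exist _ _ (pact_is_point g p).

Lemma pact1 p : pact 1 p = p.
Proof.
have E y : aut_inv_fun (sval (1 : autgroup)) y = y by exact: (@aut_invK A (aut_id A) y).
by apply: point_eq; apply/seteqP; split=> y; rewrite /pact /= E.
Qed.

Lemma pactM g h p : pact (g * h) p = pact g (pact h p).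
Proof.
apply: point_eq; apply/seteqP; split=> y /=;
  suff -> : aut_inv_fun (sval (g * h)) y =
    aut_inv_fun (sval h) (aut_inv_fun (sval g) y) by [];
  by apply: (bij_inj (aut_bij (sval (g * h)))); rewrite aut_invK /= !aut_invK.
Qed.

Lemma pact_inn a p y : sval (pact (inn a) p) y <-> sval p (a^-1 * y * a).
Proof.
rewrite /=; suff -> : aut_inv_fun (conj_aut a) y = a^-1 * y * a by [].
apply: (bij_inj (aut_bij (conj_aut a))); rewrite aut_invK /= /conj_fun.
by rewrite !mulgA mulgV mul1g mulgK.
Qed.

Lemma point_vertex (p : point) : exists x : T,
  (forall a, tact a x = x <-> sval p a) /\ exists i c, x = vmk iA (Some i) c.
Proof.
have [i [c [_ ->]]] := svalP p; exists (vmk iA (Some i) c); split; last by exists i, c.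
move=> a; rewrite fp_stabilizer; split=> -[x E]; exists x.
  by rewrite -E !mulgA mulgV mul1g mulgK.
by rewrite E !mulgA mulVg mul1g mulgVK.
Qed.

Definition vtx (p : point) : T := sval (cid (point_vertex p)).

Lemma vtx_stab (p : point) a : tact a (vtx p) = vtx p <-> sval p a.
Proof. by rewrite /vtx; case: cid => x []. Qed.

Lemma vtx_inj : injective vtx.
Proof.
move=> p q E; apply: point_eq; apply/seteqP.
by split=> a /vtx_stab; [rewrite E|rewrite -E] => /vtx_stab.
Qed.

Lemma point_nontrivial (p : point) : exists2 a, a <> 1 & sval p a.
Proof.
have [i [c [[x x1] ->]]] := svalP p; exists (c * iA i x * c^-1); last by exists x.
move=> E; apply: x1; apply: (iA_eq1 A_free_product).
by apply: (@mulgI _ c); apply: (@mulIg _ c^-1); rewrite E mulg1 mulgV.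
Qed.

Lemma vtx_act a p : vtx (pact (inn a) p) = tact a (vtx p).
Proof.
have [c c1 pc] := point_nontrivial p.
apply: (@fixed_unique _ _ (a * c * a^-1)).
- move=> E; apply: c1; apply: (@mulgI _ a); apply: (@mulIg _ a^-1).
  by rewrite E mulg1 mulgV.
- by apply/vtx_stab/pact_inn; rewrite !mulgA mulVg mul1g mulgVK.
- by rewrite !tactM tactK; congr tact; apply/vtx_stab.
Qed.

Lemma pact_fix a p : pact (inn a) p = p <-> sval p a.
Proof.
split=> [E|pa]; first by apply/vtx_stab; rewrite -vtx_act E.
by apply: vtx_inj; rewrite vtx_act; apply/vtx_stab.
Qed.

Variable i0 : 'I_n.
Hypothesis i0_nontrivial : nontrivial_group (Ai i0).

Lemma conjugate_point i a : nontrivial_group (Ai i) -> is_point (conjugate i a).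
Proof. by move=> h; exists i, a. Qed.

Definition cpoint i a (h : nontrivial_group (Ai i)) : point :=
  exist is_point _ (conjugate_point a h).

Definition p0 : point := cpoint 1 i0_nontrivial.

(** A trivial [A_i] gives no point; its edge becomes a loop, which [point_graph] discards. *)
Definition base_edge (j : edge_type n k) : point * point :=
  match j with
  | inl i => (p0, if pselect (nontrivial_group (Ai i)) is left h
                  then cpoint 1 h else p0)
  | inr l => (p0, pact (inn (bl l)) p0)
  end.

(** Translating by all of [autgroup] makes the graph invariant. Discarding loops makes [A] act
    freely on edges, as a non-trivial element fixes at most one point. *)
Definition point_graph : set (point * point) :=
  [set e | e.1 <> e.2 /\ exists g j, e = act2 pact g (base_edge j)].

Lemma point_graph_inv g e : point_graph e -> point_graph (pact g e.1, pact g e.2).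
Proof.
move=> [ne [h [j E]]]; split=> /=.
  move=> E'; apply: ne; have := congr1 (pact g^-1) E'.
  by rewrite -!pactM mulVg !pact1.
by exists (g * h), j; rewrite E /act2 /= !pactM.
Qed.

Lemma point_graph_free a e : point_graph e -> act2 pact (inn a) e = e -> a = 1.
Proof.
move=> [ne _]; case: e ne => p q /= ne [Ep Eq]; apply: contrapT => a1.
apply: ne; apply: vtx_inj; apply: (fixed_unique a1).
  by apply/vtx_stab/pact_fix.
by apply/vtx_stab/pact_fix.
Qed.

Lemma pact_innM a c p : pact (inn (a * c)) p = pact (inn a) (pact (inn c) p).
Proof. by rewrite gmulfM pactM. Qed.

Lemma point_graph_conn : graph_connected point_graph.
Proof.
move=> U hU.
have hb a j : U (pact (inn a) (base_edge j).1) <-> U (pact (inn a) (base_edge j).2).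
  have [->//|ne] := pselect ((base_edge j).1 = (base_edge j).2).
  apply: (hU (act2 pact (inn a) (base_edge j))); split; last by exists (inn a), j.
  move=> /= E; apply: ne; have := congr1 (pact (inn a)^-1) E.
  by rewrite -!pactM mulVg !pact1.
have hp i (h : nontrivial_group (Ai i)) a :
    U (pact (inn a) p0) <-> U (pact (inn a) (cpoint 1 h)).
  have := hb a (inl i); rewrite /base_edge /=; case: pselect => // h'.
  by rewrite (Prop_irrelevance h h').
have S_all : forall c, [set c | forall a, U (pact (inn a) p0) <-> U (pact (inn (a * c)) p0)] c.
  apply: (generated_by_factors A_free_product B_free).
  - split=> [a|c c' Sc Sc' a]; first by rewrite mulg1.
    by rewrite (Sc a) (Sc' (a * (c * c'^-1))) mulgA mulgVK.
  - move=> i x a; have [h|h] := pselect (nontrivial_group (Ai i)); last first.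
      suff -> : x = 1 by rewrite multiplicative1 mulg1.
      by apply: contrapT => x1; apply: h; exists x.
    rewrite (hp i h a) (hp i h (a * iA i x)) pact_innM.
    suff -> : pact (inn (iA i x)) (cpoint 1 h) =
      cpoint 1 h by [].
    by apply/pact_fix; exists x; rewrite mul1g invg1 mulg1.
  - by move=> l a; have := hb a (inr l); rewrite /= pact_innM.
have all_p p : U p <-> U p0.
  have [i [c [h pE]]] := svalP p.
  have -> : p = pact (inn c) (cpoint 1 h).
    apply: point_eq; rewrite pE; apply/seteqP; split=> y.
      move=> [x ->]; apply/pact_inn; exists x.
      by rewrite mul1g invg1 mulg1 !mulgA mulVg mul1g mulgVK.
    move=> /pact_inn [x E]; exists x; rewrite mul1g invg1 mulg1 in E.
    by rewrite -E !mulgA mulgV mul1g mulgK.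
  rewrite -hp; have := S_all c 1; rewrite mul1g multiplicative1 pact1.
  by tauto.
by move=> x y /all_p h; apply/all_p.
Qed.

Definition out_rep (i : fset_set H) : autgroup.
Proof.
exists (repr (val i)) => /=; rewrite reprK.
by have := valP i; rewrite in_fset_set // => /set_mem.
Defined.

Lemma out_repP g : exists a i, g = inn a * out_rep i.
Proof.
have Hg : \pi_(Out A) (sval g) \in fset_set H.
  by rewrite in_fset_set // mem_set //; exact: (svalP g).
have [a aE] := Out_reprP (sval g); exists a, [` Hg]%fset.
by apply: autgroup_eq => x; rewrite aE.
Qed.

Lemma torsion_fixed a m : (0 < m)%N -> a ^+ m = 1 -> exists p, pact (inn a) p = p.
Proof.
move=> m0 am; have [->|a1] := pselect (a = 1).
  by exists p0; rewrite multiplicative1 pact1.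
have [v av] := finite_order_fixed (vmk iA None 1 : T) m0 am.
have [o [c vE]] := vmkP v; rewrite vE fp_stabilizer in av.
case: o av {vE} => [i [x E]|E]; last first.
  by exfalso; apply: a1; apply: (@mulgI _ c^-1); apply: (@mulIg _ c); rewrite E mulg1 mulVg.
have aE : a = c * iA i x * c^-1 by rewrite -E !mulgA mulgV mul1g mulgK.
have h : nontrivial_group (Ai i).
  exists x => x1; apply: a1.
  by rewrite aE x1 multiplicative1 mulg1 mulgV.
exists (cpoint c h); apply/pact_fix; exists x; exact: aE.
Qed.

Definition cut_of (e : A * tedge T) (o : bool) : set point := [set p | side e o (vtx p)].

Lemma cut_of_translate a e o : translate pact (inn a) (cut_of e o) = cut_of (emul a e) o.
Proof.
have E p : translate pact (inn a) (cut_of e o) p <-> side e o (tact a^-1 (vtx p)).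
  by rewrite -vtx_act multiplicativeV.
apply/seteqP; split=> p; rewrite E -(side_mul a) tactVK //.
Qed.

(** Every edge is an [A]-translate of one of finitely many. Its translate by [a] crosses [e] only if
    [a^-1] carries [e] into a fixed geodesic, which is finite. *)
Lemma cut_of_finite e o : finite_set (coboundary point_graph (cut_of e o)).
Proof.
apply: (@sub_finite_set _ _ (\bigcup_(z in [set: (fset_set H * edge_type n k)%type])
  ((fun a => act2 pact (inn a) (act2 pact (out_rep z.1) (base_edge z.2))) @`
   [set a | sep (vtx (pact (out_rep z.1) (base_edge z.2).1))
                (vtx (pact (out_rep z.1) (base_edge z.2).2)) (emul a^-1 e)]))).
  move=> e' [[ne [g [j E]]] h]; have [a [i gE]] := out_repP g.
  exists (i, j) => //=; exists a; last by rewrite E gE /act2 /= !pactM.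
  have Ea : e'.1 = pact (inn a) (pact (out_rep i) (base_edge j).1).
    by rewrite E gE /= pactM.
  have Eb : e'.2 = pact (inn a) (pact (out_rep i) (base_edge j).2).
    by rewrite E gE /= pactM.
  rewrite /= -(sep_mul a) emulVK -!vtx_act -Ea -Eb.
  move: h; rewrite /cut_of /=; have := EM (side e o (vtx e'.1)).
  case=> [h1 h2|h1 h2]; [exists o|exists (~~ o)]; rewrite ?sideN; tauto.
apply: bigcup_finite; first exact: finite_finset.
move=> z _; apply: finite_image.
apply: (finite_preimage _ (sep_finite _ _)) => a c _ _ /= [].
by move=> /mulIg /invg_inj.
Qed.

(** Translates by [A] have equal size, so a maximum over the finitely many orbits of half-spaces
    bounds them all. *)
Definition cut_bound : nat :=
  (\max_(z : tedge T * bool) csize (coboundary point_graph (cut_of (1%g, z.1) z.2)))%N.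

(** Different half-trees may a priori contain the same points. The choice of [e] as first edge from
    [p] to [q] excludes this for translates: if [e] and its translate differ, then [p] or its
    translate lies in exactly one of the two cuts. *)
Lemma point_cuts p q : p <> q -> exists W, [/\ free_cut pact point_graph inn W,
  (csize (coboundary point_graph W) <= cut_bound)%N, ~ W p & W q].
Proof.
move=> pq; have /adjacent_sep [e [o [ep eq]]] : vtx p <> vtx q by move=> /vtx_inj.
exists (cut_of e (~~ o)).
have Wp : ~ cut_of e (~~ o) p by rewrite /cut_of /= -ep sideN => h; apply: h; apply: side_end.
have Wq : cut_of e (~~ o) q by rewrite /cut_of /= sideN.
split=> //; last first.
  have -> : cut_of e (~~ o) = translate pact (inn e.1) (cut_of (1, e.2) (~~ o)).
    by rewrite cut_of_translate /emul /= mulg1 -surjective_pairing.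
  rewrite (size_translate pact1 pactM point_graph_inv); last exact: cut_of_finite.
  exact: (leq_bigmax (e.2, ~~ o)).
split; first exact: cut_of_finite.
  move=> a; rewrite cut_of_translate.
  by case: (sides_nested e (~~ o) (emul a e) (~~ o)) => h;
    [constructor 1|constructor 2|constructor 3|constructor 4] => r /h.
move=> a E; rewrite cut_of_translate in E; apply: (@emul_free _ _ a e).
have ap : ~ side (emul a e) (~~ o) (vtx p).
  by move=> h; apply: Wp; rewrite -E.
have ap' : ~ side e (~~ o) (tact a (vtx p)).
  rewrite -vtx_act => h; have : cut_of e (~~ o) (pact (inn a) p) by [].
  by rewrite -E /cut_of /= vtx_act side_mul.
have aq : side (emul a e) (~~ o) (vtx q) by have := Wq; rewrite -E.
apply: contrapT => ne; have ne' : e <> emul a e by move=> h; apply: ne.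
case: (sides_nested e (~~ o) (emul a e) (~~ o)) => h.
- apply: ap; have := h _ (side_end e (~~ o)) => /(side_edge ne).
  by rewrite negbK ep.
- by apply: (h (vtx q)).
- apply: ap; apply: h; rewrite /setC /= -ep sideN => h'; apply: h'; exact: side_end.
- apply: ap'; have h' : side (emul a e) (~~ o) `<=` side e (~~ o).
    by move=> z hz; apply: contrapT => hz'; apply: (h z).
  have := h' _ (side_end (emul a e) (~~ o)) => /(side_edge ne').
  by rewrite negbK eend_mul ep.
Qed.

Hypothesis two_points : exists p1 p2 : point, p1 <> p2.

Lemma point_stab p : exists a, a <> 1 /\ pact (inn a) p = p.
Proof.
by have [a a1 pa] := point_nontrivial p; exists a; split=> //; apply/pact_fix.
Qed.

Lemma inn_normal (g : autgroup) a : exists c, inn c = g * inn a * g^-1.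
Proof. by exists (sval g a); rewrite inn_conj. Qed.

Lemma invariant_splitting : exists S : free_splitting A, relative iA S /\
  forall f : automorphism A, H (\pi_(Out A) f) -> equivariantly_isometric (twist f S) S.
Proof.
have [p1 [p2 p12]] := two_points.
have [C [fC [x0 Cx0] [y0 Cy0] Cn Cf]] := exists_free_nested_cut pact1 pactM
  point_graph_inv point_graph_conn inn_normal point_graph_free torsion_fixed
  point_cuts p12 point_stab.
have A_inf := infinite_group pact1 pactM point_graph_inv point_graph_conn
  point_graph_free point_cuts p12 point_stab.
pose T' := cut_tree pact1 pactM point_graph_inv point_graph_conn inn_normal
  point_graph_free torsion_fixed out_repP fC Cx0 Cy0 Cn Cf.
have T'_fix : ~ exists v : T', forall a, tact a v = v.
  exact: (cut_tree_no_fixed point_stab A_inf).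
pose ga (g : autgroup) : T' -> T' := @gact _ _ pact pact1 pactM C g.
have ga_adj g (v w : T') : adjacent v w -> adjacent (ga g v) (ga g w).
  exact: gact_adjacent.
have gaM g h v : ga (g * h) v = ga g (ga h v) by exact: gactM.
have ga1 v : ga 1 v = v by exact: gact1.
have gaK g v : ga g^-1 (ga g v) = v by rewrite -gaM mulVg ga1.
have gaVK g v : ga g (ga g^-1 v) = v by rewrite -gaM mulgV ga1.
have ga_inn a (v : T') : tact a v = ga (inn a) v by [].
have [j0 _] : exists j : tedge T', True by exact: cut_tree_edge.
have [S [phi [S_edges phi_bij phi_act phi_joined phi_stab]]] := bass_serre j0.
have [psi phiK psiK] := phi_bij.
have S_nofix : fixes_no_vertex S.
  by move=> [p pfix]; apply: T'_fix; exists (phi p) => a; rewrite -phi_act pfix.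
pose SF := FreeSplitting S_edges S_nofix.
exists SF; split.
  move=> i.
  have [p pfix] : exists p, forall y, pact (inn (iA i y)) p = p.
    have [h|h] := pselect (nontrivial_group (Ai i)).
      exists (cpoint 1 h) => y; apply/pact_fix; exists y.
      by rewrite mul1g invg1 mulg1.
    exists p0 => y; suff -> : y = 1 by rewrite !multiplicative1 pact1.
    by apply: contrapT => y1; apply: h; exists y.
  (* A non-trivial [A_i] fixes its own point, hence the vertex orienting every cut towards that
     point. *)
  pose u : T' := principal pact C p.
  have ufix y : tact (iA i y) u = u.
    by rewrite ga_inn /ga /u gact_principal pfix.
  have [v [a E]] := bs_mkP (psi u).
  have uE : u = tact a (phi (bs_mk v 1)).
    by rewrite -phi_act bs_act_mk mulg1 -E psiK.
  exists v, a => y.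
  have [|x xE] := phi_stab v (a^-1 * iA i y * a).
    by rewrite !tactM -uE ufix uE tactK.
  by exists x; rewrite -xE !mulgA mulgV mul1g mulgK.
move=> f Hf; pose g : autgroup := exist _ f Hf.
have [t' tK t'K] := @twist_to_bij A f SF.
have t'_act a p : t' (bs_act a p) = bs_act (aut_inv_fun f a) (t' p).
  by apply: (can_inj tK); rewrite twist_to_act aut_invK !t'K.
have psi_act a v : psi (tact a v) = bs_act a (psi v).
  by apply: (can_inj phiK); rewrite phi_act !psiK.
have g_act a v : ga g (tact (aut_inv_fun f a) v) = tact a (ga g v).
  rewrite !ga_inn -!gaM; congr ga.
  have := inn_conj g (aut_inv_fun f a); rewrite /= aut_invK => ->.
  by rewrite mulgVK.
(* Untwisting is equivariant only up to [f]; the action of [g] on the cut tree compensates this by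
   [inn_conj]. *)
pose w (p : bs_vertex (twist f SF)) : bs_vertex SF := psi (ga g (phi (t' p))).
have w_bij : bijective w.
  exists (fun p => @twist_to A f SF (psi (ga g^-1 (phi p)))) => p.
    by rewrite /w psiK gaK phiK t'K.
  by rewrite /w tK psiK gaVK phiK.
exists w; split=> //.
  by move=> a p; rewrite /w t'_act phi_act g_act psi_act.
apply: walk_bij => // p q; rewrite -{2}(t'K p) -{2}(t'K q) twist_to_joined.
rewrite !phi_joined /w !psiK; split; last exact: ga_adj.
by move=> /(ga_adj g^-1); rewrite !gaK.
Qed.

End InvariantSplitting.

Lemma fs_act1 (A : groupType) (c : fs_class A) : fs_act 1 c = c.
Proof.
have [S cS] : exists S, sval c S.
  by case: c => c [S E]; exists S; rewrite /= E; exact: isometric_refl.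
apply: (fs_classP (S := S)) => //; exists (aut_id A), S; split=> //.
by exists id; split=> //; [exists id|move=> a p; exact: bs_eqP].
Qed.

Theorem corollary5p1 (R : realType) (A : groupType) (n : nat)
    (Ai : 'I_n -> groupType) (B : groupType)
    (iA : forall i : 'I_n, {multiplicative Ai i -> A})
    (iB : {multiplicative B -> A})
    (A_free_product : is_free_product iA iB)
    (B_free : free_of_finite_rank B)
    (two_factors : two_nontrivial_factors Ai B)
    (H : set (Out A))
    (H_subgroup : is_subgroup H)
    (H_rel : forall h : Out A, H h -> Out_rel iA h)
    (H_finite : finite_set H)
    (Ai_fg : forall i : 'I_n, finitely_generated (Ai i)) :
  exists w : fs_class A -> R,
    FS_point iA w /\
    forall h : Out A, H h -> FS_point_act h w = w.
Proof.
have [k [b hb]] := B_free.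
have [i0 [i0_nt two_points]] : exists i0 (h : nontrivial_group (Ai i0)),
    exists p1 p2 : point iA, p1 <> p2.
  case: two_factors => [[i [j [ij hi hj]]]|[i [hi [y y1]]]]; exists i, hi.
    exists (cpoint iA 1 hi), (cpoint iA 1 hj) => /(congr1 sval) /= E.
    have [x x1] := hi; apply: x1; have [r [rK rj _]] := retraction A_free_product i.
    have : conjugate iA i 1 (iA i x) by exists x; rewrite mul1g invg1 mulg1.
    rewrite E => -[z]; rewrite mul1g invg1 mulg1 => Ez.
    by rewrite -(rK x) Ez rj // => ji; apply: ij.
  (* The second point is the translate of the first by [iB y]; it is different because the
     retraction onto [B] kills the factor [A_i]. *)
  have [r [rK rA]] := retraction_B A_free_product.
  exists (cpoint iA 1 hi).
  exists (pact A_free_product H_rel (inn H_subgroup (iB y)) (cpoint iA 1 hi)) => /esym.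
  move=> /(pact_fix A_free_product hb) [x]; rewrite mul1g invg1 mulg1 => E.
  by apply: y1; rewrite -(rK y) E rA.
have [S [S_rel S_inv]] :=
  invariant_splitting A_free_product hb H_subgroup H_rel H_finite i0_nt two_points.
pose c : fs_class A := exist _ (equivariantly_isometric S) (ex_intro _ S erefl).
have cS : sval c S by exact: isometric_refl.
have c_fixed h : H h -> fs_act h c = c.
  rewrite -[h]reprK => Hh; apply: (fs_classP (S := twist (repr h) S)).
    exact: fs_act_twist.
  exact/isometric_sym/S_inv.
(* The fixed point is a vertex, seen as a point of the degenerate segment from [c] to [c]. *)
have c_vertex : FS_vertex iA c by exists S.
exists (segment_point c c 0); split.
  by exists c, c, 0%R; split=> //; [left|rewrite Order.POrderTheory.lexx Num.Theory.ler01].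
move=> h Hh; apply/funext => z; rewrite /FS_point_act /segment_point.
suff -> : (fs_act h^-1 z = c) = (z = c) by [].
have HV : H h^-1 by have := H_subgroup.2 _ _ H_subgroup.1 Hh; rewrite mul1g.
apply/propext; split=> [E|->]; last exact: c_fixed.
by rewrite -(fs_act1 z) -(mulgV h) fs_actM E c_fixed.
Qed.
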